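(* The closure of each sub-branch contains a fractured solution: for every $n=1,2,\ldots$ there is $(\lambda_n^*,u_n^* )\in\overline{\mathcal C_n^o}$ with $u_n^*\in\partial\mathcal K$ and $\lambda_n^*>1$.
   Context: Let $W\in C^3(0,\infty)$ satisfy: $W(F)\nearrow\infty$ as $F\searrow0$; $W(F)\nearrow\gamma>0$ as $F\nearrow\infty$; $W(1)=0$ and $W(F)>0$ for $F\ne1$; $W$ is strictly convex on $(0,1/\kappa)$ and strictly concave on $(1/\kappa,\infty)$, where $0<\kappa<1$. Define $W^*(H)=HW(1/H)$ for $H>0$, $W^*(0)=0$, $W^*(H)=+\infty$ for $H<0$. Dots denote derivatives with respect to the argument, and $\dot W^*(0):=\dot W^*(0^+)=\gamma$. Then $W^*\in C^3(0,\infty)$, $W^*(1)=0$, $W^*>0$ on $(0,\infty)\setminus\{1\}$, and $W^*$ is strictly concave on $[0,\kappa)$ and strictly convex on $(\kappa,\infty)$. The constant $\varepsilon>0$ is fixed. $\mathcal H=\{v\in H^1(0,1):\int_0^1 v\,ds=0\}$ is the Hilbert space with inner product $\langle u,v\rangle=\int_0^1u'v'\,ds$, $\mathcal K=\{v\in\mathcal H: v\ge-1\text{ on }[0,1]\}$, $\mathcal K^o=\{v\in\mathcal K: v>-1\text{ on }[0,1]\}$ is its interior, and $\partial\mathcal K=\mathcal K\setminus\mathcal K^o$. A solution pair is $(\lambda,u)\in(0,\infty)\times\mathcal K$ with $$\int_0^1\Big[\varepsilon u'(v-u)'+\lambda^3\dot W^*\big([1+u]/\lambda\big)(v-u)\Big]ds\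 \ge\ 0\qquad\text{for all } v\in\mathcal K ;$$ it is nontrivial if $u\ne0$ ($u\equiv0$ is a solution for every $\lambda>0$). A solution is fractured if $u(s)=-1$ at some $s\in[0,1]$. The shape of the graph of $\ddot W^*$ is such that for each $n\in\mathbb N$ the characteristic equation $\varepsilon n^2\pi^2/\lambda^2=-\ddot W^*(1/\lambda)$ has exactly one root $\lambda=\lambda_n>0$, which is simple and transversal (the two sides, as functions of $1/\lambda$, cross with different slopes), and $1/\kappa<\lambda_1<\lambda_2<\cdots$. $\mathcal S$ is the closure in $(0,\infty)\times\mathcal H$ of the set of nontrivial solution pairs, $\mathcal C_n$ is the connected component of $\mathcal S$ containing $(\lambda_n,0)$, and the sub-branch $\mathcal C_n^o$ is the connected component of $\mathcal C_n\cap\big((0,\infty)\times\mathcal K^o\big)$ containing $(\lambda_n,0)$. *)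

(* Defs.v *)
From HB Require Import structures.
From mathcomp Require Import all_boot all_order all_algebra.
From mathcomp Require Import ring lra.
From mathcomp Require Import all_classical all_reals all_analysis.
From mathcomp Require Import measurable_realfun.

Set Implicit Arguments.
Unset Strict Implicit.
Unset Printing Implicit Defensive.

Import Order.TTheory GRing.Theory Num.Theory.
Import numFieldNormedType.Exports.

Local Open Scope classical_set_scope.
Local Open Scope ring_scope.

Section H1.
Context {R : realType}.
Local Notation mu := (@lebesgue_measure R).
Local Notation I01 := (`[0%R, 1%R]%classic : set (measurableTypeR R)).

(* An element of H^1(0, 1) is identified with its absolutely continuous
   representative on [0, 1], i.e. the primitive of an L^2 function g = u',
   which is unique up to a null set (H1_derivative_ae). *)
Definition H1_derivative (u g : R -> R) : Prop :=
  [/\ measurable_fun I01 g,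
      mu.-integrable I01 (EFin \o (fun s => g s ^+ 2)) &
      forall s, I01 s -> u s = u 0 + \int[mu]_(t in `[0%R, s]) g t].

(* Functions are extended by 0 outside [0, 1], so that equality in the space is
   equality of functions on R. *)
Definition zero_mean_H1 : set (R -> R) := [set u |
  [/\ exists g, H1_derivative u g,
      \int[mu]_(s in I01) u s = 0 &
      forall s, ~ I01 s -> u s = 0]].

Lemma mI01 : measurable I01. Proof. exact: measurable_itv. Qed.

Lemma L2M (g h : R -> R) :
  measurable_fun I01 g -> mu.-integrable I01 (EFin \o (fun s => g s ^+ 2)) ->
  measurable_fun I01 h -> mu.-integrable I01 (EFin \o (fun s => h s ^+ 2)) ->
  mu.-integrable I01 (EFin \o (fun s => g s * h s)).
Proof.
move=> mg ig mh ih.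
apply: (le_integrable mI01 _ _ (integrableD mI01 ig ih)).
  by apply/measurable_EFinP; exact: measurable_funM.
move=> s _ /=; rewrite lee_fin [leRHS]ger0_norm ?addr_ge0 ?sqr_ge0//.
rewrite normrM -[g s ^+ 2]real_normK ?num_real//.
rewrite -[h s ^+ 2]real_normK ?num_real//.
have := sqr_ge0 (`|g s| - `|h s|).
have := normr_ge0 (g s); have := normr_ge0 (h s).
by move: `|g s| `|h s| => a b b0 a0; nra.
Qed.

Lemma I01_cst (c : R) : mu.-integrable I01 (EFin \o cst c).
Proof.
apply: continuous_compact_integrable; first exact: segment_compact.
by apply: continuous_subspaceT => x; exact: cst_continuous.
Qed.

Lemma L2_L1 (g : R -> R) :
  measurable_fun I01 g -> mu.-integrable I01 (EFin \o (fun s => g s ^+ 2)) ->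
  mu.-integrable I01 (EFin \o g).
Proof.
move=> mg ig.
have -> : EFin \o g = EFin \o (fun s => g s * cst 1 s).
  by apply/funext => s /=; rewrite mulr1.
apply: L2M => //.
have -> : (fun s : R => cst 1 s ^+ 2 : R) = cst 1.
  by apply/funext => s /=; rewrite expr1n.
exact: I01_cst.
Qed.

Lemma sub_int (f : R -> R) s : I01 s -> mu.-integrable I01 (EFin \o f) ->
  mu.-integrable `[0%R, s] (EFin \o f).
Proof.
move=> s01; apply: integrableS; [exact: mI01|exact: measurable_itv|].
move: s01; rewrite /= in_itv/= => /andP[_ s1] x /=; rewrite !in_itv/=.
by move=> /andP[-> /le_trans ->].
Qed.

Lemma primitive0 (f : R -> R) : mu.-integrable I01 (EFin \o f) ->
  (forall s, I01 s -> \int[mu]_(t in `[0%R, s]) f t = 0) ->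
  ae_eq mu I01 f (cst 0).
Proof.
move=> fi f0.
have fiT : mu.-integrable setT (EFin \o f \_ I01).
  by rewrite -restrict_EFin -integrable_mkcond//; exact: mI01.
have F0 : (fun x => \int[mu]_(t in `]-oo, x]) (f \_ I01) t) = cst 0.
  apply/funext => x; rewrite -Rintegral_mkcondr /=.
  have [x0|x0] := ltP x 0.
    rewrite [X in Rintegral _ X](_ : _ = set0) ?Rintegral_set0//.
    apply/seteqP; split => // y /=; rewrite !in_itv/= => -[yx /andP[y0 _]].
    by move: (le_trans y0 yx); rewrite leNgt x0.
  have [x1|x1] := leP x 1.
    rewrite [X in Rintegral _ X](_ : _ = `[0%R, x]%classic).
      by rewrite f0//= in_itv/= x0.
    apply/seteqP; split => y /=; rewrite !in_itv/=.
      by move=> [-> /andP[->]].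
    by move=> /andP[-> yx]; split => //; rewrite (le_trans yx).
  rewrite setIidr ?f0//=; first by rewrite in_itv/= ler01 lexx.
  by move=> y /=; rewrite !in_itv/= => /andP[_ /le_trans ->//]; exact: ltW.
have /(_ _ _)/= := @FTC1Ny R (f \_ I01).
rewrite F0 => /(_ _ _).
have h1 y : mu.-integrable `]-oo, y] (EFin \o f \_ I01).
  by apply: integrableS fiT => //; exact: measurable_itv.
move=> /(_ h1 (integrable_locally mI01 fi)).
apply: (@filterS _ _ (ae_filter_ringOfSetsType mu)).
move=> x [_] + x01.
by rewrite patchE mem_set// => <-; exact: derive1_cst.
Qed.

Lemma H1_derivative_ae (u g h : R -> R) :
  H1_derivative u g -> H1_derivative u h -> ae_eq mu I01 g h.
Proof.
move=> [mg ig ug] [mh ih uh].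
have ig1 := L2_L1 mg ig; have ih1 := L2_L1 mh ih.
have : ae_eq mu I01 (fun s => g s - h s) (cst 0).
  apply: primitive0 => [|s s01]; first exact: (integrableB mI01 ig1 ih1).
  rewrite RintegralB//; [|exact: sub_int..].
  by apply/eqP; rewrite subr_eq0; apply/eqP/(addrI (u 0)); rewrite -ug// -uh.
apply: (@filterS _ _ (ae_filter_ringOfSetsType mu)).
by move=> x /= H /H /eqP; rewrite subr_eq0 => /eqP.
Qed.

Lemma H1_derivativeD (u v g h : R -> R) : H1_derivative u g ->
  H1_derivative v h -> H1_derivative (u + v) (g + h).
Proof.
move=> [mg ig ug] [mh ih uh]; split.
- exact: measurable_funD.
- have -> : EFin \o (fun s => (g + h) s ^+ 2) =
      ((EFin \o (fun s => g s ^+ 2)) \+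
        ((EFin \o (fun s => g s * h s)) \+ (EFin \o (fun s => g s * h s)))) \+
      (EFin \o (fun s => h s ^+ 2)).
    apply/funext => s /=; rewrite -!EFinD; congr EFin.
    by have -> : (g + h) s = g s + h s by []; ring.
  have igh := L2M mg ig mh ih.
  by apply: integrableD => //; repeat (apply: integrableD => //).
- move=> s s01; have E t : (u + v) t = u t + v t by [].
  rewrite !E ug// uh// RintegralD//.
  + by rewrite addrACA.
  + exact: sub_int s01 (L2_L1 mg ig).
  + exact: sub_int s01 (L2_L1 mh ih).
Qed.

Lemma H1_derivativeZ (a : R) (u g : R -> R) :
  H1_derivative u g -> H1_derivative (a *: u) (a *: g).
Proof.
move=> [mg ig ug]; split.
- exact: measurable_funM.
- have -> : EFin \o (fun s => (a *: g) s ^+ 2) =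
      (fun s => (a ^+ 2)%:E * (EFin \o (fun s => g s ^+ 2)%R) s)%E.
    by apply/funext => s /=; rewrite -EFinM -exprMn.
  exact: integrableZl.
- move=> s s01; have E t : (a *: u) t = a * u t by [].
  rewrite !E ug// mulrDr RintegralZl//.
  exact: sub_int s01 (L2_L1 mg ig).
Qed.

Lemma H1_derivative_integrable (u g : R -> R) :
  H1_derivative u g -> mu.-integrable I01 (EFin \o u).
Proof.
move=> [mg ig ug].
have ig1 := L2_L1 mg ig.
have : mu.-integrable I01 (EFin \o
    (fun s => cst (u 0) s + parameterized_integral mu 0 s g)).
  apply: (integrableD mI01 (I01_cst (u 0))
    (_ : mu.-integrable I01 (EFin \o (fun s => parameterized_integral mu 0 s g)))).
  apply: continuous_compact_integrable; first exact: segment_compact.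
  exact: parameterized_integral_continuous.
apply: eq_integrable; first exact: mI01.
by move=> s; rewrite inE => s01; rewrite /= [in RHS]ug.
Qed.

Definition zero_mean_H1_pred : {pred R -> R} := mem zero_mean_H1.

Lemma zero_mean_H1_submod : submod_closed zero_mean_H1_pred.
Proof.
split.
  rewrite inE; split.
  - exists (cst 0); split => //.
    + rewrite (_ : (fun s : R => _) = cst 0) ?I01_cst//.
      by apply/funext => s /=; rewrite expr0n.
    + by move=> s _; rewrite Rintegral_cst//= mul0r addr0.
  - by rewrite Rintegral_cst//= ?mul0r//; exact: mI01.
  - by [].
move=> a u v; rewrite !inE => -[[g ug] u0 uE] [[h vh] v0 vE]; split.
- by exists (a *: g + h); exact: H1_derivativeD (H1_derivativeZ a ug) vh.
- have iu := H1_derivative_integrable ug.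
  have iv := H1_derivative_integrable vh.
  rewrite RintegralD//.
  + by rewrite RintegralZl// u0 v0 mulr0 addr0.
  + exact: (integrableZl mI01 a iu).
- move=> s s01; have -> : (a *: u + v) s = a * u s + v s by [].
  by rewrite uE// vE// mulr0 addr0.
Qed.

HB.instance Definition _ := GRing.isSubmodClosed.Build _ _
  zero_mean_H1_pred zero_mean_H1_submod.

Record H1m : Type := MkH1m {
  H1m_fun :> R -> R;
  H1m_funP : H1m_fun \in zero_mean_H1_pred }.

HB.instance Definition _ := [isSub for H1m_fun].
HB.instance Definition _ := [Choice of H1m by <:].
HB.instance Definition _ := [SubChoice_isSubLmodule of H1m by <:].

(* only determined almost everywhere; it does not depend on representatives
   under the integrals below (H1m_dotE) *)
Definition H1m_deriv (u : H1m) : R -> R := xget (cst 0) (H1_derivative u).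

Definition H1m_dot (u v : H1m) : R :=
  \int[mu]_(s in I01) (H1m_deriv u s * H1m_deriv v s).

Definition H1m_norm (u : H1m) : R := Num.sqrt (H1m_dot u u).

Lemma H1m_zero_mean (u : H1m) : zero_mean_H1 u.
Proof. by have := H1m_funP u; rewrite inE. Qed.

Lemma H1m_derivP (u : H1m) : H1_derivative u (H1m_deriv u).
Proof.
have [[g ug] _ _] := H1m_zero_mean u.
exact: (@xgetPex _ (cst 0) (H1_derivative u) (ex_intro _ g ug)).
Qed.

Lemma H1m_dotE (u v : H1m) (g h : R -> R) :
  H1_derivative u g -> H1_derivative v h ->
  H1m_dot u v = \int[mu]_(s in I01) (g s * h s).
Proof.
move=> ug vh; have [mu' _ _] := H1m_derivP u; have [mv' _ _] := H1m_derivP v.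
have [mg _ _] := ug; have [mh _ _] := vh.
rewrite /H1m_dot /Rintegral; congr fine.
apply: ae_eq_integral; first exact: mI01.
- by apply/measurable_EFinP; exact: measurable_funM.
- by apply/measurable_EFinP; exact: measurable_funM.
have := H1_derivative_ae (H1m_derivP u) ug.
have := H1_derivative_ae (H1m_derivP v) vh.
apply: (@filterS2 _ _ (ae_filter_ringOfSetsType mu)).
by move=> x /= + + x01 => -> // ->.
Qed.

Lemma H1m_dotC (u v : H1m) : H1m_dot u v = H1m_dot v u.
Proof. by apply: eq_Rintegral => s _; rewrite mulrC. Qed.

Lemma H1m_dot_ge0 (u : H1m) : 0 <= H1m_dot u u.
Proof. by apply: Rintegral_ge0 => s _; rewrite -expr2 sqr_ge0. Qed.

Lemma H1m_dotDl (u v w : H1m) : H1m_dot (u + v) w = H1m_dot u w + H1m_dot v w.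
Proof.
have [mu' iu _] := H1m_derivP u; have [mv' iv _] := H1m_derivP v.
have [mw' iw _] := H1m_derivP w.
rewrite (@H1m_dotE (u + v) w _ _ (H1_derivativeD (H1m_derivP u) (H1m_derivP v)) (H1m_derivP w)).
rewrite -RintegralD; [|exact: mI01|exact: L2M|exact: L2M].
by apply: eq_Rintegral => s _; rewrite -mulrDl.
Qed.

Lemma H1m_dotZl a (u w : H1m) : H1m_dot (a *: u) w = a * H1m_dot u w.
Proof.
have [mu' iu _] := H1m_derivP u; have [mw' iw _] := H1m_derivP w.
rewrite (@H1m_dotE (a *: u) w _ _ (H1_derivativeZ a (H1m_derivP u)) (H1m_derivP w)).
rewrite -RintegralZl; [|exact: mI01|exact: L2M].
by apply: eq_Rintegral => s _; rewrite mulrA.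
Qed.

Lemma H1m_CauchySchwarz (u v : H1m) :
  H1m_dot u v <= H1m_norm u * H1m_norm v.
Proof.
have uu := H1m_dot_ge0 u; have vv := H1m_dot_ge0 v.
have key a b :
    0 <= a ^+ 2 * H1m_dot u u + 2 * (a * b) * H1m_dot u v + b ^+ 2 * H1m_dot v v.
  have := H1m_dot_ge0 (a *: u + b *: v).
  rewrite H1m_dotDl !H1m_dotZl [H1m_dot u (_ + _)]H1m_dotC.
  rewrite [H1m_dot v (_ + _)]H1m_dotC !H1m_dotDl !H1m_dotZl.
  by rewrite [H1m_dot v u]H1m_dotC; congr (0 <= _); ring.
have CS2 : (H1m_dot u v) ^+ 2 <= H1m_dot u u * H1m_dot v v.
  have [v0|v0] := eqVneq (H1m_dot v v) 0.
    have := key (- H1m_dot u v) ((H1m_dot u u + 1) / 2).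
    rewrite v0 => h; suff -> : H1m_dot u v = 0 by rewrite expr0n mulr0.
    have h1 : 0 <= - (H1m_dot u v ^+ 2) by move: h; nra.
    apply/eqP; rewrite -sqrf_eq0; apply/eqP/le_anti.
    by rewrite sqr_ge0 andbT -oppr_ge0.
  have vp : 0 < H1m_dot v v by rewrite lt_def v0.
  have := key (H1m_dot v v) (- H1m_dot u v).
  rewrite -(pmulr_rge0 _ vp) => h.
  have : 0 <= H1m_dot v v * (H1m_dot u u * H1m_dot v v - H1m_dot u v ^+ 2).
    rewrite -(pmulr_rge0 _ vp); move: h; congr (0 <= _); ring.
  by rewrite pmulr_rge0// subr_ge0.
rewrite /H1m_norm -sqrtrM// (le_trans (ler_norm _))//.
by rewrite -sqrtr_sqr ler_wsqrtr.
Qed.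

Lemma H1m_norm_sqr (u : H1m) : H1m_norm u ^+ 2 = H1m_dot u u.
Proof. by rewrite sqr_sqrtr// H1m_dot_ge0. Qed.

Lemma H1m_normD (u v : H1m) : H1m_norm (u + v) <= H1m_norm u + H1m_norm v.
Proof.
have nn w : 0 <= H1m_norm w by exact: sqrtr_ge0.
rewrite -(@ler_pXn2r _ 2)// ?nnegrE ?addr_ge0//.
rewrite sqrrD !H1m_norm_sqr H1m_dotDl [H1m_dot u (_ + _)]H1m_dotC.
rewrite [H1m_dot v (_ + _)]H1m_dotC !H1m_dotDl [H1m_dot v u]H1m_dotC.
by have := H1m_CauchySchwarz u v; lra.
Qed.

Lemma H1m_normZ a (u : H1m) : H1m_norm (a *: u) = `|a| * H1m_norm u.
Proof.
rewrite /H1m_norm H1m_dotZl H1m_dotC H1m_dotZl mulrA -expr2.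
by rewrite sqrtrM ?sqr_ge0// sqrtr_sqr.
Qed.

Lemma H1m_norm_eq0 (u : H1m) : H1m_norm u = 0 -> u = 0.
Proof.
move=> u0; have [mg ig ug] := H1m_derivP u.
have [_ um uE] := H1m_zero_mean u.
set g := H1m_deriv u in mg ig ug.
have g0 : \int[mu]_(s in I01) (g s * g s) = 0.
  by have := H1m_norm_sqr u; rewrite u0 expr0n.
have gae : ae_eq mu I01 (EFin \o (fun s => g s * g s)) (cst 0%E).
  apply/(ae_eq_integral_abs _ mI01).
    by apply/measurable_EFinP; exact: measurable_funM.
  under eq_integral do rewrite gee0_abs ?lee_fin -?expr2 ?sqr_ge0//.
  rewrite -[LHS]fineK.
    by congr EFin; exact: g0.
  exact: (integrable_fin_num mI01 ig).
have gz s : I01 s -> \int[mu]_(t in `[0%R, s]) g t = 0.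
  move=> s01.
  transitivity (\int[mu]_(t in `[0%R, s]) (cst 0 t : R)); last first.
    by rewrite Rintegral_cst//= mul0r.
  rewrite /Rintegral; congr fine; apply: ae_eq_integral => //.
  - apply/measurable_EFinP.
    have := sub_int s01 (L2_L1 mg ig).
    by move=> /integrableP[/measurable_EFinP].
  - by apply/measurable_EFinP; exact: measurable_cst.
  - apply: (@filterS _ _ (ae_filter_ringOfSetsType mu)) gae.
    move=> x /= H xs; congr EFin.
    have /H [] : I01 x.
      move: s01 xs; rewrite /= !in_itv/= => /andP[_ s1] /andP[->] /le_trans.
      exact.
    by move=> /eqP; rewrite mulf_eq0 orbb => /eqP.
have uc s : I01 s -> u s = u 0 by move=> s01; rewrite ug// gz// addr0.
have uz : u 0 = 0.
  have := um; rewrite (@eq_Rintegral _ _ _ mu _ (cst (u 0))); last first.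
    by move=> s; rewrite inE => s01; rewrite uc.
  rewrite Rintegral_cst; last exact: mI01.
  rewrite [X in fine X]lebesgue_measure_itv.
  by rewrite /= lte_fin ltr01 /= oppr0 addr0 mulr1.
apply/val_inj/funext => s /=.
have [s01|s01] := pselect (I01 s); last exact: uE.
by rewrite uc.
Qed.

HB.instance Definition _ :=
  Lmodule_isNormed.Build R H1m H1m_normD H1m_normZ H1m_norm_eq0.

End H1.

Arguments H1m R : clear implicits.

Section stored_energy.
Context {R : realType}.
Implicit Types (W : R -> R) (A : set R).

Definition strictly_convex_on A (f : R -> R) : Prop :=
  forall x y t, A x -> A y -> x != y -> 0 < t < 1 ->
    f (t * x + (1 - t) * y) < t * f x + (1 - t) * f y.

Definition strictly_concave_on A (f : R -> R) : Prop :=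
  strictly_convex_on A (fun x => - f x).

Definition C3_pos (f : R -> R) : Prop :=
  (forall k x, (k < 3)%N -> 0 < x -> derivable (f^`(k)%classic) x 1) /\
  (forall x, 0 < x -> {for x, continuous (f^`(3)%classic)}).

Record stored_energy W (gamma kappa : R) : Prop := {
  energy_C3 : C3_pos W;
  energy_cvg0 : W F @[F --> 0^'+] --> +oo;
  energy_mono0 :
    exists2 d, 0 < d & {in `]0, d[ &, {homo W : x y / x <= y >-> y <= x}};
  energy_gamma_gt0 : 0 < gamma;
  energy_cvgy : W F @[F --> +oo] --> gamma;
  energy_monoy :
    exists M, {in `]M, +oo[ &, {homo W : x y / x <= y}};
  energy1 : W 1 = 0;
  energy_gt0 : forall F, 0 < F -> F != 1 -> 0 < W F;
  energy_kappa : 0 < kappa < 1;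
  energy_convex : strictly_convex_on `]0, kappa^-1[ W;
  energy_concave : strictly_concave_on `]kappa^-1, +oo[ W }.

Definition Wstar W (H : R) : \bar R :=
  if 0 < H then (H * W H^-1)%:E else if H == 0 then 0%E else +oo%E.

(* Wstar is finite on [0, +oo), the only place where it is differentiated *)
Definition Wstar_fin W : R -> R := fine \o Wstar W.

(* gamma is the right limit at 0 of the derivative of Wstar *)
Definition dWstar W (gamma H : R) : R :=
  if H == 0 then gamma else (Wstar_fin W)^`()%classic H.

Definition char_root W (eps : R) (n : nat) (l : R) : Prop :=
  0 < l /\
  eps * n%:R ^+ 2 * pi ^+ 2 / l ^+ 2 = - (Wstar_fin W)^`(2)%classic l^-1.

(* both sides of the equation as functions of m = 1 / l *)
Definition char_transversal W (eps : R) (n : nat) (l : R) : Prop :=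
  (fun m : R => eps * n%:R ^+ 2 * pi ^+ 2 * m ^+ 2)^`()%classic l^-1 !=
  (fun m : R => - (Wstar_fin W)^`(2)%classic m)^`()%classic l^-1.

(* lambda 0 is not used *)
Record char_roots W (kappa eps : R) (lambda : nat -> R) : Prop := {
  char_unique : forall n l, (0 < n)%N -> char_root W eps n l <-> l = lambda n;
  char_simple : forall n, (0 < n)%N -> char_transversal W eps n (lambda n);
  char_gt_kappa : kappa^-1 < lambda 1%N;
  char_increasing : forall n m,
    (0 < n)%N -> (n < m)%N -> lambda n < lambda m }.

End stored_energy.

Section branches.
Context {R : realType}.
Local Notation mu := (@lebesgue_measure R).
Implicit Types (W : R -> R) (gamma eps : R) (p : R * H1m R).

Definition coneK : set (H1m R) :=
  [set v | forall s, s \in `[0, 1] -> -1 <= v s].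

Definition coneKo : set (H1m R) :=
  [set v | coneK v /\ forall s, s \in `[0, 1] -> -1 < v s].

Definition bdryK : set (H1m R) := coneK `\` coneKo.

Definition solution W gamma eps p : Prop :=
  let: (l, u) := p in
  [/\ 0 < l, coneK u & forall v, coneK v ->
    0 <= \int[mu]_(s in `[0, 1])
      (eps * H1m_deriv u s * H1m_deriv (v - u) s +
       l ^+ 3 * dWstar W gamma ((1 + u s) / l) * (v s - u s))].

Definition fractured W gamma eps p : Prop :=
  solution W gamma eps p /\ exists2 s, s \in `[0, 1] & p.2 s = -1.

Definition nontrivial_solutions W gamma eps : set (R * H1m R) :=
  [set p | solution W gamma eps p /\ p.2 != 0].

(* The closure in (0, +oo) x H is the trace of the closure in R x H; components
   and the other closures are unaffected by the choice of ambient space. *)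
Definition solution_closure W gamma eps : set (R * H1m R) :=
  closure (nontrivial_solutions W gamma eps) `&` [set p | 0 < p.1].

Definition branch W gamma eps (l0 : R) : set (R * H1m R) :=
  connected_component (solution_closure W gamma eps) (l0, 0).

Definition subbranch W gamma eps (l0 : R) : set (R * H1m R) :=
  connected_component
    (branch W gamma eps l0 `&` [set p | 0 < p.1 /\ coneKo p.2]) (l0, 0).

End branches.

(* Main.v *)
Require Import Defs.
From HB Require Import structures.
From mathcomp Require Import all_boot all_order all_algebra.
From mathcomp Require Import ring lra.
From mathcomp Require Import all_classical all_reals all_analysis.
From mathcomp Require Import measurable_realfun.
Set Implicit Arguments.
Unset Strict Implicit.
Unset Printing Implicit Defensive.
Import Order.TTheory GRing.Theory Num.Theory.
Import numFieldNormedType.Exports.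
Local Open Scope classical_set_scope.
Local Open Scope ring_scope.

(** Inside the cone, and also when it is touched tangentially, the equilibria with
    n monotone pieces are explicit. With H = (1 + u) / lambda the variational
    inequality becomes a Neumann problem for H'' = p H - m in the scaled variable
    lambda s / sqrt eps, where p is the derivative of the dual energy w and m a
    multiplier; it is integrated by quadrature. An orbit is determined by its
    trough a and its crest b, m being the slope of the chord of w over [a, b], and
    the velocity is the square root of twice the excess of w over that chord. The
    length of n half periods has to be lambda / sqrt eps and the mean of H has to be
    1 / lambda. Eliminating lambda leaves a single equation: the integral of H over
    half a period, the half mass, is equal to 1 / (n sqrt eps).

    So the branch is a level set in the plane, with coordinates (a / b, b). On the
    side a = b the equation reduces to the characteristic equation and has the only
    solution b = 1 / lambda_n. Where b is small the half mass is small, because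
    uniqueness of the characteristic roots forces - w''(h) / h ^ 2 to infinity at 0
    (p2_below_root, half_mass_small). Where b = 1, and more generally where w does
    not strictly exceed its chord, the half mass is infinite, logarithmically so for
    the homoclinic orbits (half_mass_diverges). A discrete path-counting argument
    then yields a connected part of the level set that joins the bifurcation point
    to the side a = r b for every r > 0 (level_continuum). Its image under the
    continuous map from orbits to pairs (load, displacement) lies in the sub-branch,
    and a limit point as r tends to 0 is an orbit with trough 0: a fractured
    equilibrium. Finally b < 1 bounds the mean of H by 1, whence lambda > 1.

    Two devices remove the singularities of the quadrature. The height is written
    H = b - (b - a) (1 + cos t) / 2, and the excess of w over its chord is
    (H - a) (b - H) times a divided difference, the gap, so that the time along the
    orbit is the integral of 1 / sqrt (2 gap) over t, without singularity at the
    turning points. And the gap is cut off from below by a small d; by compactness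
    the cut-off is inactive on the level set (uniform_gap). *)

(** * Continuous maps and near-by points *)
Lemma continuous_pair (X Y Z : topologicalType) (f : X -> Y) (g : X -> Z) x :
  {for x, continuous f} -> {for x, continuous g} ->
  {for x, continuous (fun t => (f t, g t))}.
Proof. by move=> cf cg; exact: (cvg_pair cf cg). Qed.

Lemma closed_preimage (X Y : topologicalType) (f : X -> Y) (D : set Y) :
  continuous f -> closed D -> closed (f @^-1` D).
Proof. by move=> cf cD; apply: closed_comp => // x _; exact: cf. Qed.

Lemma continuous_slice2 (X Y Z : topologicalType) (f : X * Y -> Z) x :
  continuous f -> continuous (fun y => f (x, y)).
Proof.
move=> cf y; apply: (@continuous_comp _ _ _ (fun y => (x, y)) f); last exact: cf.
by apply: continuous_pair => //; exact: cst_continuous.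
Qed.

Lemma continuous_slice1 (X Y Z : topologicalType) (f : X * Y -> Z) y :
  continuous f -> continuous (fun x => f (x, y)).
Proof.
move=> cf x; apply: (@continuous_comp _ _ _ (fun x => (x, y)) f); last exact: cf.
by apply: continuous_pair => //; exact: cst_continuous.
Qed.

Lemma continuous_comp_fst (X Y Z : topologicalType) (f : X -> Z) :
  continuous f -> continuous (fun xy : X * Y => f xy.1).
Proof.
move=> cf xy; apply: (@continuous_comp _ _ _ fst f); first exact: cvg_fst.
exact: cf.
Qed.

Lemma near_lt (R : realType) (X : topologicalType) (f : X -> R) x c :
  {for x, continuous f} -> f x < c -> \forall y \near x, f y < c.
Proof. by move=> cf; exact: (cvgr_lt (f x) cf). Qed.

Lemma near_gt (R : realType) (X : topologicalType) (f : X -> R) x c :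
  {for x, continuous f} -> c < f x -> \forall y \near x, c < f y.
Proof. by move=> cf; exact: (cvgr_gt (f x) cf). Qed.

(** * Zero sets of continuous functions on a rectangle *)

Section grid.
Context {R : realType}.

Lemma IVT_sign (g : R -> R) x y : continuous g -> x <= y ->
  (0 < g x) != (0 < g y) -> exists2 z, x <= z <= y & g z = 0.
Proof.
move=> cg xy sgn.
have [|z zxy gz] := @IVT R g x y 0 xy (continuous_subspaceT cg).
  by move: sgn; rewrite ge_min le_max; case: (ltrP 0 (g x)) => h1;
    case: (ltrP 0 (g y)) => h2 //= _; rewrite ?h1 ?h2 ?(ltW h1) ?(ltW h2) ?orbT.
by exists z => //; move: zxy; rewrite in_itv.
Qed.

Definition rect (r t b0 b1 : R) : set (R * R) :=
  [set x | r <= x.1 <= t /\ b0 <= x.2 <= b1].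

(** A Hex argument modulo 2 on a fine grid. Count, in each column of vertical
    edges, the edges across which f changes sign and that are close to A. Each
    such edge contains a zero of f, and zeros in the same cell lie on the same
    side of the separation; going around the cells between two columns, sign
    changes come in pairs, so the parity of the count does not depend on the
    column. It is even on the left, where A is absent, and odd on the right,
    where all the sign changes from bottom to top are counted. *)
Lemma no_separation (f : R * R -> R) (r t b0 b1 e : R) (A B : set (R * R)) :
  continuous f -> r < t -> b0 < b1 -> 0 < e ->
  (forall s, r <= s <= t -> f (s, b0) < 0) ->
  (forall s, r <= s <= t -> 0 < f (s, b1)) ->
  (forall x, rect r t b0 b1 x -> f x = 0 -> A x \/ B x) ->
  (forall x y, A x -> B y -> `|x - y| < e -> False) ->
  (forall b, ~ A (r, b)) -> (forall b, ~ B (t, b)) -> False.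
Proof.
move=> cf rt b01 e0 fb0 fb1 fAB AB A0 B1.
pose M := Num.max (t - r) (b1 - b0).
have M0 : 0 < M by rewrite lt_max subr_gt0 rt.
pose N := (Num.truncn (M / e)).+1.
have NM : M / N%:R < e.
  rewrite ltr_pdivrMr ?ltr0n// mulrC -ltr_pdivrMr//; exact: truncnS_gt.
have N0 : 0 < N%:R :> R by rewrite ltr0n.
pose T i := r + (t - r) / N%:R * i%:R.
pose Y j := b0 + (b1 - b0) / N%:R * j%:R.
have hT : 0 <= (t - r) / N%:R < e.
  rewrite divr_ge0 ?subr_ge0 ?(ltW rt)//=; apply: le_lt_trans NM.
  by rewrite ler_pM2r ?invr_gt0// le_max lexx.
have hY : 0 <= (b1 - b0) / N%:R < e.
  rewrite divr_ge0 ?subr_ge0 ?(ltW b01)//=; apply: le_lt_trans NM.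
  by rewrite ler_pM2r ?invr_gt0// le_max lexx orbT.
have TS i : T i.+1 = T i + (t - r) / N%:R by rewrite /T -addn1 natrD; ring.
have YS j : Y j.+1 = Y j + (b1 - b0) / N%:R by rewrite /Y -addn1 natrD; ring.
have T0 : T 0%N = r by rewrite /T mulr0 addr0.
have Y0 : Y 0%N = b0 by rewrite /Y mulr0 addr0.
have TN : T N = t by rewrite /T divfK ?gt_eqF//; ring.
have YN : Y N = b1 by rewrite /Y divfK ?gt_eqF//; ring.
have Tin i : (i <= N)%N -> r <= T i <= t.
  move=> iN; apply/andP; split.
    by rewrite /T lerDl mulr_ge0 ?ler0n ?(andP hT).1.
  by rewrite -[leRHS]TN /T lerD2l ler_wpM2l ?(andP hT).1 // ler_nat.
have Yin j : (j <= N)%N -> b0 <= Y j <= b1.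
  move=> jN; apply/andP; split.
    by rewrite /Y lerDl mulr_ge0 ?ler0n ?(andP hY).1.
  by rewrite -[leRHS]YN /Y lerD2l ler_wpM2l ?(andP hY).1 // ler_nat.
pose s i j := 0 < f (T i, Y j).
pose cell i j : set (R * R) := rect (T i) (T i.+1) (Y j) (Y j.+1).
pose vedge i j : set (R * R) := [set x | x.1 = T i /\ Y j <= x.2 <= Y j.+1].
pose hedge i j : set (R * R) := [set x | T i <= x.1 <= T i.+1 /\ x.2 = Y j].
pose q (E : set (R * R)) := `[< exists2 x, E x & A x >].
(* a cell is smaller than the distance e between A and B *)
have qE i j (E : set (R * R)) : (i < N)%N -> (j < N)%N -> E `<=` cell i j ->
    (exists2 z, E z & f z = 0) -> q E = q (cell i j).
  move=> iN jN EC [z Ez fz]; apply/asboolP/asboolP => -[x Ex Ax].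
    by exists x => //; exact: EC.
  have cz := EC _ Ez.
  have rz : rect r t b0 b1 z.
    case: cz => /andP[h1 h2] /andP[h3 h4].
    have /andP[k1 k2] := Tin _ (ltnW iN); have /andP[k3 k4] := Tin _ iN.
    have /andP[k5 k6] := Yin _ (ltnW jN); have /andP[k7 k8] := Yin _ jN.
    by split; apply/andP; split; [exact: le_trans k1 h1|exact: le_trans h2 k4|
      exact: le_trans k5 h3|exact: le_trans h4 k8].
  have [Az|Bz] := fAB _ rz fz; first by exists z.
  exfalso; apply: (AB _ _ Ax Bz).
  case: cz Ex => /andP[h1 h2] /andP[h3 h4] [/andP[k1 k2] /andP[k3 k4]].
  rewrite prod_normE gt_max /= !ltr_norml.
  move: h2 h4 k2 k4 hT hY; rewrite TS YS => h2 h4 k2 k4 /andP[? ?] /andP[? ?].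
  by apply/andP; split; apply/andP; split; lra.
have vsign i j : s i j != s i j.+1 -> exists2 z, vedge i j z & f z = 0.
  move=> sij; have [||z zin fz] := @IVT_sign (fun y => f (T i, y)) (Y j) (Y j.+1) _ _ sij.
  - exact: continuous_slice2.
  - by rewrite YS lerDl (andP hY).1.
  - by exists (T i, z).
have hsign i j : s i j != s i.+1 j -> exists2 z, hedge i j z & f z = 0.
  move=> sij; have [||z zin fz] := @IVT_sign (fun y => f (y, Y j)) (T i) (T i.+1) _ _ sij.
  - exact: continuous_slice1.
  - by rewrite TS lerDl (andP hT).1.
  - by exists (z, Y j).
pose ev i j := q (vedge i j) && (s i j (+) s i j.+1).
pose eh i j := q (hedge i j) && (s i j (+) s i.+1 j).
have evE i j k : (i < N)%N -> (j < N)%N -> vedge k j `<=` cell i j ->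
    ev k j = q (cell i j) && (s k j (+) s k j.+1).
  move=> iN jN sub; rewrite /ev; case: (boolP (_ (+) _)) => sk; last by rewrite !andbF.
  rewrite (qE i j)//; apply: vsign; by move: sk; case: (s k j); case: (s k j.+1).
have ehE i j k : (i < N)%N -> (j < N)%N -> hedge i k `<=` cell i j ->
    eh i k = q (cell i j) && (s i k (+) s i.+1 k).
  move=> iN jN sub; rewrite /eh; case: (boolP (_ (+) _)) => sk; last by rewrite !andbF.
  rewrite (qE i j)//; apply: hsign; by move: sk; case: (s i k); case: (s i.+1 k).
have TSle i : T i <= T i.+1 by rewrite TS lerDl (andP hT).1.
have YSle j : Y j <= Y j.+1 by rewrite YS lerDl (andP hY).1.
have around i j : (i < N)%N -> (j < N)%N ->
    ev i j (+) ev i.+1 j = eh i j (+) eh i j.+1.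
  move=> iN jN; rewrite !(evE i j) ?(ehE i j)//.
  - by case: (q _); case: (s i j); case: (s i j.+1); case: (s i.+1 j);
      case: (s i.+1 j.+1).
  - by move=> x [h1 h2]; split => //; rewrite h2 lexx YSle.
  - by move=> x [h1 h2]; split => //; rewrite h2 lexx YSle.
  - by move=> x [h1 h2]; split => //; rewrite h1 lexx TSle.
  - by move=> x [h1 h2]; split => //; rewrite h1 lexx TSle.
pose V i J := \big[addb/false]_(j < J) ev i j.
have Vstep i J : (i < N)%N -> (J <= N)%N ->
    V i J (+) V i.+1 J = eh i 0%N (+) eh i J.
  move=> iN; elim: J => [|J IH] JN; first by rewrite /V !big_ord0 !addbb.
  rewrite /V !big_ord_recr /= -/(V i J) -/(V i.+1 J) addbACA IH ?(ltnW JN)//.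
  by rewrite around// -addbA addKb.
have s0 i : (i <= N)%N -> s i 0%N = false.
  by move=> iN; apply/negbTE; rewrite /s Y0 -leNgt ltW// fb0// Tin.
have sN i : (i <= N)%N -> s i N = true.
  by move=> iN; rewrite /s YN fb1// Tin.
have Veq i : (i < N)%N -> V i.+1 N = V i N.
  move=> iN; have := Vstep i N iN (leqnn _).
  rewrite /eh !s0 ?sN ?(ltnW iN)// !andbF.
  by case: (V i N); case: (V i.+1 N).
have V0 : V 0%N N = false.
  rewrite /V big1// => j _; rewrite /ev (_ : q _ = false)//.
  apply/asboolP => -[[x1 x2] [/= x1T _]]; rewrite x1T T0; exact: A0.
have VN : V N N = true.
  have -> : V N N = \big[addb/false]_(j < N) (s N j (+) s N j.+1).
    apply: eq_bigr => j _; rewrite /ev; case: (boolP (_ (+) _)) => sj.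
      rewrite andbT; have [|z Vz fz] := vsign N j.
        by move: sj; case: (s N j); case: (s N j.+1).
      apply/asboolP; exists z => //.
      have [|//|Bz] := fAB z _ fz.
        case: Vz => z1 /andP[z2 z3]; split; first by rewrite z1 TN lexx ltW.
        have /andP[k5 k6] := Yin _ (ltnW (ltn_ord j)).
        have /andP[k7 k8] := Yin _ (ltn_ord j).
        by rewrite (le_trans k5)//= (le_trans z3).
      by exfalso; case: z Vz Bz {fz} => z1 z2 [/= -> _]; rewrite TN => /B1.
    by rewrite andbF.
  have tel J : \big[addb/false]_(j < J) (s N j (+) s N j.+1) = s N 0%N (+) s N J.
    elim: J => [|J IH]; first by rewrite big_ord0 addbb.
    by rewrite big_ord_recr /= IH -addbA addKb.
  by rewrite tel s0// sN.
have : V N N = V 0%N N.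
  have VJ J : (J <= N)%N -> V J N = V 0%N N.
    elim: J => [//|J IH] JN; rewrite Veq// IH//; exact: ltnW.
  exact: VJ.
by rewrite V0 VN.
Qed.

End grid.

Section chains.
Context {R : realType} {V : normedModType R}.
Variables (Z : set V) (p : V).
Hypotheses (cZ : compact Z) (Zp : Z p).

(** An impredicative least fixed point stands for the chains in Z from p with steps
    shorter than e. *)
Definition chain_comp (e : R) : set V := [set x | forall S : set V, S p ->
  (forall y z, S y -> Z z -> `|y - z| < e -> S z) -> S x].

(** In a compact set the quasi-component of p, obtained by letting the length of
    the steps tend to 0, is a connected set; it is easier to reach a side of the
    rectangle with it than with the connected component, as only finitely many
    steps are involved at a time. *)
Definition quasi_comp : set V := [set x | forall e, 0 < e -> chain_comp e x].

Lemma chain_comp0 e : chain_comp e p. Proof. by move=> S Sp _. Qed.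

Lemma chain_comp_step e y z : chain_comp e y -> Z z -> `|y - z| < e ->
  chain_comp e z.
Proof. by move=> cy Zz yz S Sp SS; apply: SS (cy _ Sp SS) Zz yz. Qed.

Lemma chain_comp_sub e : chain_comp e `<=` Z.
Proof. by move=> x; apply. Qed.

Lemma chain_comp_le d e : d <= e -> chain_comp d `<=` chain_comp e.
Proof.
move=> de x cx S Sp SS; apply: cx => // y z Sy Zz yz; apply: SS Sy Zz _.
exact: lt_le_trans yz de.
Qed.

(** A point of T outside all the small-step components has, together with its
    neighbours, a positive threshold; compactness makes the threshold uniform. *)
Lemma quasi_comp_meets (T : set V) : closed T ->
  (forall e, 0 < e -> exists2 x, chain_comp e x & T x) ->
  exists2 x, quasi_comp x & T x.
Proof.
move=> clT eT; apply: contrapT => nT.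
have cZT : compact (Z `&` T).
  by apply: (subclosed_compact _ cZ) => //; apply: closedI => //; exact: compact_closed.
have := (compact_near_coveringP (Z `&` T)).1 cZT R (0^'+)
  (fun e x => ~ chain_comp e x) _ _.
move=> /(_ _)[].
  move=> x [Zx Tx].
  have [e e0 nx] : exists2 e, 0 < e & ~ chain_comp e x.
    apply: contrapT => h; apply: nT; exists x => // e e0; apply: contrapT => h'.
    by apply: h; exists e.
  near=> x' d.
  have de : d <= e by near: d; exact: nbhs_right_le.
  have xx' : `|x - x'| < e by near: x'; exact: (@cvgr_dist_lt _ _ _ _ _ id x cvg_id).
  move=> cx'; apply: nx; apply: (@chain_comp_step e x') => //.
    exact: chain_comp_le cx'.
move=> d /= d0 H.
have d2 : 0 < d / 2 by rewrite divr_gt0.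
have [x cx Tx] := eT _ d2.
apply: (H (d / 2)) (conj (chain_comp_sub cx) Tx) cx => //=.
by rewrite sub0r normrN gtr0_norm// ltr_pdivrMr// ltr_pMr// ltr1n.
Unshelve. all: by end_near. Qed.

Lemma quasi_comp_closed : closed quasi_comp.
Proof.
move=> x clx e e0.
have Zx : Z x.
  have clZ : closed Z by apply: compact_closed => //; exact: norm_hausdorff.
  apply: clZ; move: clx; apply: closure_subset => y.
  by move=> /(_ 1 ltr01) /chain_comp_sub.
have [y [qy xy]] := clx (ball x e) (nbhsx_ballx _ _ e0).
apply: chain_comp_step (qy _ e0) Zx _.
by move: xy; rewrite -ball_normE /= distrC.
Qed.

(** Were it split into two closed parts at distance 3 d, every chain from one to
    the other with short steps would visit the closed set T of the points at
    distance at least d from both, hence so would the quasi-component. *)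
Lemma quasi_comp_connected : connected quasi_comp.
Proof.
apply/connectedP => E [E0 CE [sep1 sep2]].
wlog pE : E E0 CE sep1 sep2 / E false p.
  move=> H; have : quasi_comp p by move=> e _; exact: chain_comp0.
  rewrite CE => -[pE|pE]; first by apply: (H E).
  apply: (H (fun b => E (~~ b))) => //=.
  - by rewrite setUC.
  - by rewrite setIC.
  - by rewrite setIC.
have clE b : closed (E b).
  move=> x xb; have : quasi_comp x.
    apply: quasi_comp_closed; move: xb; apply: closure_subset; rewrite CE.
    by case: b => y; [right|left].
  rewrite CE; case: b xb => xb [Ex|Ex] //; exfalso.
  - by rewrite -[False]/(set0 x) -sep2; split.
  - by rewrite -[False]/(set0 x) -sep1; split.
have subZ b : E b `<=` Z.
  move=> x Ex; have : quasi_comp x by rewrite CE; case: b Ex; [right|left].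
  by move=> /(_ 1 ltr01) /chain_comp_sub.
have [d d0 dist] : exists2 d, 0 < d & forall x y, E false x -> E true y ->
    ~ `|x - y| < 3 * d.
  have cE : compact (E false).
    by apply: (subclosed_compact _ cZ) => //; exact: clE.
  have := (compact_near_coveringP (E false)).1 cE R (0^'+)
    (fun d x => forall y, E true y -> ~ `|x - y| < 3 * d) _ _.
  move=> /(_ _)[].
    move=> x Ex.
    have nEx : ~ E true x.
      by move=> Ex'; rewrite -[False]/(set0 x) -sep1; split => //; exact: subset_closure.
    have : nbhs x (~` E true).
      by apply: open_nbhs_nbhs; split => //; rewrite openC; exact: clE.
    move=> /nbhs_ballP[e /= e0 He].
    near=> x' d'.
    have d'e : d' <= e / 6 by near: d'; apply: nbhs_right_le; rewrite divr_gt0.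
    have xx' : `|x - x'| < e / 2.
      near: x'; apply: (@cvgr_dist_lt _ _ _ _ _ id x cvg_id).
      by rewrite divr_gt0.
    move=> y Ey xy; apply: (He y) => //=.
    rewrite -ball_normE /=.
    rewrite (_ : x - y = (x - x') + (x' - y)); last by rewrite addrA subrK.
    rewrite (le_lt_trans (ler_normD _ _))// [e]splitr ltrD//.
    by rewrite (lt_le_trans xy)//=; move: d'e => /=; lra.
  move=> d /= d0 H; exists (d / 2); first by rewrite divr_gt0.
  move=> x y Ex Ey; apply: (H (d / 2)) => //=.
    by rewrite sub0r normrN gtr0_norm ?divr_gt0// ltr_pdivrMr// ltr_pMr// ltr1n.
  by rewrite divr_gt0.
pose T := [set z : V | forall b x, E b x -> ~ `|x - z| < d].
have [||x qx Tx] := @quasi_comp_meets T.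
- have -> : T = \bigcap_b \bigcap_(x in E b) ~` (ball x d).
    apply/seteqP; split => z Tz b.
      by move=> _ x Ex /=; rewrite -ball_normE; exact: (Tz b).
    by move=> x Ex; have := Tz b I x Ex; rewrite /= -ball_normE.
  apply: closed_bigI => b _; apply: closed_bigI => x _.
  by apply: open_closedC; exact: ball_open.
- suff H e : 0 < e -> e <= d -> exists2 x, chain_comp e x & T x.
    move=> e e0; have [ed|de] := leP e d; first exact: H.
    have [x cx Tx] := H _ d0 (lexx _); exists x => //.
    by apply: chain_comp_le cx; exact: ltW.
  move=> e0 ed; apply: contrapT => nT.
  have [y Ey] := E0 true.
  have cy : chain_comp e y.
    by have : quasi_comp y by [rewrite CE; right]; exact.
  have : (chain_comp e `&` [set z | exists2 x, E false x & `|x - z| < d]) y.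
    apply: cy.
      split; first exact: chain_comp0.
      by exists p => //; rewrite subrr normr0.
    move=> z z' [cz [x Ex xz]] Zz' zz'.
    have cz' := chain_comp_step cz Zz' zz'; split => //.
    have : ~ T z' by move=> Tz'; apply: nT; exists z'.
    move=> /existsNP[b] /existsNP[x'] /not_implyP[Ex'] /contrapT x'z'.
    case: b Ex' => Ex'; last by exists x'.
    exfalso; apply: (dist _ _ Ex Ex').
    have -> : x - x' = (x - z) + ((z - z') + (z' - x')).
      by rewrite !subrKA.
    apply: (le_lt_trans (ler_normD _ _)).
    have := ler_normD (z - z') (z' - x').
    have : `|z' - x'| < d by rewrite distrC.
    lra.
  move=> [_ [x Ex xy]]; apply: (dist _ _ Ex Ey); lra.
have : T x by [].
move: qx; rewrite CE => -[Ex|Ex] /(_ _ _ Ex); rewrite subrr normr0; exact.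
Unshelve. all: by end_near. Qed.

End chains.

Section level.
Context {R : realType}.

Lemma rect_compact (r t b0 b1 : R) : compact (rect r t b0 b1).
Proof.
have -> : rect r t b0 b1 = `[r, t]%classic `*` `[b0, b1]%classic.
  by apply/seteqP; split => x /=; rewrite !in_itv.
by apply: compact_setX; exact: segment_compact.
Qed.

(** If no chain of step e reached the left side, the component of (t, c) and the
    rest of the zero set would be at distance e and contradict no_separation. *)
Lemma level_continuum (f : R * R -> R) (r t b0 b1 c : R) :
  continuous f -> r < t -> b0 < b1 ->
  (forall s, r <= s <= t -> f (s, b0) < 0) ->
  (forall s, r <= s <= t -> 0 < f (s, b1)) ->
  (forall b, b0 <= b <= b1 -> f (t, b) = 0 -> b = c) ->
  exists C : set (R * R), [/\ connected C,
    C `<=` rect r t b0 b1 `&` [set x | f x = 0], C (t, c) &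
    exists b, C (r, b)].
Proof.
move=> cf rt b01 fb0 fb1 ft.
pose Z := rect r t b0 b1 `&` [set x | f x = 0].
have rtt : r <= t <= t by rewrite (ltW rt) lexx.
have cZ : compact Z.
  apply: (subclosed_compact _ (@rect_compact r t b0 b1)) => [|x []//].
  apply: closedI; first by apply: compact_closed => //; exact: rect_compact.
  exact: (closed_preimage cf (@closed_eq _ 0)).
have [c' c'in fc'] : exists2 c', b0 <= c' <= b1 & f (t, c') = 0.
  have [||z zin fz] := @IVT_sign _ (fun y => f (t, y)) b0 b1 _ (ltW b01).
  - exact: continuous_slice2.
  - by rewrite fb1// ltNge ltW// fb0.
  - by exists z.
have c'c := ft _ c'in fc'; subst c'.
have Zp : Z (t, c) by split => //; split.
exists (quasi_comp Z (t, c)); split.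
- exact: quasi_comp_connected.
- by move=> x /(_ 1 ltr01); exact: chain_comp_sub.
- by move=> e _; exact: chain_comp0.
have [||[x1 x2] qx /= x1r] := @quasi_comp_meets _ _ Z (t, c) cZ Zp [set x | x.1 = r].
- by apply: (closed_preimage _ (@closed_eq _ r)) => x; exact: cvg_fst.
- move=> e e0; apply: contrapT => nr.
  apply: (@no_separation _ f r t b0 b1 e (chain_comp Z (t, c) e)
    (Z `\` chain_comp Z (t, c) e)) => //.
  + move=> x rx fx; have [cx|cx] := pselect (chain_comp Z (t, c) e x); [left|right] => //.
  + by move=> x y cx [Zy ncy] xy; apply: ncy; exact: chain_comp_step cx Zy xy.
  + by move=> b cb; apply: nr; exists (r, b).
  + move=> b [[[_ bin] fb]]; apply.
    by move: (ft b bin fb) => ->; exact: chain_comp0.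
- by exists x2; rewrite -x1r.
Qed.

End level.

(** * Primitives of continuous functions *)

Section calculus.
Context {R : realType}.
Local Notation mu := (@lebesgue_measure R).
Implicit Types f F : R -> R.

Lemma is_derive_continuous f (x l : R) : is_derive x 1 f l -> {for x, continuous f}.
Proof.
by case=> df _; apply: differentiable_continuous; exact/derivable1_diffP.
Qed.

Lemma is_derive1E f (x l : R) : is_derive x 1 f l -> f^`()%classic x = l.
Proof. by move=> df; rewrite derive1E; apply: derive_val. Qed.

Lemma mean_value f df (a b : R) : a <= b ->
  (forall x, a <= x <= b -> is_derive x 1 f (df x)) ->
  exists2 c, a <= c <= b & f b - f a = df c * (b - a).
Proof.
move=> ab H; have [x|x|c cab fE] := @MVT_segment R f df a b ab.
- by rewrite in_itv/= => /andP[/ltW ? /ltW ?]; apply: H; apply/andP.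
- move: x; apply: continuous_in_subspaceT => x; rewrite inE/= in_itv/= => xab.
  exact: is_derive_continuous (H x xab).
- by exists c => //; move: cab; rewrite in_itv.
Qed.

Lemma is_derive_nondecreasing f df (a b : R) : a <= b ->
  (forall x, a <= x <= b -> is_derive x 1 f (df x)) ->
  (forall x, a <= x <= b -> 0 <= df x) -> f a <= f b.
Proof.
move=> ab dfE df0; have [c cab fE] := mean_value ab dfE.
by rewrite -subr_ge0 fE mulr_ge0 ?subr_ge0 ?df0.
Qed.

Lemma continuous_itv_integrable f (a b : R) : continuous f ->
  mu.-integrable `[a, b] (EFin \o f).
Proof.
move=> cf; apply: continuous_compact_integrable; first exact: segment_compact.
exact: continuous_subspaceT.
Qed.

Lemma Rintegral_FTC f F (a b : R) : a <= b -> continuous f ->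
  (forall x : R, is_derive x 1 F (f x)) ->
  \int[mu]_(x in `[a, b]) f x = F b - F a.
Proof.
rewrite le_eqVlt => /predU1P[-> _ _|ab cf dF].
  by rewrite set_itv1 Rintegral_set1 subrr.
rewrite /Rintegral (@continuous_FTC2 _ f F a b)//.
- exact: continuous_subspaceT.
- split.
  + by move=> x _; have [] := dF x.
  + apply: cvg_at_right_filter; exact: is_derive_continuous (dF a).
  + apply: cvg_at_left_filter; exact: is_derive_continuous (dF b).
- by move=> x _; rewrite (is_derive1E (dF x)).
Qed.

(** At least one of the two integrals is over an empty or negligible interval, depending
    on the sign of x, so that this is the primitive vanishing at 0. *)
Definition prim f (x : R) : R :=
  \int[mu]_(t in `[0, x]) f t - \int[mu]_(t in `[x, 0]) f t.

Lemma prim_base f (n x : R) : continuous f -> - n <= 0 -> - n <= x ->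
  prim f x = \int[mu]_(t in `[- n, x]) f t - \int[mu]_(t in `[- n, 0]) f t.
Proof.
move=> cf n0 nx; have fi a b := @continuous_itv_integrable f a b cf.
have split3 a b c : a <= b -> b <= c ->
    \int[mu]_(t in `[a, c]) f t =
    \int[mu]_(t in `[a, b]) f t + \int[mu]_(t in `[b, c]) f t.
  move=> ab bc; have := @Rintegral_itvB R f (BLeft a) (BRight c) b (fi _ _).
  rewrite !bnd_simp => /(_ ab bc); rewrite Rintegral_itv_obnd_cbnd.
    by move=> <-; rewrite addrC subrK.
  apply: integrableS (fi b c); [exact: measurable_itv|exact: measurable_itv|].
  by move=> y /=; rewrite !in_itv/= => /andP[/ltW -> ->].
rewrite /prim; have [x0|x0] := leP 0 x.
  rewrite (split3 (- n) 0 x)// addrAC subrr add0r.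
  have [->|xn0] := eqVneq x 0; first by rewrite set_itv1 Rintegral_set1 subrr.
  rewrite [X in _ - \int[mu]_(t in X) _](_ : _ = set0) ?Rintegral_set0 ?subr0//.
  by apply: set_itv_ge; rewrite bnd_simp -ltNge lt_def xn0.
rewrite (split3 (- n) x 0) ?(ltW x0)// opprD addrA subrr sub0r.
rewrite [X in \int[mu]_(t in X) _ - _](_ : _ = set0) ?Rintegral_set0 ?sub0r//.
by apply: set_itv_ge; rewrite bnd_simp -ltNge.
Qed.

Lemma is_derive_prim f (x : R) : continuous f -> is_derive x 1 (prim f) (f x).
Proof.
move=> cf; pose n := `|x| + 1.
have xn : - n < x by rewrite /n ltrNl -normrN (le_lt_trans (ler_norm _))// ltrDl.
have n0 : - n <= 0 by rewrite oppr_le0 addr_ge0.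
have [d1 d2] := @continuous_FTC1_closed R f (- n) x (x + 1) (ltr_pwDr ltr01 (lexx x))
  (continuous_itv_integrable _ _ cf) xn (cf x).
have d3 : is_derive x 1 (fun y => \int[mu]_(t in `[- n, y]) f t) (f x).
  by split; [exact: d1|rewrite -derive1E; exact: d2].
have d4 : is_derive x 1 (fun y => \int[mu]_(t in `[- n, y]) f t
    - cst (\int[mu]_(t in `[- n, 0]) f t) y) (f x).
  by apply: is_derive_eq; rewrite subr0.
apply: near_eq_is_derive d4.
near=> y; rewrite (@prim_base _ n)//.
by apply/ltW; near: y; exact: lt_nbhsr.
Unshelve. all: by end_near. Qed.

Lemma prim0 f : prim f 0 = 0.
Proof. by rewrite /prim subrr. Qed.

Lemma continuous_prim f : continuous f -> continuous (prim f).
Proof. by move=> cf x; apply: is_derive_continuous; exact: is_derive_prim. Qed.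

Lemma Rintegral_prim f (a b : R) : a <= b -> continuous f ->
  \int[mu]_(x in `[a, b]) f x = prim f b - prim f a.
Proof.
by move=> ab cf; apply: Rintegral_FTC => // x; exact: is_derive_prim.
Qed.

Lemma le_prim f g (x : R) : 0 <= x -> continuous f -> continuous g ->
  (forall t, 0 <= t <= x -> f t <= g t) -> prim f x <= prim g x.
Proof.
move=> x0 cf cg fg; rewrite -subr_ge0.
rewrite -[leLHS](_ : (prim g 0 - prim f 0) = 0); last by rewrite !prim0 subrr.
apply: (@is_derive_nondecreasing (fun y => prim g y - prim f y) (g \- f) 0 x x0).
  move=> t _; apply: (@is_deriveB _ _ _ (prim g) (prim f)); exact: is_derive_prim.
by move=> t tx; rewrite subr_ge0 fg.
Qed.

Lemma near_uniform_itv (Z : topologicalType) (h : Z * R -> R) (z0 : Z) (a b e : R) :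
  continuous h -> 0 < e ->
  \forall z \near z0, `[a, b] `<=` (fun t => `|h (z0, t) - h (z, t)| < e).
Proof.
move=> ch e0; have /compact_near_coveringP nc := @segment_compact R a b.
apply: nc => t _.
have e2 : 0 < e / 2 by rewrite divr_gt0.
have := ch (z0, t) => /cvgrPdist_lt /(_ _ e2) [[/= U V] [Uz Vt] UV].
exists (V, U) => //= -[t' z'] [/= Vt' Uz'].
have h1 := UV (z0, t') (conj (nbhs_singleton Uz) Vt').
have h2 := UV (z', t') (conj Uz' Vt').
rewrite [e]splitr.
have -> : h (z0, t') - h (z', t') = (h (z0, t') - h (z0, t)) + (h (z0, t) - h (z', t')).
  by rewrite subrKA.
by rewrite (le_lt_trans (ler_normD _ _))// ltrD// distrC.
Qed.

Lemma continuous_prim_param (Z : topologicalType) (k : Z * R -> R) :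
  continuous k -> continuous (fun zt : Z * R => prim (fun t => k (zt.1, t)) zt.2).
Proof.
move=> ck [z0 t0].
have ckz z : continuous (fun t => k (z, t)).
  exact: continuous_slice2.
apply/cvgrPdist_lt => e e0.
pose n := `|t0| + 1.
have n0 : 0 < n by rewrite ltr_pwDr.
have nearz := near_uniform_itv z0 (- n) n ck (divr_gt0 (divr_gt0 e0 (ltr0n _ 2)) n0).
have cp0 := continuous_prim (ckz z0).
have e2 : 0 < e / 2 by rewrite divr_gt0.
have neart : \forall t \near t0, `|t0 - t| < 1 /\
    `|prim (fun s => k (z0, s)) t0 - prim (fun s => k (z0, s)) t| < e / 2.
  apply: filterI.
    exact: (@cvgr_dist_lt _ _ _ _ _ id t0 cvg_id).
  by have /cvgrPdist_lt := cp0 t0; apply.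
exists ((fun z => `[- n, n] `<=` (fun t => `|k (z0, t) - k (z, t)| < e / 2 / n)),
  (fun t => `|t0 - t| < 1 /\
    `|prim (fun s => k (z0, s)) t0 - prim (fun s => k (z0, s)) t| < e / 2)) => //=.
move=> [z t] /= [kz [t1 pt]].
have tn : `|t| <= n.
  rewrite -[t](subrK t0) (le_trans (ler_normD _ _))// /n addrC lerD2l ltW//.
  by rewrite distrC.
pose D s := prim (fun t => k (z0, t)) s - prim (fun t => k (z, t)) s.
have dD (s : R) : is_derive s 1 D (k (z0, s) - k (z, s)).
  apply: (@is_deriveB _ _ _ (prim (fun t => k (z0, t))) (prim (fun t => k (z, t)))).
    exact: (is_derive_prim s (ckz z0)).
  exact: (is_derive_prim s (ckz z)).
have D0 : D 0 = 0 by rewrite /D !prim0 subrr.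
have Dt : `|D t| <= e / 2.
  have bnd c : `|c| <= n -> `|k (z0, c) - k (z, c)| <= e / 2 / n.
    by rewrite ler_norml => cn; apply/ltW/kz; rewrite /= in_itv.
  have [tpos|tneg] := leP 0 t.
    have [c /andP[c0 ct]] := mean_value tpos (fun s _ => dD s).
    rewrite D0 !subr0 => ->; rewrite normrM.
    have cn : `|c| <= n by rewrite ger0_norm// (le_trans ct)// (le_trans _ tn)// ler_norm.
    rewrite (le_trans (ler_pM _ _ (bnd _ cn) tn))// divfK// gt_eqF//.
  have [c /andP[ct c0]] := mean_value (ltW tneg) (fun s _ => dD s).
  rewrite D0 !sub0r => /(congr1 -%R); rewrite opprK => ->; rewrite normrN normrM normrN.
  have cn : `|c| <= n.
    by rewrite ler0_norm// (le_trans _ tn)// ler0_norm ?(ltW tneg)// lerN2.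
  by rewrite (le_trans (ler_pM _ _ (bnd _ cn) tn))// divfK// gt_eqF.
have -> : prim (fun s => k (z0, s)) t0 - prim (fun s => k (z, s)) t =
    (prim (fun s => k (z0, s)) t0 - prim (fun s => k (z0, s)) t) + D t.
  by rewrite /D subrKA.
by rewrite (le_lt_trans (ler_normD _ _))// [e]splitr ltr_leD.
Qed.

Lemma primZ (c x : R) (f : R -> R) : continuous f ->
  prim (fun t => c * f t) x = c * prim f x.
Proof.
move=> cf; have ccf : continuous (fun t => c * f t).
  by move=> t; apply: continuousM; [exact: cst_continuous|exact: cf].
pose D t := prim (fun t => c * f t) t - c * prim f t.
have dD (t : R) : is_derive t 1 D 0.
  have h := is_deriveB (is_derive_prim t ccf) (is_deriveZ c (is_derive_prim t cf)).
  by apply: (is_derive_eq h); rewrite subrr.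
have := is_derive_0_is_cst x 0 dD; rewrite /D !prim0 mulr0 subrr.
by move/eqP; rewrite subr_eq0 => /eqP.
Qed.

(** g need not be differentiable at x: the term of the product rule with its
    derivative has the factor f x = 0. *)
Lemma is_derive_mul_vanish (f g : R -> R) (x l : R) : is_derive x 1 f l -> f x = 0 ->
  {for x, continuous g} -> is_derive x 1 (fun y => f y * g y) (l * g x).
Proof.
move=> /is_derive1_caratheodory[h [fE hc hx]] fx cg.
apply/is_derive1_caratheodory; exists (fun y => h y * g y); split.
- by move=> z; rewrite fx mul0r subr0 mulrAC -fE fx subr0.
- exact: continuousM.
- by rewrite hx.
Qed.

End calculus.

(** * Integration by parts in H^1 *)

Section by_parts.
Context {R : realType}.
Local Notation mu := (@lebesgue_measure R).
Local Notation I01 := (`[0%R, 1%R]%classic : set (measurableTypeR R)).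

Lemma integrable_patch (f : R -> R) : mu.-integrable I01 (EFin \o f) ->
  mu.-integrable setT (EFin \o (f \_ I01)).
Proof.
by move=> fi; rewrite -restrict_EFin -integrable_mkcond//; exact: mI01.
Qed.

Lemma integral_patchZ (f : R -> R) (D : set (measurableTypeR R)) (c : R) :
  measurable D -> mu.-integrable D (EFin \o f) ->
  (\int[mu]_y (c * (f \_ D) y)%:E = (c * \int[mu]_(y in D) f y)%:E)%E.
Proof.
move=> mD fi; under eq_integral do rewrite EFinM.
have fiT : mu.-integrable setT (EFin \o (f \_ D)).
  by rewrite -restrict_EFin -integrable_mkcond.
rewrite integralZl// EFinM; congr (_ * _)%E.
rewrite fineK; last exact: integrable_fin_num.
by rewrite [RHS]integral_mkcond; apply: eq_integral => y _; rewrite restrict_EFin.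
Qed.

(** Both sides are iterated integrals of df x * g y over the triangle y <= x. *)
Lemma Rintegral_triangle (df g : R -> R) :
  mu.-integrable I01 (EFin \o df) -> mu.-integrable I01 (EFin \o g) ->
  \int[mu]_(x in I01) (df x * \int[mu]_(y in `[0, x]) g y) =
  \int[mu]_(y in I01) (g y * \int[mu]_(x in `[y, 1]) df x).
Proof.
move=> idf ig.
have ia := integrable_patch idf; have ib := integrable_patch ig.
set a := df \_ I01 in ia; set b := g \_ I01 in ib.
have ma : measurable_fun setT a by have /measurable_int/measurable_EFinP := ia.
have mb : measurable_fun setT b by have /measurable_int/measurable_EFinP := ib.
pose S : set (measurableTypeR R * measurableTypeR R) := [set z | z.2 <= z.1].
have mS : measurable S.
  have : measurable_fun setT (fun z : measurableTypeR R * measurableTypeR R => z.2 <= z.1).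
    exact: measurable_fun_ler.
  move=> /(_ measurableT [set true] _); rewrite setTI; apply => //.
pose F (z : measurableTypeR R * measurableTypeR R) : \bar R := (a z.1 * b z.2 * \1_S z)%:E.
have mab : measurable_fun setT
    (fun z : measurableTypeR R * measurableTypeR R => a z.1 * b z.2).
  by apply: measurable_funM; apply: measurableT_comp.
have mF : measurable_fun setT F.
  by apply/measurable_EFinP; apply: measurable_funM.
have iab : (mu \x mu)%E.-integrable setT
    (fun z : measurableTypeR R * measurableTypeR R => (a z.1 * b z.2)%:E).
  apply/integrable12ltyP => /=; first exact/measurable_EFinP.
  have -> : (\int[mu]_x \int[mu]_y `|(a x * b y)%:E| =
      (\int[mu]_x `|(a x)%:E|) * (\int[mu]_y `|(b y)%:E|))%E.
    rewrite -ge0_integralZr//; last 2 first.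
    - by apply: measurableT_comp => //; exact/measurable_EFinP.
    - exact: integral_ge0.
    apply: eq_integral => x _; rewrite -ge0_integralZl//.
      by apply: eq_integral => y _; rewrite -abseM.
    by apply: measurableT_comp => //; exact/measurable_EFinP.
  have /integrableP[_ ha] := ia; have /integrableP[_ hb] := ib.
  by rewrite lte_mul_pinfty// ?integral_ge0// ge0_fin_numE// integral_ge0.
have iF : (mu \x mu)%E.-integrable setT F.
  apply: le_integrable iab => // z _; rewrite /F !abse_EFin lee_fin.
  rewrite [leLHS]normrM ler_piMr// indicE.
  by case: (_ \in _); rewrite ?normr1 ?normr0.
have := Fubini iF.
have subI (D : set (measurableTypeR R)) f : measurable D -> D `<=` I01 ->
    mu.-integrable I01 (EFin \o f) -> mu.-integrable D (EFin \o f).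
  by move=> mD DI; apply: integrableS => //; exact: mI01.
have -> : (\int[mu]_x \int[mu]_y F (x, y) =
    \int[mu]_(x in I01) (df x * \int[mu]_(y in `[0%R, x]) g y)%:E)%E.
  rewrite [RHS]integral_mkcond; apply: eq_integral => x _.
  rewrite patchE; case: ifPn => [|] xI; last first.
    by apply: integral0_eq => y _; rewrite /F /a patchE (negbTE xI) !mul0r.
  have sx : `[0%R, x]%classic `<=` I01.
    move=> y; move: xI; rewrite inE /= !in_itv/= => /andP[_ x1] /andP[-> yx].
    exact: le_trans x1.
  rewrite -integral_patchZ//; last exact: subI.
  apply: eq_integral => y _; rewrite /F /a /b patchE xI -mulrA; congr (_ * _)%:E.
  rewrite !patchE indicE /=; case: (boolP (y \in `[0%R, x]%classic)) => yx.
    rewrite mem_set ?mem_set ?mulr1//=; last by apply: sx; rewrite inE in yx.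
    by move: yx; rewrite inE/= in_itv/= => /andP[].
  case: (boolP (y \in I01)) => yI; last by rewrite mul0r.
  rewrite memNset ?mulr0//= => yx'; move/negP: yx; apply.
  by move: yI; rewrite !inE /= !in_itv/= => /andP[-> _].
have -> : (\int[mu]_y \int[mu]_x F (x, y) =
    \int[mu]_(y in I01) (g y * \int[mu]_(x in `[y, 1%R]) df x)%:E)%E.
  rewrite [RHS]integral_mkcond; apply: eq_integral => y _.
  rewrite patchE; case: ifPn => [|] yI; last first.
    by apply: integral0_eq => x _; rewrite /F /b patchE (negbTE yI) mulr0 mul0r.
  have sy : `[y, 1%R]%classic `<=` I01.
    move=> x; move: yI; rewrite inE /= !in_itv/= => /andP[y0 _] /andP[yx ->].
    by rewrite (le_trans y0).
  rewrite -integral_patchZ//; last exact: subI.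
  apply: eq_integral => x _; rewrite /F /a /b [X in a _ * X]patchE yI.
  rewrite [a x * _]mulrC -mulrA; congr (_ * _)%:E.
  rewrite /a !patchE indicE /=; case: (boolP (x \in `[y, 1%R]%classic)) => yx.
    rewrite mem_set ?mem_set ?mulr1//=; last by apply: sy; rewrite inE in yx.
    by move: yx; rewrite inE/= in_itv/= => /andP[].
  case: (boolP (x \in I01)) => xI; last by rewrite mul0r.
  rewrite memNset ?mulr0//= => yx'; move/negP: yx; apply.
  by move: xI; rewrite !inE /= !in_itv/= => /andP[_ ->]; rewrite andbT.
by rewrite /Rintegral => ->.
Qed.

Lemma integrable_continuousM (h k : R -> R) : continuous h ->
  mu.-integrable I01 (EFin \o k) -> mu.-integrable I01 (EFin \o (fun s => h s * k s)).
Proof.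
move=> ch ik.
have [c _ hM] := @EVT_max R (fun x => `|h x|) 0 1 ler01
  (continuous_subspaceT (fun x => cvg_norm (ch x))).
have := integrableZl mI01 `|h c| ik.
apply: le_integrable; first exact: mI01.
  apply/measurable_EFinP/measurable_funM.
    by apply: measurable_funS (@continuous_measurable_fun _ _ ch).
  by have /measurable_int/measurable_EFinP := ik.
move=> x xI /=; rewrite lee_fin !normrM ler_wpM2r//.
by rewrite normr_id hM.
Qed.

Lemma continuous_H1_derivative (u f : R -> R) : continuous f ->
  (forall s, I01 s -> u s = u 0 + \int[mu]_(t in `[0%R, s]) f t) -> H1_derivative u f.
Proof.
move=> cf uf; split => //.
  by apply: measurable_funS (@continuous_measurable_fun _ _ cf).
apply: continuous_itv_integrable => x; apply: (@continuous_comp _ _ _ f (fun y => y ^+ 2)).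
  exact: cf.
exact: exprn_continuous.
Qed.

(** Only f is C^1; the other factor is the primitive of an L^2 function, hence
    Fubini's theorem on a triangle instead of the product rule. *)
Lemma H1_by_parts (f df u g : R -> R) :
  (forall x : R, is_derive x 1 f (df x)) -> continuous df -> f 0 = 0 -> f 1 = 0 ->
  H1_derivative u g ->
  \int[mu]_(s in I01) (f s * g s + df s * u s) = 0.
Proof.
move=> dfE cdf f0 f1 ug; have [mg ig2 uE] := ug.
have ig := L2_L1 mg ig2; have iu := H1_derivative_integrable ug.
have cf : continuous f by move=> x; exact: is_derive_continuous (dfE x).
have bM := integrable_continuousM.
have int_df y : I01 y -> \int[mu]_(x in `[y, 1]) df x = - f y.
  rewrite /= in_itv/= => /andP[_ y1].
  by rewrite (Rintegral_FTC y1 cdf dfE) f1 sub0r.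
rewrite RintegralD; [|exact: mI01|exact: bM|exact: bM].
have -> : \int[mu]_(s in I01) (df s * u s) =
    \int[mu]_(s in I01) (df s * u 0) +
    \int[mu]_(s in I01) (df s * \int[mu]_(t in `[0, s]) g t).
  rewrite -RintegralD; first last.
  - have : mu.-integrable I01 (EFin \o (fun s => df s * u s - df s * u 0)).
      exact: (integrableB mI01 (bM _ _ cdf iu) (bM _ _ cdf (I01_cst (u 0)))).
    apply: eq_integrable; first exact: mI01.
    by move=> s; rewrite inE => sI /=; rewrite [in LHS]uE// mulrDr [X in X - _]addrC addrK.
  - by apply: bM => //; exact: I01_cst.
  - exact: mI01.
  by apply: eq_Rintegral => s; rewrite inE => sI; rewrite [in LHS]uE// mulrDr.
have -> : \int[mu]_(s in I01) (df s * u 0) = 0.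
  rewrite RintegralZr; [|exact: mI01|exact: continuous_itv_integrable].
  by rewrite (Rintegral_FTC ler01 cdf dfE) f0 f1 subrr mul0r.
rewrite add0r Rintegral_triangle//; last exact: continuous_itv_integrable.
rewrite -RintegralD; first last.
- have : mu.-integrable I01 (EFin \o (fun s => (- f s) * g s)).
    by apply: bM => //; move=> x; apply: continuousN; exact: cf.
  apply: eq_integrable; first exact: mI01.
  by move=> s; rewrite inE => sI /=; rewrite int_df// mulrC.
- exact: bM.
- exact: mI01.
transitivity (\int[mu]_(s in I01) (cst 0 s : R)).
  apply: eq_Rintegral => s; rewrite inE => sI.
  by rewrite int_df// mulrN mulrC subrr.
by rewrite Rintegral_cst ?mul0r//; exact: mI01.
Qed.

End by_parts.

(** * Strictly convex functions and their derivatives *)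

Section strict_convexity.
Context {R : realType}.
Implicit Types (A B : set R) (f g : R -> R).

(** x f(1/x) is the perspective of f: the reciprocal of a convex combination of x
    and y is a convex combination of their reciprocals, with weights proportional
    to t x and (1 - t) y. *)
Lemma strictly_convex_perspective A B f : strictly_convex_on A f ->
  (forall x, B x -> 0 < x /\ A x^-1) ->
  strictly_convex_on B (fun x => x * f x^-1).
Proof.
move=> cf BA x y t Bx By xy /andP[t0 t1].
have [x0 Ax] := BA _ Bx; have [y0 Ay] := BA _ By.
set z := t * x + _.
have z0 : 0 < z by rewrite addr_gt0 ?mulr_gt0 ?subr_gt0.
have xy' : x^-1 != y^-1 by rewrite (inj_eq invr_inj).
pose s := t * x / z.
have s1E : 1 - s = (1 - t) * y / z.
  by apply: (mulIf (lt0r_neq0 z0)); rewrite mulrBl !divfK ?gt_eqF// /z; ring.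
have s01 : 0 < s < 1.
  apply/andP; split; first by rewrite divr_gt0 ?mulr_gt0.
  by rewrite -subr_gt0 s1E divr_gt0 ?mulr_gt0 ?subr_gt0.
have zE : s * x^-1 + (1 - s) * y^-1 = z^-1.
  by rewrite s1E /s; field; rewrite !gt_eqF.
have := cf _ _ s Ax Ay xy' s01; rewrite zE => h.
have -> : t * (x * f x^-1) + (1 - t) * (y * f y^-1) =
    z * (s * f x^-1 + (1 - s) * f y^-1).
  have e1 : z * s = t * x by rewrite mulrC divfK ?gt_eqF.
  have e2 : z * (1 - s) = (1 - t) * y by rewrite s1E mulrC divfK ?gt_eqF.
  transitivity ((z * s) * f x^-1 + (z * (1 - s)) * f y^-1); last by ring.
  by rewrite e1 e2 !mulrA.
by rewrite ltr_pM2l.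
Qed.

(** The difference quotients of f along the segment give the weak inequality; the
    midpoint makes it strict. *)
Lemma strictly_convex_tangent A f (x y d : R) : strictly_convex_on A f ->
  (forall a b t, A a -> A b -> 0 < t < 1 -> A (t * a + (1 - t) * b)) ->
  is_derive x 1 f d -> A x -> A y -> x != y -> f x + d * (y - x) < f y.
Proof.
move=> cf cA df Ax Ay xy.
have weak b : A b -> x != b -> f x + d * (b - x) <= f b.
  move=> Ab xb; have /is_derive1_caratheodory[g [fE cg gx]] := df.
  rewrite leNgt; apply/negP => lt.
  have lt' : f b - f x < g x * (b - x) by rewrite gx; lra.
  pose G t := g ((1 - t) * x + t * b) * (b - x).
  have cG : {for 0, continuous G}.
    apply: continuousM; last exact: cst_continuous.
    apply: continuous_comp; last by rewrite /= subr0 mul1r mul0r addr0.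
    apply: continuousD; apply: continuousM => //; try exact: cst_continuous.
    by apply: continuousB => //; exact: cst_continuous.
  have G0 : G 0 = g x * (b - x) by rewrite /G subr0 mul1r mul0r addr0.
  have near1 : \forall t \near 0^'+, f b - f x < G t.
    by apply: (cvgr_gt (G 0)); [exact: cvg_at_right_filter|rewrite G0].
  have near2 : \forall t \near 0^'+, (t : R) < 1 by exact: nbhs_right_lt.
  have near3 : \forall t \near (0:R)^'+, 0 < t by exact: nbhs_right_gt.
  have [t [Gt [t1 t0]]] := filter_ex (filterI near1 (filterI near2 near3)).
  have t01 : 0 < 1 - t < 1 by rewrite subr_gt0 t1 ltrBlDr ltrDl.
  have := cf _ _ _ Ax Ab xb t01.
  have -> : 1 - (1 - t) = t by ring.
  move=> /ltW; rewrite -lerBlDl => h.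
  have := fE ((1 - t) * x + t * b).
  have -> : (1 - t) * x + t * b - x = t * (b - x) by ring.
  move=> e; have : t * (f b - f x) < t * G t by rewrite ltr_pM2l.
  rewrite /G; have -> : t * (g ((1 - t) * x + t * b) * (b - x)) =
    f ((1 - t) * x + t * b) - f x by rewrite e; ring.
  lra.
pose m := 2^-1 * x + (1 - 2^-1) * y.
have h2 : 0 < (2^-1 : R) < 1 by rewrite invr_gt0 ltr0n /= invf_lt1 ?ltr0n// ltr1n.
have Am : A m by exact: cA.
have mE : m - x = 2^-1 * (y - x) by rewrite /m; field.
have xm : x != m.
  by rewrite eq_sym -subr_eq0 mE mulf_neq0 ?invr_eq0 ?pnatr_eq0// subr_eq0 eq_sym.
have := weak _ Am xm; rewrite mE.
have := cf _ _ _ Ax Ay xy h2; rewrite -/m.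
have -> : (1 - 2^-1 : R) = 2^-1 by field.
lra.
Qed.

Lemma strictly_convex_derive_lt A f df (x y : R) : strictly_convex_on A f ->
  (forall a b t, A a -> A b -> 0 < t < 1 -> A (t * a + (1 - t) * b)) ->
  (forall z, A z -> is_derive z 1 f (df z)) -> A x -> A y -> x < y ->
  df x < df y.
Proof.
move=> cf cA dfE Ax Ay xy.
have xy' : x != y by rewrite lt_eqF.
have h1 := strictly_convex_tangent cf cA (dfE _ Ax) Ax Ay xy'.
have yx' : y != x by rewrite gt_eqF.
have h2 := strictly_convex_tangent cf cA (dfE _ Ay) Ay Ax yx'.
have : df x * (y - x) < df y * (y - x) by lra.
by rewrite ltr_pM2r ?subr_gt0.
Qed.

Lemma itv_convex (i : interval R) a b t :
  [set` i] a -> [set` i] b -> 0 < t < 1 -> [set` i] (t * a + (1 - t) * b).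
Proof.
move=> ia ib /andP[t0 t1] /=.
wlog ab : a b t t0 t1 ia ib / a <= b.
  move=> H; have [/H|/ltW ba] := leP a b; first exact.
  rewrite addrC -[X in X * a](_ : 1 - (1 - t) = t); last by ring.
  by apply: H => //; rewrite ?subr_gt0// ltrBlDr ltrDl.
apply: (@interval_is_interval _ i a b ia ib); apply/andP; split.
  have -> : t * a + (1 - t) * b = a + (1 - t) * (b - a) by ring.
  by rewrite lerDl mulr_ge0// subr_ge0// ltW.
have -> : t * a + (1 - t) * b = b - t * (b - a) by ring.
by rewrite gerBl mulr_ge0 ?subr_ge0// ltW.
Qed.

Lemma continuous_increasing_closure f (a b : R) : continuous f ->
  (forall x y : R, a < x -> x < y -> y < b -> f x < f y) ->
  forall x y : R, a <= x -> x < y -> y <= b -> f x < f y.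
Proof.
move=> cf H x y ax xy yb.
pose u := (2 * x + y) / 3; pose v := (x + 2 * y) / 3.
have [xu uv vy] : [/\ x < u, u < v & v < y].
  by split; rewrite /u /v ?ltr_pdivlMr ?ltr_pdivrMr ?divfK ?pnatr_eq0//; lra.
have fxu : f x <= f u.
  rewrite leNgt; apply/negP => lt.
  have near1 : \forall t \near x^'+, f u < f t.
    by apply: (cvgr_gt (f x)) => //; exact/cvg_at_right_filter/cf.
  have near2 : \forall t \near x^'+, t < u by exact: nbhs_right_lt.
  have near3 : \forall t \near x^'+, x < t by exact: nbhs_right_gt.
  have [t [ft [tu xt]]] := @filter_ex _ _ (at_right_proper_filter x) _
    (filterI near1 (filterI near2 near3)).
  have ub : u < b by exact: lt_le_trans (lt_trans uv vy) yb.
  have : f t < f u by exact: H (le_lt_trans ax xt) tu ub.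
  by rewrite ltNge (ltW ft).
have fvy : f v <= f y.
  rewrite leNgt; apply/negP => lt.
  have near1 : \forall t \near y^'-, f t < f v.
    by apply: (cvgr_lt (f y)) => //; exact/cvg_at_left_filter/cf.
  have near2 : \forall t \near y^'-, v < t by exact: nbhs_left_gt.
  have near3 : \forall t \near y^'-, t < y by exact: nbhs_left_lt.
  have [t [ft [vt ty]]] := @filter_ex _ _ (at_left_proper_filter y) _
    (filterI near1 (filterI near2 near3)).
  have av : a < v by exact: le_lt_trans ax (lt_trans xu uv).
  have : f v < f t by exact: H av vt (lt_le_trans ty yb).
  by rewrite ltNge (ltW ft).
apply: le_lt_trans fxu (lt_le_trans _ fvy).
exact: H (le_lt_trans ax xu) uv (lt_le_trans vy yb).
Qed.

End strict_convexity.

(** * The dual energy *)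

(** What the bifurcation analysis uses of the dual energy: it is C^1 on the
    whole line (extended linearly to the left of 0), C^2 to the right of 0,
    concave and then convex, and its minimal value on [0, 1] is 0. *)
Record concave_convex {R : realType} (w p p2 : R -> R) (k : R) : Prop := {
  cc_derive : forall x : R, is_derive x 1 w (p x);
  cc_cont : continuous p;
  cc_derive2 : forall x : R, 0 < x -> is_derive x 1 p (p2 x);
  cc_cont2 : forall x : R, 0 < x -> {for x, continuous p2};
  cc_decr : forall x y : R, 0 <= x -> x < y -> y <= k -> p y < p x;
  cc_incr : forall x y : R, k <= x -> x < y -> p x < p y;
  cc_k : 0 < k < 1;
  cc_w0 : w 0 = 0;
  cc_w1 : w 1 = 0;
  cc_ge0 : forall x, 0 <= x <= 1 -> 0 <= w x;
  cc_p1 : p 1 = 0 }.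

Section dual_energy.
Context {R : realType}.
Variables (W : R -> R) (gamma kappa : R).
Hypothesis hW : stored_energy W gamma kappa.

(** On H < 0, where the dual energy is infinite, the tangent line at 0 replaces it,
    so that one-sided limits at 0 are avoided. *)
Definition dual_w x := if 0 < x then x * W x^-1 else gamma * x.
Definition dual_p x :=
  if 0 < x then W x^-1 - x^-1 * W^`()%classic x^-1 else gamma.
Definition dual_p2 x := W^`(2)%classic x^-1 * x^-1 ^+ 3.

Let kp : 0 < kappa. Proof. by have /andP[] := energy_kappa hW. Qed.

Let dW (F : R) : 0 < F -> is_derive F 1 W (W^`()%classic F).
Proof.
move=> F0; have [/(_ 0%N F isT F0) d _] := energy_C3 hW.
by split => //; rewrite derive1E.
Qed.

Let dW1 (F : R) : 0 < F -> is_derive F 1 (W^`()%classic) (W^`(2)%classic F).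
Proof.
move=> F0; have [/(_ 1%N F isT F0) d _] := energy_C3 hW.
split; first by rewrite -derive1n1.
by rewrite -derive1E (derive1nS _ 1) derive1n1.
Qed.

Let cW2 (F : R) : 0 < F -> {for F, continuous (W^`(2)%classic)}.
Proof.
move=> F0; have [/(_ 2%N F isT F0) d _] := energy_C3 hW.
by apply: differentiable_continuous; exact/derivable1_diffP.
Qed.

Let dV (x : R) : 0 < x -> is_derive x 1 (fun y : R => y^-1) (- x ^- 2).
Proof.
move=> x0; have := @is_deriveV _ id x 1 1 (lt0r_neq0 x0) (is_derive_id _ _).
by rewrite /= [_ *: _]mulr1.
Qed.

Lemma dual_w_pos (x : R) : 0 < x -> is_derive x 1 dual_w (dual_p x).
Proof.
move=> x0; have V0 : 0 < x^-1 by rewrite invr_gt0.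
have d1 := @is_derive1_comp _ W (fun y => y^-1) x _ _ (dW V0) (dV x0).
have d2 := is_deriveM (is_derive_id x 1) d1.
have -> : dual_p x = x *: (W^`()%classic x^-1 * - x ^- 2) + (W \o (fun y => y^-1)) x *: 1.
  rewrite /dual_p x0 /= [_ *: 1]mulr1 [_ *: _]mulrA -exprVn expr2.
  by rewrite mulrN mulrACA divff ?gt_eqF// ; ring.
apply: near_eq_is_derive d2; near=> y.
rewrite /dual_w (_ : 0 < y)//.
by near: y; exact: lt_nbhsr.
Unshelve. all: by end_near. Qed.

Lemma W_cvgy e : 0 < e -> exists2 d, 0 < d &
  forall x, 0 < x -> x < d -> `|gamma - W x^-1| < e.
Proof.
move=> e0; have /cvgrPdist_lt /(_ e e0) [M [_ HM]] := energy_cvgy hW.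
exists (`|M| + 1)^-1; first by rewrite invr_gt0 ltr_wpDl.
move=> x x0 xd; apply: HM; rewrite (le_lt_trans (ler_norm M))//.
rewrite (@lt_trans _ _ (`|M| + 1)) ?ltrDl//.
by rewrite -[ltLHS]invrK ltf_pV2// posrE invr_gt0 ltr_wpDl.
Qed.

Lemma dual_w_derive (x : R) : is_derive x 1 dual_w (dual_p x).
Proof.
have [x0|x0|->] := ltrgtP x 0; last 1 first.
- apply/is_derive1_caratheodory.
  exists (fun y => if 0 < y then W y^-1 else gamma); split.
  + move=> z; rewrite /dual_w ltxx mulr0 !subr0; case: ifP => // _; exact: mulrC.
  + rewrite /prop_for /continuous_at ltxx; apply/cvgrPdist_lt => e e0.
    have [d d0 Hd] := W_cvgy e0.
    near=> y; case: ifPn => y0; last by rewrite subrr normr0.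
    apply: Hd => //; near: y; exact: lt_nbhsl.
  + by rewrite /dual_p ltxx.
- have d : is_derive x 1 (fun y => gamma * y) gamma.
    by apply: is_derive_eq; rewrite [_%:A]mulr1.
  rewrite /dual_p ltNge (ltW x0) /=; apply: near_eq_is_derive d; near=> y.
  rewrite /dual_w ltNge (_ : y <= 0)//; apply/ltW; near: y; exact: lt_nbhsl.
- exact: dual_w_pos.
Unshelve. all: by end_near. Qed.

(** By concavity F W'(F) lies between W (2 F) - W F and 2 (W F - W (F / 2)), which
    both tend to 0. *)
Lemma FW'_cvg0 e : 0 < e -> exists2 d, 0 < d &
  forall x, 0 < x -> x < d -> `|x^-1 * W^`()%classic x^-1| < e.
Proof.
move=> e0; have e8 : 0 < e / 8 by rewrite divr_gt0.
have [d d0 Hd] := W_cvgy e8.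
exists (Num.min d kappa / 2); first by rewrite divr_gt0// lt_min d0 kp.
move=> x x0; rewrite ltr_pdivlMr// lt_min => /andP[xd xk].
have x2 : x * 2 = x + x by ring.
have A (y : R) : 0 < y -> y <= x * 2 -> `]kappa^-1, +oo[%classic y^-1.
  move=> y0 yx; rewrite /= in_itv/= andbT ltf_pV2 ?posrE//.
  exact: le_lt_trans yx xk.
have V0 : 0 < x^-1 by rewrite invr_gt0.
have cA a b t : `]kappa^-1, +oo[%classic a -> `]kappa^-1, +oo[%classic b ->
    0 < t < 1 -> `]kappa^-1, +oo[%classic (t * a + (1 - t) * b).
  exact: itv_convex.
have dN := is_deriveN (dW V0).
have xx2 : x^-1 != (x * 2)^-1.
  by rewrite (inj_eq invr_inj) lt_eqF// ltr_pMr// ltr1n.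
have xx2' : x^-1 != (x / 2)^-1.
  by rewrite (inj_eq invr_inj) gt_eqF// ltr_pdivrMr// ltr_pMr// ltr1n.
have Ax : `]kappa^-1, +oo[%classic x^-1 by apply: A => //; rewrite ler_pMr// ler1n.
have h1 := strictly_convex_tangent (energy_concave hW) cA dN Ax
  (A (x * 2) (mulr_gt0 x0 (ltr0n _ 2)) (lexx _)) xx2.
have xh0 : 0 < x / 2 by rewrite divr_gt0.
have xhx : x / 2 <= x * 2 by rewrite ler_pdivrMr// x2; lra.
have h2 := strictly_convex_tangent (energy_concave hW) cA dN Ax (A _ xh0 xhx) xx2'.
have b1 := Hd x x0 (lt_trans (_ : x < x * 2) xd).
have {}b1 : `|gamma - W x^-1| < e / 8 by apply: b1; rewrite ltr_pMr// ltr1n.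
have b2 : `|gamma - W (x * 2)^-1| < e / 8 by apply: Hd => //; rewrite mulr_gt0.
have b3 : `|gamma - W (x / 2)^-1| < e / 8.
  by apply: Hd => //; apply: le_lt_trans xhx xd.
move: h1 h2 b1 b2 b3; rewrite !ltr_norml.
have -> : (x * 2)^-1 - x^-1 = - (x^-1 / 2) by field; rewrite gt_eqF.
have -> : (x / 2)^-1 - x^-1 = x^-1 by field; rewrite gt_eqF.
set D := W^`()%classic x^-1; rewrite /= [x^-1 * D]mulrC.
have -> : - D * - (x^-1 / 2) = D * x^-1 / 2 by ring.
rewrite mulNr.
set a := W x^-1; set b := W _; set c := W _.
move: (D * x^-1) => v h1 h2 /andP[? ?] /andP[? ?] /andP[? ?].
apply/andP; split; lra.
Qed.

Lemma dual_p_cont : continuous dual_p.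
Proof.
move=> x; have [x0|x0|->] := ltrgtP x 0; last 1 first.
- rewrite /continuous_at /dual_p ltxx; apply/cvgrPdist_lt => e e0.
  have e2 : 0 < e / 2 by rewrite divr_gt0.
  have [d d0 Hd] := W_cvgy e2; have [d' d'0 Hd'] := FW'_cvg0 e2.
  near=> y; case: ifPn => y0; last by rewrite subrr normr0.
  rewrite opprB addrC -addrA [- _ + _]addrC.
  rewrite (le_lt_trans (ler_normD _ _))// [e]splitr ltrD//.
    by apply: Hd' => //; near: y; exact: lt_nbhsl.
  by apply: Hd => //; near: y; exact: lt_nbhsl.
- have : {for x, continuous (cst gamma : R -> R)} by exact: cst_continuous.
  rewrite /continuous_at {2}/dual_p ltNge (ltW x0) /=.
  apply: cvg_trans; apply: near_eq_cvg; near=> y.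
  rewrite /dual_p ltNge (_ : y <= 0)//; apply/ltW; near: y; exact: lt_nbhsl.
- have V0 : 0 < x^-1 by rewrite invr_gt0.
  have cV : {for x, continuous (fun y : R => y^-1)} by apply: inv_continuous; rewrite gt_eqF.
  have c1 : {for x, continuous (fun y : R => W y^-1 - y^-1 * W^`()%classic y^-1)}.
    apply: continuousB.
      by apply: (continuous_comp cV); exact: is_derive_continuous (dW V0).
    apply: continuousM => //.
    by apply: (continuous_comp cV); exact: is_derive_continuous (dW1 V0).
  move: c1; rewrite /continuous_at {2}/dual_p x0.
  apply: cvg_trans; apply: near_eq_cvg; near=> y.
  by rewrite /dual_p (_ : 0 < y)//; near: y; exact: lt_nbhsr.
Unshelve. all: by end_near. Qed.

Lemma dual_p_derive (x : R) : 0 < x -> is_derive x 1 dual_p (dual_p2 x).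
Proof.
move=> x0; have V0 : 0 < x^-1 by rewrite invr_gt0.
have d1 := @is_derive1_comp _ W (fun y => y^-1) x _ _ (dW V0) (dV x0).
have d2 := @is_derive1_comp _ W^`()%classic (fun y => y^-1) x _ _ (dW1 V0) (dV x0).
have d3 := is_deriveB d1 (is_deriveM (dV x0) d2).
have e : dual_p2 x = W^`()%classic x^-1 * - x ^- 2 -
    (x^-1 *: (W^`(2)%classic x^-1 * - x ^- 2) + (W^`()%classic \o (fun y => y^-1)) x *: - x ^- 2).
  rewrite /dual_p2 /GRing.scale /= -!exprVn.
  by ring.
rewrite e; apply: near_eq_is_derive d3; near=> y.
rewrite /dual_p (_ : 0 < y)//.
by near: y; exact: lt_nbhsr.
Unshelve. all: by end_near. Qed.

Lemma dual_p2_cont (x : R) : 0 < x -> {for x, continuous dual_p2}.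
Proof.
move=> x0; have V0 : 0 < x^-1 by rewrite invr_gt0.
have cV : {for x, continuous (fun y : R => y^-1)} by apply: inv_continuous; rewrite gt_eqF.
apply: continuousM; first by apply: (continuous_comp cV); exact: cW2.
apply: (@continuous_comp _ _ _ (fun y : R => y^-1) (fun z : R => z ^+ 3)) => //.
exact: exprn_continuous.
Qed.

Lemma dual_concave_convex : concave_convex dual_w dual_p dual_p2 kappa.
Proof.
have k01 := energy_kappa hW; have /andP[_ k1] := k01.
have wV x : 0 < x -> dual_w x = x * W x^-1 by move=> x0; rewrite /dual_w x0.
have conc : strictly_convex_on `]0, kappa[ (fun x => x * - W x^-1).
  apply: (strictly_convex_perspective (energy_concave hW)) => x.
  rewrite /= !in_itv/= andbT => /andP[x0 xk]; split => //.
  by rewrite ltf_pV2.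
have conv : strictly_convex_on `]kappa, +oo[ (fun x => x * W x^-1).
  apply: (strictly_convex_perspective (energy_convex hW)) => x.
  rewrite /= !in_itv/= andbT => kx; have x0 := lt_trans kp kx; split => //.
  by rewrite invr_gt0 x0 /= ltf_pV2.
have dpos (x : R) : 0 < x -> is_derive x 1 (fun y => y * W y^-1) (dual_p x).
  move=> x0; apply: near_eq_is_derive (dual_w_derive x); near=> y.
  by rewrite wV//; near: y; exact: lt_nbhsr.
have wpos x : 0 < x -> 0 <= x * W x^-1.
  move=> x0; have [->|x1] := eqVneq x 1; first by rewrite invr1 (energy1 hW) mulr0.
  rewrite mulr_ge0 ?(ltW x0)// ltW// (energy_gt0 hW)// ?invr_gt0//.
  by rewrite invr_eq1.
split => //.
- exact: dual_w_derive.
- exact: dual_p_cont.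
- exact: dual_p_derive.
- exact: dual_p2_cont.
- move=> x y x0 xy yk; rewrite -ltrN2.
  apply: (@continuous_increasing_closure R (fun x => - dual_p x) 0 kappa) => //.
    by move=> z; apply: continuousN; exact: dual_p_cont.
  move=> a b a0 ab bk.
  apply: (@strictly_convex_derive_lt R `]0, kappa[%classic
      (fun x => x * - W x^-1) (fun x => - dual_p x)) => //.
  + by move=> *; exact: itv_convex.
  + move=> z /=; rewrite in_itv/= => /andP[z0 _].
    have := is_deriveN (dpos z z0); congr is_derive.
    by apply/funext => u /=; rewrite mulrN.
  + by rewrite /= in_itv/= a0 (lt_trans ab).
  + by rewrite /= in_itv/= bk (lt_trans a0).
- move=> x y kx xy.
  apply: (@continuous_increasing_closure R dual_p kappa (y + 1)) => //.
  + exact: dual_p_cont.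
  + move=> a b ka ab _.
    apply: (@strictly_convex_derive_lt R `]kappa, +oo[%classic
        (fun x => x * W x^-1) dual_p) => //.
    * by move=> *; exact: itv_convex.
    * move=> z /=; rewrite in_itv/= andbT => kz; apply: dpos; exact: lt_trans kz.
    * by rewrite /= in_itv/= ka.
    * by rewrite /= in_itv/= andbT (lt_trans ka).
  + by rewrite lerDl.
- by rewrite /dual_w ltxx mulr0.
- by rewrite wV// invr1 (energy1 hW) mulr0.
- move=> x /andP[]; rewrite le_eqVlt => /predU1P[<- _|x0 _].
    by rewrite /dual_w ltxx mulr0.
  by rewrite wV// wpos.
- have d0 := @derive1_at_min R (fun y => y * W y^-1) 2^-1 2 1.
  have {}d0 : is_derive (1 : R) 1 (fun y => y * W y^-1) 0.
    apply: d0.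
    + by rewrite -[leRHS]invrK lef_pV2 ?posrE ?invr_gt0//; lra.
    + move=> t; rewrite in_itv/= => /andP[t2 _].
      have t0 : 0 < t by apply: lt_trans t2; rewrite invr_gt0.
      by have [] := dpos t t0.
    + by rewrite in_itv/= ltr1n invf_lt1 ?ltr1n.
    + move=> t; rewrite in_itv/= => /andP[t2 _].
      by rewrite invr1 (energy1 hW) mulr0 wpos//; apply: lt_trans t2; rewrite invr_gt0.
  by rewrite -(is_derive1E (dpos 1 ltr01)) (is_derive1E d0).
Unshelve. all: by end_near. Qed.

Lemma Wstar_finE x : 0 <= x -> Wstar_fin W x = dual_w x.
Proof.
rewrite /Wstar_fin /= /Wstar /dual_w; case: ltrgtP => //= <- _.
by rewrite mulr0.
Qed.

Lemma Wstar_fin1E x : 0 < x -> (Wstar_fin W)^`()%classic x = dual_p x.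
Proof.
move=> x0; apply: is_derive1E; apply: near_eq_is_derive (dual_w_derive x).
by near=> y; rewrite Wstar_finE//; apply/ltW; near: y; exact: lt_nbhsr.
Unshelve. all: by end_near. Qed.

Lemma dWstarE x : 0 <= x -> dWstar W gamma x = dual_p x.
Proof.
rewrite /dWstar le_eqVlt => /predU1P[<-|x0]; first by rewrite eqxx /dual_p ltxx.
by rewrite gt_eqF// Wstar_fin1E.
Qed.

Lemma Wstar_fin2E x : 0 < x -> (Wstar_fin W)^`(2)%classic x = dual_p2 x.
Proof.
move=> x0; rewrite (derive1nS _ 1); apply: is_derive1E.
apply: near_eq_is_derive (dual_p_derive x0).
by near=> y; rewrite derive1n1 Wstar_fin1E//; near: y; exact: lt_nbhsr.
Unshelve. all: by end_near. Qed.

End dual_energy.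

(** * Divided differences and chords of the dual energy *)

Section divided_difference.
Context {R : realType}.
Implicit Types f df : R -> R.

Definition divdiff f df (x y : R) := if x == y then df x else (f y - f x) / (y - x).

Lemma divdiffxx f df x : divdiff f df x x = df x.
Proof. by rewrite /divdiff eqxx. Qed.

Lemma divdiffE f df x y : divdiff f df x y * (y - x) = f y - f x.
Proof.
rewrite /divdiff; case: eqVneq => [->|xy]; first by rewrite !subrr mulr0.
by rewrite divfK// subr_eq0 eq_sym.
Qed.

Lemma divdiffC f df x y : divdiff f df x y = divdiff f df y x.
Proof.
rewrite /divdiff eq_sym; case: eqVneq => [->//|yx].
by rewrite -opprB -[X in _ / X]opprB invrN mulrNN.
Qed.

Lemma divdiff_mean f df (x y : R) : x <= y ->
  (forall z, x <= z <= y -> is_derive z 1 f (df z)) ->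
  exists2 c, x <= c <= y & divdiff f df x y = df c.
Proof.
move=> xy H; have [c cxy fE] := mean_value xy H.
have [xy'|xy'] := eqVneq x y.
  by exists x; rewrite ?lexx// /divdiff xy' eqxx.
exists c => //; rewrite /divdiff (negbTE xy') fE mulfK// subr_eq0 eq_sym//.
Qed.

Lemma divdiff_eq f df f' df' (h : R -> R -> R) x y :
  df' x = df x + h x x -> f' y - f' x = f y - f x + h x y * (y - x) ->
  divdiff f' df' x y = divdiff f df x y + h x y.
Proof.
move=> e1 e2; rewrite /divdiff; case: eqVneq => [<-//|xy].
by rewrite e2 mulrDl mulfK// subr_eq0 eq_sym.
Qed.

Lemma continuous_divdiff f df : (forall z : R, is_derive z 1 f (df z)) ->
  continuous df -> continuous (fun z : R * R => divdiff f df z.1 z.2).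
Proof.
move=> dfE cdf [x0 y0].
have cf : continuous f by move=> x; exact: is_derive_continuous (dfE x).
have [<-|xy0] := eqVneq x0 y0.
  rewrite /continuous_at /= divdiffxx; apply/cvgrPdist_lt => e e0.
  have /cvgrPdist_lt /(_ e e0) [d /= d0 Hd] := cdf x0.
  exists (ball x0 d, ball x0 d); first by split; exact: nbhsx_ballx.
  move=> [x y] /= [xd yd].
  wlog xy : x y xd yd / x <= y.
    move=> W; have [/W|/ltW yx] := leP x y; first exact.
    by rewrite divdiffC; exact: W.
  have [c /andP[xc cy] ->] := divdiff_mean xy (fun z _ => dfE z).
  apply: Hd; move: xd yd; rewrite -!ball_normE /= !ltr_norml.
  move=> /andP[? ?] /andP[? ?]; apply/andP; split; lra.
have c1 : {for (x0, y0), continuous (fun z : R * R => (f z.2 - f z.1) / (z.2 - z.1))}.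
  apply: continuousM.
    apply: continuousB; apply: continuous_comp; try exact: cf.
      exact: cvg_snd.
    exact: cvg_fst.
  apply: continuousV; first by rewrite /= subr_eq0 eq_sym.
  by apply: continuousB; [exact: cvg_snd|exact: cvg_fst].
move: c1; rewrite /continuous_at {2}/divdiff /= (negbTE xy0).
apply: cvg_trans; apply: near_eq_cvg.
have : \forall z \near (x0, y0), (z : R * R).1 - z.2 != 0.
  have c2 : {for (x0, y0), continuous (fun z : R * R => z.1 - z.2)}.
    by apply: continuousB; [exact: cvg_fst|exact: cvg_snd].
  by apply: (cvgr_neq0 _ c2); rewrite /= subr_eq0.
apply: filterS => z; rewrite subr_eq0 => zz.
by rewrite /divdiff (negbTE zz).
Qed.

End divided_difference.

Section orbits.
Context {R : realType}.
Variables (w p p2 : R -> R) (k : R).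
Hypothesis hw : concave_convex w p p2 k.

Notation dd := (divdiff w p).

(** minus the second divided difference of w at a, h, b; the value for a = b is the
    one on the triple diagonal, as a <= h <= b is understood *)
Definition gap (a b h : R) : R :=
  if a == b then - p2 b / 2 else (dd a h - dd h b) / (b - a).

Lemma dd_mean x y : x <= y -> exists2 c, x <= c <= y & dd x y = p c.
Proof. by move=> xy; apply: divdiff_mean => // z _; exact: cc_derive hw z. Qed.

(** The energy integral of the orbits: with m the slope of the chord, half the
    square of the velocity at height h is the right-hand side. *)
Lemma gap_chord a b h : a <= h <= b ->
  (h - a) * (b - h) * gap a b h = w h - w a - dd a b * (h - a).
Proof.
move=> /andP[ah hb]; rewrite /gap; case: eqVneq => [ab|ab].
  have -> : h = a by apply/le_anti; rewrite ah ab hb.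
  by rewrite !subrr !(mul0r, mulr0) subrr.
have ba : b - a != 0 by rewrite subr_eq0 eq_sym.
apply: (mulIf ba); rewrite -[LHS]mulrA divfK//.
transitivity ((b - h) * (dd a h * (h - a)) - (h - a) * (dd h b * (b - h))); first by ring.
rewrite !divdiffE.
transitivity ((w h - w a) * (b - a) - (dd a b * (b - a)) * (h - a)); last by ring.
by rewrite divdiffE; ring.
Qed.

Lemma gap_left a b : a != b -> (b - a) * gap a b a = p a - dd a b.
Proof.
move=> ab; rewrite /gap (negbTE ab) divdiffxx mulrC divfK//.
by rewrite subr_eq0 eq_sym.
Qed.

Lemma gap_right a b : a != b -> (b - a) * gap a b b = dd a b - p b.
Proof.
move=> ab; rewrite /gap (negbTE ab) divdiffxx mulrC divfK//.
by rewrite subr_eq0 eq_sym.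
Qed.

(** The gap of q x ^ 2 / 2 is the constant - q / 2, and w - q x ^ 2 / 2 has a
    derivative that varies by at most e (b - a) over [a, b]. *)
Lemma gap_approx a b h q e : 0 < a -> a <= h <= b ->
  (forall x, a <= x <= b -> `|p2 x - q| <= e) -> `|gap a b h + q / 2| <= e.
Proof.
move=> a0 /andP[ah hb] He.
have ab := le_trans ah hb.
rewrite /gap; case: eqVneq => [ab'|ab'].
  have := He b; rewrite ab lexx => /(_ isT).
  have -> : - p2 b / 2 + q / 2 = - ((p2 b - q) / 2) by ring.
  rewrite normrN normrM [`|2^-1|]ger0_norm ?invr_ge0//.
  have := normr_ge0 (p2 b - q); lra.
have ltab : a < b by rewrite lt_neqAle ab' ab.
pose v x := w x - q / 2 * x ^+ 2; pose v' x := p x - q * x.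
have dv (x : R) : is_derive x 1 v (v' x).
  have d := is_deriveB (cc_derive hw x) (is_deriveZ (q / 2) (is_deriveX 2 (is_derive_id x 1))).
  apply: (is_derive_eq d).
  rewrite /v' /GRing.scale /=; congr (_ - _).
  by rewrite expr1 mulr1; field.
have dv' (x : R) : 0 < x -> is_derive x 1 v' (p2 x - q).
  move=> x0; have d := is_deriveB (cc_derive2 hw x0) (is_deriveZ q (is_derive_id x 1)).
  by apply: (is_derive_eq d); rewrite /GRing.scale /= mulr1.
have dvE x y : divdiff v v' x y = dd x y + - (q / 2 * (x + y)).
  apply: (@divdiff_eq R w p v v' (fun x y => - (q / 2 * (x + y)))).
    by rewrite /v'; field.
  by rewrite /v; ring.
have [c1 /andP[ac1 c1h] e1] := divdiff_mean ah (fun z _ => dv z).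
have [c2 /andP[hc2 c2b] e2] := divdiff_mean hb (fun z _ => dv z).
have c12 := le_trans c1h hc2.
have [c /andP[cc1 cc2] ce] := @mean_value R v' (fun x => p2 x - q) c1 c2 c12
  (fun z zc => dv' z (lt_le_trans a0 (le_trans ac1 (andP zc).1))).
have -> : (dd a h - dd h b) / (b - a) + q / 2 = (v' c1 - v' c2) / (b - a).
  rewrite -e1 -e2 !dvE; field; lra.
rewrite -opprB ce mulNr normrN -mulrA normrM.
have hc : `|p2 c - q| <= e.
  by apply: He; rewrite (le_trans ac1 cc1) (le_trans cc2 c2b).
have e0 : 0 <= e by apply: le_trans hc.
rewrite -[leRHS]mulr1 ler_pM// ger0_norm; last by rewrite divr_ge0 ?subr_ge0.
rewrite ler_pdivrMr ?subr_gt0// mul1r; lra.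
Qed.

(** w + Q x ^ 4 / 12 is concave on [0, b], so the gap of w dominates that of
    - Q x ^ 4 / 12, which is Q / 12 times the sum of the monomials of degree 2 in
    a, h, b. *)
Lemma gap_lower a b h Q : 0 <= a -> a <= h <= b -> 0 < b -> 0 <= Q ->
  (forall x, 0 < x <= b -> p2 x <= - (Q * x ^+ 2)) ->
  Q / 12 * h ^+ 2 <= gap a b h.
Proof.
move=> a0 /andP[ah hb] b0 Q0 HQ.
have ab := le_trans ah hb; have h0 := le_trans a0 ah.
rewrite /gap; case: eqVneq => [ab'|ab'].
  have -> : h = b by apply/le_anti; rewrite hb -ab' ah.
  have := HQ b; rewrite b0 lexx => /(_ isT).
  have : 0 <= Q * b ^+ 2 by rewrite mulr_ge0// sqr_ge0.
  have -> : Q / 12 * b ^+ 2 = (Q * b ^+ 2) / 12 by ring.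
  lra.
have ltab : a < b by rewrite lt_neqAle ab' ab.
pose v x := w x + Q / 12 * x ^+ 4; pose v' x := p x + Q / 3 * x ^+ 3.
have dv (x : R) : is_derive x 1 v (v' x).
  have d := is_deriveD (cc_derive hw x) (is_deriveZ (Q / 12) (is_deriveX 4 (is_derive_id x 1))).
  apply: (is_derive_eq d).
  rewrite /v' /GRing.scale /=; congr (_ + _).
  by rewrite mulr1; field.
have dv' (x : R) : 0 < x -> is_derive x 1 v' (p2 x + Q * x ^+ 2).
  move=> x0; have d := is_deriveD (cc_derive2 hw x0) (is_deriveZ (Q / 3) (is_deriveX 3 (is_derive_id x 1))).
  apply: (is_derive_eq d); rewrite /GRing.scale /=; congr (_ + _).
  by rewrite mulr1; field.
have dvE x y : divdiff v v' x y = dd x y + Q / 12 * (x ^+ 3 + x ^+ 2 * y + x * y ^+ 2 + y ^+ 3).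
  apply: (@divdiff_eq R w p v v' (fun x y => Q / 12 * (x ^+ 3 + x ^+ 2 * y + x * y ^+ 2 + y ^+ 3))).
    by rewrite /v'; field.
  by rewrite /v; ring.
have cv' : continuous v'.
  move=> x; apply: (@continuousD _ _ _ p (fun x => Q / 3 * x ^+ 3)).
    exact: (cc_cont hw).
  by apply: continuousM; [exact: cst_continuous|exact: exprn_continuous].
have v'_le c1 c2 : 0 <= c1 -> c1 <= c2 -> c2 <= b -> v' c2 <= v' c1.
  move=> c10; rewrite le_eqVlt => /predU1P[->//|c12 c2b].
  have [c|c|] := @MVT R v' (fun x => p2 x + Q * x ^+ 2) c1 c2 c12.
  - by rewrite in_itv/= => /andP[cc _]; apply: dv'; exact: le_lt_trans cc.
  - move: c; exact: continuous_subspaceT.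
  move=> c; rewrite in_itv/= => /andP[cc1 cc2] e.
  rewrite -subr_le0 e mulr_le0_ge0 ?subr_ge0 ?(ltW c12)//.
  have := HQ c; rewrite (le_lt_trans c10 cc1) (ltW (lt_le_trans cc2 c2b)) => /(_ isT).
  by move: (Q * c ^+ 2) => ? ?; lra.
have [c1 /andP[ac1 c1h] e1] := divdiff_mean ah (fun z _ => dv z).
have [c2 /andP[hc2 c2b] e2] := divdiff_mean hb (fun z _ => dv z).
have := v'_le c1 c2 (le_trans a0 ac1) (le_trans c1h hc2) c2b.
rewrite -e1 -e2 !dvE => le.
rewrite ler_pdivlMr ?subr_gt0//.
have : 0 <= Q / 12 * ((b - a) * (h * (a + b) + (a ^+ 2 + a * b + b ^+ 2))).
  have b0' := ltW b0.
  apply: mulr_ge0; first by rewrite divr_ge0.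
  apply: mulr_ge0; first by rewrite subr_ge0.
  by rewrite addr_ge0 ?mulr_ge0 ?addr_ge0 ?sqr_ge0 ?mulr_ge0.
have -> : Q / 12 * ((b - a) * (h * (a + b) + (a ^+ 2 + a * b + b ^+ 2))) =
  Q / 12 * (h ^+ 3 + h ^+ 2 * b + h * b ^+ 2 + b ^+ 3) -
  Q / 12 * (a ^+ 3 + a ^+ 2 * h + a * h ^+ 2 + h ^+ 3) - Q / 12 * h ^+ 2 * (b - a) by ring.
lra.
Qed.

End orbits.

(** * The family of orbits *)

Section clamp.
Context {R : realType}.

Definition clamp (lo hi x : R) := Num.max lo (Num.min hi x).

Lemma clamp_itv lo hi x : lo <= hi -> lo <= clamp lo hi x <= hi.
Proof. by move=> lh; rewrite /clamp le_max lexx/= ge_max lh ge_min lexx. Qed.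

Lemma clamp_id lo hi x : lo <= x <= hi -> clamp lo hi x = x.
Proof. by move=> /andP[lx xh]; rewrite /clamp min_r// max_r. Qed.

Lemma continuous_clamp (T : topologicalType) lo hi (f : T -> R) : continuous f ->
  continuous (fun t => clamp lo hi (f t)).
Proof.
move=> cf t; apply: (@continuous_max R T (cst lo) (cst hi \min f) t).
  exact: cst_continuous.
by apply: continuous_min; [exact: cst_continuous|exact: cf].
Qed.

End clamp.

Section half_period.
Context {R : realType}.
Variables (w p p2 : R -> R) (k bm : R).
Hypotheses (hw : concave_convex w p p2 k) (bm0 : 0 < bm) (bm1 : bm <= 1).

(** A solution of h'' = p h - m oscillates between a trough and a crest, where m is
    the slope of the chord of w between them. The parameters z are the ratio of
    trough to crest and the crest: the side z.1 = 1 consists of constant orbits,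
    the side z.1 = 0 of the orbits that reach the value 0, and the degenerate
    corner trough = crest = 0 is blown up and cut off by crest >= bm. Clamping
    makes everything defined and continuous on the whole plane. *)
Definition crest (z : R * R) : R := clamp bm 1 z.2.
Definition trough (z : R * R) : R := clamp 0 1 z.1 * crest z.
(** Along an orbit the height is this function of a phase t, which regularises the
    turning points. *)
Definition height (zt : (R * R) * R) : R :=
  crest zt.1 - (crest zt.1 - trough zt.1) * ((1 + cos zt.2) / 2).
Definition orbit_gap (zt : (R * R) * R) : R :=
  gap w p p2 (trough zt.1) (crest zt.1) (height zt).

Lemma crest_itv z : bm <= crest z <= 1.
Proof. exact: clamp_itv. Qed.

Lemma crest_gt0 z : 0 < crest z.
Proof. by have /andP[h _] := crest_itv z; exact: lt_le_trans h. Qed.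

Lemma trough_ge0 z : 0 <= trough z.
Proof.
have /andP[h _] := @clamp_itv R 0 1 z.1 ler01.
by rewrite mulr_ge0// ltW// crest_gt0.
Qed.

Lemma trough_le_crest z : trough z <= crest z.
Proof.
have /andP[_ h] := @clamp_itv R 0 1 z.1 ler01.
by rewrite ger_pMl// crest_gt0.
Qed.

Lemma cos01 (t : R) : 0 <= (1 + cos t) / 2 <= 1.
Proof. by have := cos_geN1 t; have := cos_le1 t => ? ?; apply/andP; split; lra. Qed.

Lemma height_itv zt : trough zt.1 <= height zt <= crest zt.1.
Proof.
have /andP[c0 c1] := cos01 zt.2; have d := trough_le_crest zt.1.
rewrite /height; move: (crest _) (trough _) (_ / 2) c0 c1 d => b a c c0 c1 d.
by apply/andP; split; nra.
Qed.

Lemma height_surj z h : trough z <= h <= crest z ->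
  exists2 t, 0 <= t <= pi & height (z, t) = h.
Proof.
move=> /andP[ah hb].
have [ab|ab] := eqVneq (trough z) (crest z).
  exists 0; first by rewrite lexx pi_ge0.
  have -> : h = crest z by apply/le_anti; rewrite hb -ab.
  by rewrite /height /= ab subrr mul0r subr0.
have ltab : 0 < crest z - trough z by rewrite subr_gt0 lt_neqAle ab trough_le_crest.
pose c := 2 * (crest z - h) / (crest z - trough z) - 1.
have c1 : -1 <= c <= 1.
  rewrite /c; apply/andP; split.
    by rewrite lerBrDr addNr divr_ge0 ?(ltW ltab)// mulr_ge0// subr_ge0.
  by rewrite lerBlDr ler_pdivrMr//; lra.
exists (acos c); first by rewrite acos_ge0// acos_lepi.
rewrite /height /= acosK ?in_itv//= /c; field.
by rewrite gt_eqF.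
Qed.

Lemma height0 z : height (z, 0) = trough z.
Proof. by rewrite /height /= cos0; field. Qed.

Lemma heightpi z : height (z, pi) = crest z.
Proof. by rewrite /height /= cospi; field. Qed.

Lemma crest_cont : continuous crest.
Proof. by apply: continuous_clamp => z; exact: cvg_snd. Qed.

Lemma trough_cont : continuous trough.
Proof.
move=> z; apply: (@continuousM _ _ (fun z => clamp 0 1 z.1) crest); last exact: crest_cont.
by apply: continuous_clamp => z'; exact: cvg_fst.
Qed.

Let crest1_cont : continuous (fun zt : (R * R) * R => crest zt.1).
Proof. exact: (continuous_comp_fst crest_cont). Qed.

Let trough1_cont : continuous (fun zt : (R * R) * R => trough zt.1).
Proof. exact: (continuous_comp_fst trough_cont). Qed.

Lemma height_cont : continuous height.
Proof.
move=> zt; apply: (@continuousB _ _ _ (fun zt => crest zt.1)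
  (fun zt => (crest zt.1 - trough zt.1) * ((1 + cos zt.2) / 2))); first exact: crest1_cont.
apply: continuousM.
  by apply: continuousB; [exact: crest1_cont|exact: trough1_cont].
apply: continuousM; last exact: cst_continuous.
apply: continuousD; first exact: cst_continuous.
apply: (@continuous_comp _ _ _ snd (@cos R)); first exact: cvg_snd.
exact: continuous_cos.
Qed.

(** On the diagonal trough = crest the divided difference has to be compared with
    the second derivative of w nearby. *)
Lemma orbit_gap_cont : continuous orbit_gap.
Proof.
move=> zt0; have [ab|ab] := eqVneq (trough zt0.1) (crest zt0.1).
  have h0 := crest_gt0 zt0.1.
  set h := crest zt0.1 in ab h0.
  rewrite /continuous_at; have -> : orbit_gap zt0 = - p2 h / 2 by rewrite /orbit_gap /gap ab eqxx.
  apply/cvgrPdist_le => e e0.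
  have /cvgrPdist_le /(_ e e0) [d /= d0 Hd] := cc_cont2 hw h0.
  have d'0 : 0 < Num.min d h by rewrite lt_min d0.
  have nb : \forall zt \near zt0, `|crest zt0.1 - crest zt.1| < Num.min d h.
    by have /cvgrPdist_lt := @crest1_cont zt0; apply.
  have na : \forall zt \near zt0, `|trough zt0.1 - trough zt.1| < Num.min d h.
    by have /cvgrPdist_lt := @trough1_cont zt0; apply.
  near=> zt.
  have : `|crest zt0.1 - crest zt.1| < Num.min d h by near: zt.
  have : `|trough zt0.1 - trough zt.1| < Num.min d h by near: zt.
  rewrite ab -/h !lt_min => /andP[ad ah] /andP[bd bh].
  have a0 : 0 < trough zt.1 by move: ah; rewrite ltr_norml => /andP[_]; lra.
  have := @gap_approx _ _ _ _ _ hw _ _ _ (p2 h) e a0 (height_itv zt).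
  rewrite -/(orbit_gap zt).
  have -> : - p2 h / 2 - orbit_gap zt = - (orbit_gap zt + p2 h / 2) by ring.
  rewrite normrN; apply => x /andP[ax xb].
  rewrite distrC; apply: Hd; rewrite /=.
  move: ad bd; rewrite !ltr_norml => /andP[? ?] /andP[? ?]; apply/andP; split; lra.
pose g zt := (divdiff w p (trough zt.1) (height zt) - divdiff w p (height zt) (crest zt.1)) /
  (crest zt.1 - trough zt.1) : R.
have cdd := continuous_divdiff (cc_derive hw) (cc_cont hw).
have cg : {for zt0, continuous g}.
  apply: (@continuousM _ _ (fun zt => divdiff w p (trough zt.1) (height zt) -
    divdiff w p (height zt) (crest zt.1)) (fun zt => (crest zt.1 - trough zt.1)^-1)).
    apply: continuousB.
      apply: (@continuous_comp _ _ _ (fun zt => (trough zt.1, height zt))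
        (fun z => divdiff w p z.1 z.2)); last exact: cdd.
      by apply: continuous_pair; [exact: trough1_cont|exact: height_cont].
    apply: (@continuous_comp _ _ _ (fun zt => (height zt, crest zt.1))
      (fun z => divdiff w p z.1 z.2)); last exact: cdd.
    by apply: continuous_pair; [exact: height_cont|exact: crest1_cont].
  apply: continuousV; first by rewrite subr_eq0 eq_sym.
  by apply: continuousB; [exact: crest1_cont|exact: trough1_cont].
rewrite /continuous_at; have -> : orbit_gap zt0 = g zt0 by rewrite /orbit_gap /gap (negbTE ab).
apply: cvg_trans cg; apply: near_eq_cvg.
have c2 : {for zt0, continuous (fun zt => trough zt.1 - crest zt.1)}.
  by apply: continuousB; [exact: trough1_cont|exact: crest1_cont].
have := cvgr_neq0 _ c2; rewrite subr_eq0 => /(_ _ ab).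
by apply: filterS => zt; rewrite subr_eq0 /orbit_gap /gap => /negbTE ->.
Unshelve. all: by end_near. Qed.

Lemma orbit_gap_slice z : continuous (fun t => orbit_gap (z, t)).
Proof. by apply: continuous_slice2; exact: orbit_gap_cont. Qed.

(** By the energy integral the phase t of an orbit h = height (z, t) increases at
    the rate sqrt (2 orbit_gap), so this is the time spent per unit of phase. The
    gap is cut off below at d, which changes nothing on orbits whose gap exceeds d
    and keeps the others defined. *)
Definition slowness (d : R) (zt : (R * R) * R) : R :=
  (Num.sqrt (2 * Num.max (orbit_gap zt) d))^-1.

Lemma max_gap_gt0 d zt : 0 < d -> 0 < 2 * Num.max (orbit_gap zt) d.
Proof. by move=> d0; rewrite mulr_gt0// lt_max d0 orbT. Qed.

Lemma slowness_gt0 d zt : 0 < d -> 0 < slowness d zt.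
Proof. by move=> d0; rewrite invr_gt0 sqrtr_gt0 max_gap_gt0. Qed.

Lemma slowness_cont d : 0 < d -> continuous (slowness d).
Proof.
move=> d0 zt; apply: (@continuousV _ _ (fun zt => Num.sqrt (2 * Num.max (orbit_gap zt) d))).
  by rewrite gt_eqF// sqrtr_gt0 max_gap_gt0.
apply: (@continuous_comp _ _ _ (fun zt => 2 * Num.max (orbit_gap zt) d) (@Num.sqrt R)); last exact: sqrt_continuous.
apply: continuousM; first exact: cst_continuous.
apply: (@continuous_max R _ orbit_gap (cst d) zt); first exact: orbit_gap_cont.
exact: cst_continuous.
Qed.

Lemma slowness_slice d z : 0 < d -> continuous (fun t => slowness d (z, t)).
Proof. by move=> d0; apply: continuous_slice2; exact: slowness_cont. Qed.

Definition mass_density d zt := height zt * slowness d zt.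

Lemma mass_density_cont d : 0 < d -> continuous (mass_density d).
Proof.
by move=> d0 zt; apply: (@continuousM _ _ height (slowness d));
  [exact: height_cont|exact: slowness_cont].
Qed.

Lemma mass_density_slice d z : 0 < d -> continuous (fun t => mass_density d (z, t)).
Proof. by move=> d0; apply: continuous_slice2; exact: mass_density_cont. Qed.

Lemma mass_density_ge0 d zt : 0 < d -> 0 <= mass_density d zt.
Proof.
move=> d0; rewrite mulr_ge0 ?(ltW (slowness_gt0 _ d0))//.
by have /andP[h _] := height_itv zt; exact: le_trans (trough_ge0 _) h.
Qed.

(** in terms of time, the integral of the height over half a period *)
Definition half_mass d z : R := prim (fun t => mass_density d (z, t)) pi.
Definition half_time d z : R := prim (fun t => slowness d (z, t)) pi.

Lemma half_mass_cont d : 0 < d -> continuous (half_mass d).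
Proof.
move=> d0; have := continuous_prim_param (mass_density_cont d0).
exact: continuous_slice1.
Qed.

Lemma half_time_cont d : 0 < d -> continuous (half_time d).
Proof.
move=> d0; have := continuous_prim_param (slowness_cont d0).
exact: continuous_slice1.
Qed.

Lemma half_mass_mono d d' z : 0 < d' -> d' <= d -> half_mass d z <= half_mass d' z.
Proof.
move=> d'0 dd'; have d0 := lt_le_trans d'0 dd'.
apply: le_prim; [exact: pi_ge0|exact: mass_density_slice|exact: mass_density_slice|].
move=> t _; rewrite /mass_density ler_wpM2l//.
  by have /andP[h _] := height_itv (z, t); exact: le_trans (trough_ge0 _) h.
rewrite lef_pV2 ?posrE ?sqrtr_gt0 ?max_gap_gt0//.
by rewrite ler_wsqrtr// ler_pM2l// ge_max !le_max lexx dd' orbT.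
Qed.

End half_period.

(** * Degenerate orbits have infinite mass *)

Section divergence.
Context {R : realType}.
Variables (w p p2 : R -> R) (k bm : R).
Hypotheses (hw : concave_convex w p p2 k) (bm0 : 0 < bm) (bm1 : bm <= 1).

Notation crest := (crest bm).
Notation trough := (trough bm).
Notation height := (height bm).
Notation orbit_gap := (orbit_gap w p p2 bm).
Notation slowness := (slowness w p p2 bm).
Notation mass_density := (mass_density w p p2 bm).
Notation half_mass := (half_mass w p p2 bm).
Notation half_time := (half_time w p p2 bm).

Lemma prim_ge_sub (f : R -> R) (a b : R) : continuous f -> 0 <= a -> a <= b -> b <= pi ->
  (forall t, 0 <= t <= pi -> 0 <= f t) -> prim f b - prim f a <= prim f pi.
Proof.
move=> cf a0 ab bpi f0.
have mono x y : 0 <= x -> x <= y -> y <= pi -> prim f x <= prim f y.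
  move=> x0 xy ypi; apply: (@is_derive_nondecreasing R (prim f) f) => //.
    by move=> t _; exact: is_derive_prim.
  by move=> t /andP[xt ty]; rewrite f0// (le_trans x0)//= (le_trans ty).
have := mono b pi (le_trans a0 ab) bpi (lexx _).
have := mono 0 a (lexx _) a0 (le_trans ab bpi); rewrite prim0; lra.
Qed.

Lemma height_ge (z : R * R) t : crest z * ((1 - cos t) / 2) <= height (z, t).
Proof.
rewrite /height /=; have := trough_ge0 bm0 bm1 z; have := cos01 t.
move=> /andP[c0 c1] l0; rewrite -subr_ge0.
have -> : crest z - (crest z - trough z) * ((1 + cos t) / 2) - crest z * ((1 - cos t) / 2) =
  trough z * ((1 + cos t) / 2) by field.
exact: mulr_ge0.
Qed.

(** There the density of mass is of order 1 / sqrt d. *)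
Lemma half_mass_diverges_itv z (a b C : R) : 0 < a -> a < b -> b <= pi ->
  (forall t, a <= t <= b -> orbit_gap (z, t) <= 0) ->
  exists2 d, 0 < d & C < half_mass d z.
Proof.
move=> a0 ab bpi G0.
have h0 := crest_gt0 bm0 bm1 z.
pose e := crest z * ((1 - cos a) / 2).
have cosa : cos a < 1.
  rewrite -[ltRHS](@cos0 R) ltr_cos ?in_itv/= ?lexx ?pi_ge0//.
  by rewrite (ltW a0) (le_trans (ltW ab) bpi).
have e0 : 0 < e by rewrite mulr_gt0// divr_gt0// subr_gt0.
pose q := e * (b - a) / (`|C| + 1).
have q0 : 0 < q by rewrite divr_gt0 ?mulr_gt0 ?subr_gt0// ltr_wpDl.
pose d := q ^+ 2 / 2.
have d0 : 0 < d by rewrite divr_gt0// exprn_gt0.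
exists d => //.
have cf := mass_density_slice hw bm0 bm1 (z := z) d0.
apply: lt_le_trans (@prim_ge_sub _ a b cf (ltW a0) (ltW ab) bpi _); last first.
  by move=> t _; exact: mass_density_ge0.
have [t /andP[at_ tb] ->] := @mean_value R (prim (fun t => mass_density d (z, t)))
  _ a b (ltW ab) (fun t _ => is_derive_prim t cf).
rewrite /mass_density /slowness max_r; last first.
  by apply: le_trans (ltW d0); apply: G0; rewrite at_.
have -> : 2 * d = q ^+ 2 by rewrite /d mulrC divfK.
rewrite sqrtr_sqr gtr0_norm//.
have et : e <= height (z, t).
  apply: le_trans (height_ge z t); rewrite ler_pM2l// ler_pM2r// lerD2l lerN2.
  move: at_; rewrite le_eqVlt => /predU1P[->//|at_].
  rewrite ltW// ltr_cos// ?in_itv/=.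
    by rewrite (ltW a0) (le_trans (ltW ab) bpi).
  by rewrite (ltW (lt_trans a0 at_)) (le_trans tb bpi).
apply: (@lt_le_trans _ _ (e * q^-1 * (b - a))); last first.
  by rewrite ler_pM2r ?subr_gt0// ler_pM2r ?invr_gt0.
have -> : e * q^-1 * (b - a) = `|C| + 1.
  rewrite /q; field; rewrite ?gt_eqF ?subr_gt0// ?ltr_wpDl//.
by rewrite (le_lt_trans (ler_norm C))// ltrDl.
Qed.

Lemma cos_le0_pihalf_pi (t : R) : pi / 2 <= t <= pi -> cos t <= 0.
Proof.
have pi20 : 0 < pi / 2 :> R by rewrite divr_gt0// pi_gt0.
move=> /andP[]; rewrite -[X in _ -> _ -> _ <= X](@cos_pihalf R).
rewrite le_eqVlt => /predU1P[<-//|t1 t2]; rewrite ltW// ltr_cos// in_itv/=.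
  by rewrite (ltW pi20) (le_trans (ltW t1)).
by rewrite (ltW (lt_trans pi20 t1)).
Qed.

Lemma cos_quadratic (y : R) : 0 <= y <= pi -> 1 - cos y <= y ^+ 2.
Proof.
move=> /andP[y0 ypi].
have [c /andP[c0 cy]] := @mean_value R (@cos R) (fun x => - sin x) 0 y y0 (fun x _ => is_derive_cos x).
rewrite cos0 subr0 => e.
have [c' _] := @mean_value R (@sin R) (@cos R) 0 c c0 (fun x _ => is_derive_sin x).
rewrite sin0 !subr0 => e'.
have : sin c <= y by rewrite e' (le_trans _ cy)// ler_piMl// cos_le1.
have -> : 1 - cos y = sin c * y by rewrite -opprB e mulNr opprK.
by move=> h; rewrite expr2 ler_wpM2r.
Qed.

(** The density is at least of order 1 / (pi - t) up to a distance of order sqrt d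
    from pi, and its integral of order - ln d. *)
Lemma half_mass_diverges_log z (C K : R) : 0 < K ->
  (forall t, pi / 2 <= t <= pi -> orbit_gap (z, t) <= K * (pi - t) ^+ 2) ->
  exists2 d, 0 < d & C < half_mass d z.
Proof.
move=> K0 GK.
have h0 := crest_gt0 bm0 bm1 z; have pi0 := pi_gt0 R.
have pi20 : 0 < pi / 2 :> R by rewrite divr_gt0.
pose r := crest z / 2 / Num.sqrt (2 * K).
have sK0 : 0 < Num.sqrt (2 * K) by rewrite sqrtr_gt0 mulr_gt0.
have r0 : 0 < r by rewrite !divr_gt0.
pose E := (`|C| + 1) / r.
have E0 : 0 < E by rewrite divr_gt0// ltr_wpDl.
pose s := pi / 2 * expR (- E).
have s0 : 0 < s by apply: mulr_gt0 => //; exact: expR_gt0.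
have s1 : s < pi / 2 by rewrite gtr_pMr// expR_lt1 oppr_lt0.
pose d := K * s ^+ 2.
have d0 : 0 < d by rewrite mulr_gt0// exprn_gt0.
(* the quadratic bound equals d at distance s from pi *)
exists d => //.
have cf := mass_density_slice hw bm0 bm1 (z := z) d0.
have ab : pi / 2 <= pi - s by rewrite lerBrDr -lerBrDl; apply: le_trans (ltW s1) _; lra.
apply: lt_le_trans (@prim_ge_sub _ (pi / 2) (pi - s) cf (ltW pi20) ab _ _); last 2 first.
- by rewrite gerBl ltW.
- by move=> t _; exact: mass_density_ge0.
pose F t := prim (fun t => mass_density d (z, t)) t + r * ln (pi - t).
have dF t : pi / 2 <= t <= pi - s ->
    is_derive t 1 F (mass_density d (z, t) - r / (pi - t)).
  move=> /andP[_ ts].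
  have pt0 : 0 < pi - t by rewrite (lt_le_trans s0)// lerBrDr addrC -lerBrDr.
  have d1 : is_derive t 1 (fun t : R => pi - t) (- 1).
    have h := is_deriveB (is_derive_cst pi t 1) (is_derive_id t 1).
    by apply: (is_derive_eq h); rewrite sub0r.
  have d2 := @is_derive1_comp _ (@ln R) (fun t => pi - t) t _ _ (is_derive1_ln pt0) d1.
  have d3 := is_deriveD (is_derive_prim t cf) (is_deriveZ r d2).
  by apply: (is_derive_eq d3); rewrite /GRing.scale /= mulrN1 mulrN.
have := is_derive_nondecreasing ab dF; rewrite /F.
have -> : pi - (pi - s) = s by ring.
have -> : pi - pi / 2 = pi / 2 :> R by field.
have -> : ln s = ln (pi / 2) - E.
  have sp : expR (- E) \is Num.pos by rewrite posrE; exact: expR_gt0.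
  by rewrite /s lnM// expRK.
move=> H.
have rE : r * E = `|C| + 1 by rewrite /E mulrC divfK// gt_eqF.
have CC := ler_norm C.
suff : forall t, pi / 2 <= t <= pi - s -> 0 <= mass_density d (z, t) - r / (pi - t).
  move=> /H; rewrite mulrDr mulrN rE; lra.
move=> t /andP[t1 t2].
have pst : s <= pi - t by rewrite lerBrDr addrC -lerBrDr.
have pt0 : 0 < pi - t by exact: lt_le_trans pst.
have tpi : t <= pi by rewrite -subr_ge0 ltW.
have maxK : Num.max (orbit_gap (z, t)) d <= K * (pi - t) ^+ 2.
  rewrite ge_max GK ?t1 ?tpi//= ler_pM2l//.
  by rewrite ler_pXn2r ?nnegrE ?(ltW s0) ?(ltW pt0).
rewrite subr_ge0 /r /mass_density.
have -> : crest z / 2 / Num.sqrt (2 * K) / (pi - t) =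
    crest z / 2 * (Num.sqrt (2 * K) * (pi - t))^-1 by rewrite invfM mulrA.
have cost : cos t <= 0 by rewrite cos_le0_pihalf_pi// t1.
apply: ler_pM.
- by rewrite divr_ge0// ltW.
- by rewrite invr_ge0 mulr_ge0// ltW.
- apply: le_trans (height_ge z t); rewrite ler_pM2l//.
  by rewrite ler_pdivlMr// mulVf// lerBrDr addrC -lerBrDr subrr.
- have m0 := max_gap_gt0 w p p2 bm (z, t) d0.
  rewrite /slowness lef_pV2; first last.
  + by rewrite posrE sqrtr_gt0.
  + by rewrite posrE mulr_gt0.
  have -> : Num.sqrt (2 * K) * (pi - t) = Num.sqrt (2 * (K * (pi - t) ^+ 2)).
    by rewrite [in RHS]mulrA [in RHS]sqrtrM ?mulr_ge0 ?(ltW K0)// sqrtr_sqr gtr0_norm.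
  by rewrite ler_wsqrtr// ler_pM2l.
Qed.

(** To the right of a contact point h < b, where w is tangent to its chord, strict
    concavity would take w below the chord if h < k, and strict convexity would
    keep it above at b, where the two agree, if h >= k. *)
Lemma contact_at_right a b h : 0 <= a -> a < b -> a <= h <= b ->
  (forall x, a <= x <= b -> 0 <= gap w p p2 a b x) -> gap w p p2 a b h <= 0 ->
  h = b.
Proof.
move=> a0 ab /andP[ah hb] gap0 gaph.
have {}gaph : gap w p p2 a b h = 0.
  by apply/le_anti; rewrite gaph gap0// ah.
have [//|hb'] := eqVneq h b.
have {}hb : h < b by rewrite lt_neqAle hb' hb.
have abne : a != b by rewrite lt_eqF.
pose m := divdiff w p a b; pose phi x := w x - w a - m * (x - a).
have phiE x : a <= x <= b -> phi x = (x - a) * (b - x) * gap w p p2 a b x.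
  by move=> xab; rewrite (gap_chord w p p2 xab).
have dphi (x : R) : is_derive x 1 phi (p x - m).
  have d := is_deriveB (is_deriveB (cc_derive hw x) (is_derive_cst (w a) x 1))
    (is_deriveZ m (is_deriveB (is_derive_id x 1) (is_derive_cst a x 1))).
  by apply: (is_derive_eq d); rewrite /GRing.scale /= !subr0 mulr1.
have phi0 x : a <= x <= b -> 0 <= phi x.
  move=> xab; rewrite phiE// mulr_ge0 ?gap0// mulr_ge0// subr_ge0.
    by case/andP: xab.
  by case/andP: xab.
have phih : phi h = 0 by rewrite phiE ?gaph ?mulr0// ah ltW.
have ph : p h = m.
  have [ha|ha] := eqVneq h a.
    have := gap_left w p p2 abne.
    rewrite -[X in gap _ _ _ _ _ X]ha gaph mulr0.
    by rewrite ha => /esym/eqP; rewrite subr_eq0 => /eqP.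
  have ah' : a < h by rewrite lt_neqAle eq_sym ha ah.
  have [|t|||] := @derive1_at_min R phi a b h.
  - exact: ltW.
  - by have [] := dphi t.
  - by rewrite in_itv/= ah'.
  - by move=> t; rewrite in_itv/= => /andP[/ltW ta /ltW tb]; rewrite phih phi0// ta.
  - move=> _ e; apply/eqP; rewrite -subr_eq0 -(@derive_val _ _ _ _ _ _ _ (dphi h)) e//.
have mvt (x y : R) : x < y -> exists2 c, x < c < y & phi y - phi x = (p c - m) * (y - x).
  move=> xy; have cphi : {within `[x, y], continuous phi}.
    by apply: continuous_subspaceT => x'; exact: is_derive_continuous (dphi x').
  have [c cin cE] := @MVT R phi (fun x => p x - m) x y xy (fun x _ => dphi x) cphi.
  by exists c => //; move: cin; rewrite in_itv.
have [hk|kh] := ltP h k.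
  pose y := Num.min k b.
  have hy : h < y by rewrite lt_min hk.
  have [c /andP[hc cy] e] := mvt _ _ hy.
  have ck : c <= k by rewrite (le_trans (ltW cy))// ge_min lexx.
  have := cc_decr hw (le_trans a0 ah) hc ck; rewrite ph => pc.
  have : phi y < 0.
    by rewrite -[phi y]subr0 -phih e phih nmulr_rlt0 ?subr_gt0// subr_lt0.
  by rewrite ltNge phi0// (le_trans ah (ltW hy))/= ge_min lexx orbT.
have [c /andP[hc cb] e] := mvt _ _ hb.
have pc := cc_incr hw kh hc; rewrite ph in pc.
have : 0 < phi b - phi h by rewrite e mulr_gt0 ?subr_gt0.
by rewrite phih phiE ?(ltW ab) ?lexx// subrr mulr0 mul0r subrr ltxx.
Qed.

(** Either the gap is nonpositive on an interval of phases, or it vanishes only at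
    the crest, where w is then tangent to its chord: the orbit is homoclinic and
    takes a logarithmically infinite time to reach its crest. *)
Lemma half_mass_diverges z t0 C : 0 <= t0 <= pi -> orbit_gap (z, t0) <= 0 ->
  exists2 d, 0 < d & C < half_mass d z.
Proof.
move=> /andP[t00 t0pi] Gt0.
have h0 := crest_gt0 bm0 bm1 z; have pi0 := pi_gt0 R.
have pi20 : 0 < pi / 2 :> R by rewrite divr_gt0.
have [ab|ab] := eqVneq (trough z) (crest z).
  have Gc t : orbit_gap (z, t) = - p2 (crest z) / 2 by rewrite /orbit_gap /gap /= ab eqxx.
  apply: (@half_mass_diverges_itv z (pi / 2) pi) => //.
    by rewrite ltr_pdivrMr// ltr_pMr// ltr1n.
  by move=> t _; rewrite Gc -(Gc t0).
have ltab : trough z < crest z by rewrite lt_neqAle ab trough_le_crest.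
have [[t1 t1in Gt1]|noneg] := pselect (exists2 t1, 0 <= t1 <= pi & orbit_gap (z, t1) < 0).
  have cG := @orbit_gap_slice _ _ _ _ _ _ hw bm0 bm1 z.
  have : \forall t \near t1, orbit_gap (z, t) < 0.
    exact: (near_lt (@cG t1)).
  move=> /nbhs_ballP[e /= e0 He].
  have /andP[t10 t1pi] := t1in.
  have [a [b [a0 abl bpi sub]]] : exists a b, [/\ 0 < a, a < b, b <= pi &
      forall t, a <= t <= b -> `|t1 - t| < e].
    pose f := Num.min (e / 2) (pi / 4).
    have f0 : 0 < f by rewrite lt_min !divr_gt0.
    have fe : f <= e / 2 by rewrite ge_min lexx.
    have fpi : f <= pi / 4 by rewrite ge_min lexx orbT.
    have [t1l|t1r] := leP t1 (pi / 2).
      exists (t1 + f / 2), (t1 + f); split; try lra.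
      move=> t /andP[? ?]; rewrite ltr_norml; apply/andP; split; lra.
    exists (t1 - f), (t1 - f / 2); split; try lra.
    move=> t /andP[? ?]; rewrite ltr_norml; apply/andP; split; lra.
  apply: (@half_mass_diverges_itv z a b) => // t tab.
  by apply/ltW/He; rewrite -ball_normE /=; exact: sub.
have G0 h : trough z <= h <= crest z -> 0 <= gap w p p2 (trough z) (crest z) h.
  move=> hin; have [t tin ht] := height_surj bm0 bm1 hin.
  rewrite leNgt; apply/negP => lt; apply: noneg; exists t => //.
  by rewrite /orbit_gap /= ht.
have hin : trough z <= height (z, t0) <= crest z by exact: (height_itv bm0 bm1 (z, t0)).
have a0 := trough_ge0 bm0 bm1 z.
have hE := contact_at_right a0 ltab hin G0 Gt0.
have Gb : gap w p p2 (trough z) (crest z) (crest z) = 0.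
  by apply/le_anti; rewrite G0 ?lexx ?(ltW ltab)// andbT -{2}hE.
have pb : p (crest z) = divdiff w p (trough z) (crest z).
  have := gap_right w p p2 ab; rewrite Gb mulr0 => /esym/eqP.
  by rewrite subr_eq0 => /eqP.
have [c _ Lc] : exists2 c, c \in `[crest z / 2, crest z] &
    forall t, t \in `[crest z / 2, crest z] -> `|p2 t| <= `|p2 c|.
  apply: (@EVT_max R (fun x => `|p2 x|)); first by rewrite ler_pdivrMr// ler_pMr// ler1n.
  apply: continuous_in_subspaceT => x; rewrite inE /= in_itv/= => /andP[x1 _].
  have x0 : 0 < x by apply: lt_le_trans x1; rewrite divr_gt0.
  by apply: cvg_norm; exact: (cc_cont2 hw x0).
pose K := `|p2 c| + 1.
have K0 : 0 < K by rewrite ltr_wpDl.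
apply: (@half_mass_diverges_log z C K K0) => t /andP[t1 t2].
set h := height (z, t).
have /andP[ah hb] : trough z <= h <= crest z by exact: (height_itv bm0 bm1 (z, t)).
have cost : cos t <= 0 by rewrite cos_le0_pihalf_pi// t1.
have h2 : crest z / 2 <= h.
  apply: le_trans (height_ge z t); rewrite ler_pM2l//.
  by rewrite ler_pdivlMr// mulVf// lerBrDr addrC -lerBrDr subrr.
have e1 : h - trough z = (crest z - trough z) * ((1 - cos t) / 2) by rewrite /h /height /=; field.
have e2 : crest z - h = (crest z - trough z) * ((1 + cos t) / 2) by rewrite /h /height /=; ring.
have ha : (crest z - trough z) / 2 <= h - trough z.
  by rewrite e1 ler_pM2l ?subr_gt0// ler_pdivlMr// mulVf// lerBrDr addrC -lerBrDr subrr.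
have cosK : 1 + cos t <= (pi - t) ^+ 2.
  have := @cos_quadratic (pi - t); rewrite -cosN opprB.
  have -> : cos (t - pi) = - cos t.
    by rewrite -[in RHS](subrK pi t) cosDpi opprK.
  rewrite opprK; apply; rewrite subr_ge0 t2/= gerBl.
  exact: le_trans (ltW pi20) t1.
have [hbE|hbne] := eqVneq h (crest z).
  by rewrite /orbit_gap /= -/h hbE Gb mulr_ge0 ?sqr_ge0// ltW.
have hb' : 0 < crest z - h by rewrite subr_gt0 lt_neqAle hbne hb.
have [c1 /andP[hc1 c1b] dE] := dd_mean hw hb.
have [c2 /andP[c12 c2b] pE] := @mean_value R p p2 c1 (crest z) c1b
  (fun x xin => cc_derive2 hw (lt_le_trans (lt_le_trans (divr_gt0 h0 (ltr0n _ 2)) h2)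
     (le_trans hc1 (andP xin).1))).
have pK : p (crest z) - divdiff w p h (crest z) <= K * (crest z - h).
  rewrite dE pE.
  apply: (@le_trans _ _ (K * (crest z - c1))); last by rewrite ler_pM2l// lerD2l lerN2.
  rewrite ler_wpM2r ?subr_ge0// (le_trans (ler_norm _))// /K.
  apply: (@le_trans _ _ `|p2 c|); last by rewrite lerDl.
  by apply: Lc; rewrite in_itv/= c2b (le_trans h2)// (le_trans hc1).
have chord := @gap_chord _ w p p2 (trough z) (crest z) h _; rewrite ah hb in chord.
have {}chord := chord isT.
have : (h - trough z) * orbit_gap (z, t) = p (crest z) - divdiff w p h (crest z).
  apply: (mulfI (lt0r_neq0 hb')).
  rewrite mulrA [_ * (h - _)]mulrC [X in X = _]chord -pb.
  have wE := divdiffE w p h (crest z).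
  have -> : (crest z - h) * (p (crest z) - divdiff w p h (crest z)) =
    p (crest z) * (crest z - h) - divdiff w p h (crest z) * (crest z - h) by ring.
  have wE' := divdiffE w p (trough z) (crest z).
  rewrite wE; rewrite -pb in wE'.
  have -> : w (crest z) = w (trough z) + p (crest z) * (crest z - trough z) by rewrite wE'; ring.
  by ring.
move=> GE.
have Gpos : 0 <= orbit_gap (z, t) by apply: G0; rewrite ah hb.
have : (crest z - trough z) / 2 * orbit_gap (z, t) <= (crest z - trough z) / 2 * (K * (pi - t) ^+ 2).
  apply: (@le_trans _ _ ((h - trough z) * orbit_gap (z, t))); first by rewrite ler_wpM2r.
  rewrite GE (le_trans pK)// e2.
  have -> : K * ((crest z - trough z) * ((1 + cos t) / 2)) = (crest z - trough z) / 2 * (K * (1 + cos t)) by field.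
  by rewrite ler_pM2l ?divr_gt0 ?subr_gt0// ler_pM2l.
by rewrite ler_pM2l ?divr_gt0 ?subr_gt0.
Qed.

End divergence.

(** * The mass on the sides of the parameter rectangle *)

Section sides.
Context {R : realType}.
Variables (w p p2 : R -> R) (k bm : R).
Hypotheses (hw : concave_convex w p p2 k) (bm0 : 0 < bm) (bm1 : bm <= 1).

Notation crest := (crest bm).
Notation trough := (trough bm).
Notation height := (height bm).
Notation orbit_gap := (orbit_gap w p p2 bm).
Notation half_mass := (half_mass w p p2 bm).

(** At a degenerate orbit the mass exceeds C for some cut-off, hence nearby for
    every smaller cut-off; at the others the gap is locally bounded below.
    Compactness of the rectangle gives one cut-off d that is inactive on all the
    orbits of mass at most C. *)
Lemma uniform_gap (C : R) : exists2 d, 0 < d &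
  forall z, rect 0 1 bm 1 z -> half_mass d z <= C -> forall t, d <= orbit_gap (z, t).
Proof.
have cK : compact (rect 0 1 bm 1 `*` `[0, pi]%classic : set ((R * R) * R)).
  by apply: compact_setX; [exact: rect_compact|exact: segment_compact].
have /compact_near_coveringP nc := cK.
have nd : \forall d \near 0^'+, (rect 0 1 bm 1 `*` `[0, pi]%classic : set ((R * R) * R)) `<=`
    (fun zt => half_mass d zt.1 <= C -> d <= orbit_gap zt).
  apply: nc => -[z t] [/= rz]; rewrite in_itv/= => tin.
  have [Gpos|Gneg] := ltP 0 (orbit_gap (z, t)).
    have G2 : 0 < orbit_gap (z, t) / 2 by rewrite divr_gt0.
    have n1 : \forall zt \near (z, t), orbit_gap (z, t) / 2 < orbit_gap zt.
      by apply: near_gt; [exact: (orbit_gap_cont hw bm0 bm1)|rewrite ltr_pdivrMr// ltr_pMr// ltr1n].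
    near=> zt d => _.
    have h1 : orbit_gap (z, t) / 2 < orbit_gap zt by near: zt.
    have h2 : d <= orbit_gap (z, t) / 2 by near: d; exact: nbhs_right_le.
    exact: le_trans h2 (ltW h1).
  have [d' d'0 Cd'] := half_mass_diverges hw bm0 bm1 C tin Gneg.
  have n1 : \forall zt \near (z, t), C < half_mass d' zt.1.
    have c1 : {for (z, t), continuous (fun zt : (R * R) * R => half_mass d' zt.1)}.
      apply: (@continuous_comp _ _ _ fst (half_mass d')); first exact: cvg_fst.
      exact: (half_mass_cont hw bm0 bm1 d'0).
    exact: (near_gt c1).
  near=> zt d.
  have h1 : C < half_mass d' zt.1 by near: zt.
  have h2 : d <= d' by near: d; exact: nbhs_right_le.
  have h3 : 0 < d by near: d; exact: nbhs_right_gt.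
  move=> le; exfalso.
  have := @half_mass_mono _ _ _ _ _ _ hw bm0 bm1 d' d zt.1 h3 h2.
  by move: le h1 => /=; lra.
have [d [Hd d0]] := @filter_ex _ _ (at_right_proper_filter (0 : R)) _
  (filterI nd (nbhs_right_gt (0 : R))).
exists d => // z rz le t.
have [t' t'in hE] := height_surj bm0 bm1 (height_itv bm0 bm1 (z, t)).
have := Hd (z, t') _ le; rewrite /orbit_gap /= hE; apply.
by split => //=; rewrite in_itv.
Unshelve. all: by end_near. Qed.

Lemma p2_1_ge0 : 0 <= p2 1.
Proof.
rewrite leNgt; apply/negP => lt.
have /nbhs_ballP[e /= e0 He] : \forall x \near (1 : R), p2 x < 0.
  exact: (near_lt (@cc_cont2 _ _ _ _ _ hw 1 ltr01)).
have h1 : 1 <= 1 + e / 2 by rewrite lerDl divr_ge0// ltW.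
have [c /andP[c1 c2] pE] := @mean_value R p p2 1 (1 + e / 2) h1
  (fun x xin => cc_derive2 hw (lt_le_trans ltr01 (andP xin).1)).
have /andP[_ k1] := cc_k hw.
have h2 : 1 < 1 + e / 2 by rewrite ltrDl divr_gt0.
have := cc_incr hw (ltW k1) h2; rewrite -subr_gt0 pE.
have p2c : p2 c < 0.
  by apply: He; rewrite -ball_normE /= ltr_norml; apply/andP; split; lra.
have -> : 1 + e / 2 - 1 = e / 2 by ring.
by rewrite ltNge mulr_le0_ge0// ?divr_ge0// ltW.
Qed.

(** w is nonnegative on [0, 1] and vanishes at 1 with its derivative, so the chord
    from the trough to 1 has a nonpositive slope, which has the sign of the gap at
    1. When the trough is 1 too, convexity beyond k concludes. *)
Lemma orbit_gap_at1 z : crest z = 1 -> orbit_gap (z, pi) <= 0.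
Proof.
move=> h1; rewrite /orbit_gap heightpi /= h1.
have [ab|ab] := eqVneq (trough z) 1.
  by rewrite /gap ab eqxx mulNr oppr_le0 divr_ge0// p2_1_ge0.
have a1 : 0 < 1 - trough z.
  by rewrite subr_gt0 lt_neqAle ab -h1 trough_le_crest.
have e1 := gap_right w p p2 ab.
have e2 := divdiffE w p (trough z) 1.
rewrite -(pmulr_rle0 _ a1) e1 (cc_p1 hw) subr0.
rewrite -(pmulr_lle0 _ a1) e2 (cc_w1 hw) sub0r oppr_le0 (cc_ge0 hw)//.
by rewrite trough_ge0//= -subr_ge0 ltW.
Qed.

Lemma half_mass_mean d z : 0 < d -> exists c, half_mass d z = mass_density w p p2 bm d (z, c) * pi.
Proof.
move=> d0; have cf := mass_density_slice hw bm0 bm1 (z := z) d0.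
have [c _] := @mean_value R (prim (fun t => mass_density w p p2 bm d (z, t)))
  _ 0 pi (pi_ge0 R) (fun t _ => is_derive_prim t cf).
by rewrite prim0 !subr0 => e; exists c.
Qed.

(** height * slowness is at most sqrt (6 / Q) by gap_lower. *)
Lemma half_mass_small d z Q : 0 < d -> 0 < Q ->
  (forall x, 0 < x <= bm -> p2 x <= - (Q * x ^+ 2)) -> crest z = bm ->
  half_mass d z <= pi * Num.sqrt (6 / Q).
Proof.
move=> d0 Q0 HQ hz; have [c ->] := half_mass_mean z d0.
rewrite mulrC ler_pM2l ?pi_gt0//.
have hin := height_itv bm0 bm1 (z, c).
have l0 := trough_ge0 bm0 bm1 z.
have h0 : 0 <= height (z, c) by apply: le_trans l0 _; case/andP: hin.
have Gl : Q / 12 * height (z, c) ^+ 2 <= orbit_gap (z, c).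
  apply: (gap_lower hw l0 hin (crest_gt0 bm0 bm1 z) (ltW Q0)) => x; rewrite hz; exact: HQ.
rewrite /mass_density /slowness.
have m0 := max_gap_gt0 w p p2 bm (z, c) d0.
rewrite ler_pdivrMr ?sqrtr_gt0// -sqrtrM ?divr_ge0 ?(ltW Q0)//.
rewrite -[leLHS]ger0_norm// -sqrtr_sqr ler_wsqrtr//.
have Gm : orbit_gap (z, c) <= Num.max (orbit_gap (z, c)) d by rewrite le_max lexx.
have -> : height (z, c) ^+ 2 = 6 / Q * (2 * (Q / 12 * height (z, c) ^+ 2)).
  by field; rewrite gt_eqF.
by rewrite ler_pM2l ?divr_gt0// ler_pM2l// (le_trans Gl).
Qed.

(** Constant orbits are the limits of small harmonic oscillations, of frequency
    sqrt (- p2). *)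
Lemma half_mass_diag d z : 0 < d -> trough z = crest z ->
  (forall t, d <= orbit_gap (z, t)) ->
  0 < - p2 (crest z) /\ half_mass d z = crest z / Num.sqrt (- p2 (crest z)) * pi.
Proof.
move=> d0 ab Gd; have GE t : orbit_gap (z, t) = - p2 (crest z) / 2 by rewrite /orbit_gap /gap /= ab eqxx.
have p20 : 0 < - p2 (crest z).
  by have := lt_le_trans d0 (Gd 0); rewrite GE pmulr_lgt0.
split => //; have [c ->] := half_mass_mean z d0; congr (_ * _).
rewrite /mass_density /slowness max_l// GE mulrC [_ / 2]mulrC mulVKf//.
by rewrite mulrC; congr (_ / _); rewrite /height /= ab subrr mul0r subr0.
Qed.

End sides.

(** * The phase along an orbit *)

Section even_periodic.
Context {R : realType}.

(** The primitive is odd and increases by twice its value at pi over each period. *)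
Lemma prim_half_periods (f : R -> R) n : continuous f -> (forall t, f (- t) = f t) ->
  (forall t, f (t + pi *+ 2) = f t) -> prim f (n%:R * pi) = n%:R * prim f pi.
Proof.
move=> cf fN fp.
have dF (t : R) : is_derive t 1 (prim f) (f t) by exact: is_derive_prim.
pose D t := prim f (t + pi *+ 2) - prim f t.
have dD (t : R) : is_derive t 1 D 0.
  have d1 : is_derive t 1 (fun t : R => t + pi *+ 2) 1.
    have h := is_deriveD (is_derive_id t 1) (is_derive_cst (pi *+ 2 : R) t 1).
    by apply: (is_derive_eq h); rewrite addr0.
  have d2 := @is_derive1_comp _ (prim f) (fun t => t + pi *+ 2) t _ _ (dF _) d1.
  have d3 := is_deriveB d2 (dF t).
  by apply: (is_derive_eq d3); rewrite fp mulr1 subrr.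
pose E t := prim f t + prim f (- t).
have dE (t : R) : is_derive t 1 E 0.
  have d2 := @is_derive1_comp _ (prim f) (fun t => - t) t _ _ (dF _) (is_deriveNid t 1).
  have d3 := is_deriveD (dF t) d2.
  by apply: (is_derive_eq d3); rewrite fN mulrN1 subrr.
have E0 t : prim f (- t) = - prim f t.
  have := is_derive_0_is_cst t 0 dE; rewrite /E oppr0 prim0 addr0.
  by move/eqP; rewrite addrC addr_eq0 => /eqP.
have Dpi t : prim f (t + pi *+ 2) = prim f t + 2 * prim f pi.
  have := is_derive_0_is_cst t (- pi) dD; rewrite /D E0.
  have -> : - pi + pi *+ 2 = pi :> R by ring.
  by move=> h; rewrite -[LHS](subrK (prim f t)) h; ring.
have [m] := ubnP n; elim: m n => // m IH [|[|n]] nm.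
- by rewrite !mul0r prim0.
- by rewrite !mul1r.
- have -> : n.+2%:R * pi = n%:R * pi + pi *+ 2 :> R by rewrite -addn2 natrD; ring.
  rewrite Dpi IH; last by move: nm; rewrite ltnS => /ltnW.
  by rewrite -addn2 natrD; ring.
Qed.

End even_periodic.

Section phase.
Context {R : realType}.
Variables (w p p2 : R -> R) (k bm d : R).
Hypotheses (hw : concave_convex w p p2 k) (bm0 : 0 < bm) (bm1 : bm <= 1) (d0 : 0 < d).

Notation crest := (crest bm).
Notation trough := (trough bm).
Notation height := (height bm).
Notation orbit_gap := (orbit_gap w p p2 bm).
Notation slowness := (slowness w p p2 bm d).
Notation half_mass := (half_mass w p p2 bm d).
Notation half_time := (half_time w p p2 bm d).
Notation mass_density := (mass_density w p p2 bm d).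

Definition elapsed (zt : (R * R) * R) : R := prim (fun t => slowness (zt.1, t)) zt.2.

Let sc z : continuous (fun t => slowness (z, t)).
Proof. exact: (slowness_slice hw bm0 bm1 (z := z) d0). Qed.

Lemma elapsed_cont : continuous elapsed.
Proof. exact: (continuous_prim_param (slowness_cont hw bm0 bm1 d0)). Qed.

Lemma elapsed_derive z (t : R) : is_derive t 1 (fun t => elapsed (z, t)) (slowness (z, t)).
Proof. exact: (is_derive_prim t (@sc z)). Qed.

Lemma slowness_bounded_below z : exists2 e, 0 < e & forall t, e <= slowness (z, t).
Proof.
have [c _ Lc] := @EVT_max R (fun t => orbit_gap (z, t)) 0 pi (pi_ge0 R)
  (continuous_subspaceT (@orbit_gap_slice _ _ _ _ _ _ hw bm0 bm1 z)).
exists (slowness (z, c)); first exact: slowness_gt0.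
move=> t.
have [t' t'in hE] := height_surj bm0 bm1 (height_itv bm0 bm1 (z, t)).
have -> : slowness (z, t) = slowness (z, t') by rewrite /slowness /orbit_gap /= hE.
rewrite lef_pV2 ?posrE ?sqrtr_gt0 ?max_gap_gt0//.
rewrite ler_wsqrtr// ler_pM2l// ge_max !le_max lexx orbT andbT.
by rewrite Lc ?in_itv.
Qed.

Lemma elapsed_lt z x y : x < y -> elapsed (z, x) < elapsed (z, y).
Proof.
move=> xy; have [c _] := mean_value (ltW xy) (fun t _ => elapsed_derive z t).
rewrite -subr_gt0 => ->; rewrite mulr_gt0 ?subr_gt0//; exact: slowness_gt0.
Qed.

Lemma elapsed_inj z : injective (fun t => elapsed (z, t)).
Proof.
move=> x y /= e; have [xy|xy|//] := ltrgtP x y.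
  by have := elapsed_lt z xy; rewrite e ltxx.
by have := elapsed_lt z xy; rewrite e ltxx.
Qed.

Lemma elapsed_slice z : continuous (fun t => elapsed (z, t)).
Proof. by move=> t; exact: is_derive_continuous (elapsed_derive z t). Qed.

Lemma elapsed0 z : elapsed (z, 0) = 0.
Proof. exact: prim0. Qed.

Lemma elapsed_surj z x : exists t, elapsed (z, t) = x.
Proof.
have [e e0 He] := slowness_bounded_below z.
pose q := `|x| / e.
have q0 : 0 <= q by rewrite divr_ge0// ltW.
have up : `|x| <= elapsed (z, q).
  have [c _] := mean_value q0 (fun t _ => elapsed_derive z t).
  rewrite elapsed0 !subr0 => ->.
  have -> : `|x| = e * q by rewrite /q mulrC divfK// gt_eqF.
  by rewrite ler_wpM2r.
have dn : elapsed (z, - q) <= - `|x|.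
  have nq0 : - q <= 0 by rewrite oppr_le0.
  have [c _] := mean_value nq0 (fun t _ => elapsed_derive z t).
  rewrite elapsed0 !sub0r opprK => e1; rewrite -lerN2 opprK e1.
  have -> : `|x| = e * q by rewrite /q mulrC divfK// gt_eqF.
  by rewrite ler_wpM2r.
have qq : - q <= q by lra.
have [|t _ tE] := @IVT R (fun t => elapsed (z, t)) (- q) q x qq
  (continuous_subspaceT (@elapsed_slice z)).
  rewrite ge_min le_max; apply/andP; split; apply/orP.
    by left; apply: le_trans dn _; rewrite lerNl -normrN ler_norm.
  by right; apply: le_trans up; rewrite ler_norm.
by exists t.
Qed.

Definition phase (zx : (R * R) * R) : R := sval (cid (elapsed_surj zx.1 zx.2)).

Lemma phaseK z x : elapsed (z, phase (z, x)) = x.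
Proof. by rewrite /phase; case: cid. Qed.

Lemma elapsedK z : cancel (fun t => elapsed (z, t)) (fun x => phase (z, x)).
Proof. by move=> t; apply: (@elapsed_inj z); rewrite phaseK. Qed.

(** As elapsed is increasing in the phase and jointly continuous, the inequalities
    elapsed (z, t0 - e) < x < elapsed (z, t0 + e) persist near (z0, x0). *)
Lemma phase_cont : continuous phase.
Proof.
move=> [z0 x0]; apply/cvgrPdist_lt => e e0.
set t0 := phase (z0, x0).
have lo0 : elapsed (z0, t0 - e) < x0.
  by rewrite -[ltRHS](phaseK z0) elapsed_lt// gtrBl.
have hi0 : x0 < elapsed (z0, t0 + e).
  by rewrite -[ltLHS](phaseK z0) elapsed_lt// ltrDl.
have cdiff t : {for (z0, x0), continuous (fun zx : (R * R) * R => zx.2 - elapsed (zx.1, t))}.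
  apply: continuousB; first exact: cvg_snd.
  apply: (@continuous_comp _ _ _ (fun zx : (R * R) * R => (zx.1, t)) elapsed); last exact: elapsed_cont.
  by apply: continuous_pair; [exact: cvg_fst|exact: cst_continuous].
have n1 : \forall zx \near (z0, x0), elapsed (zx.1, t0 - e) < zx.2.
  have := near_gt (c := 0) (cdiff (t0 - e)); rewrite subr_gt0 => /(_ lo0).
  by apply: filterS => zx; rewrite subr_gt0.
have n2 : \forall zx \near (z0, x0), zx.2 < elapsed (zx.1, t0 + e).
  have := near_lt (c := 0) (cdiff (t0 + e)); rewrite subr_lt0 => /(_ hi0).
  by apply: filterS => zx; rewrite subr_lt0.
apply: filterS2 n1 n2 => -[z x] /= h1 h2.
have a1 : t0 - e < phase (z, x).
  rewrite ltNge; apply/negP; rewrite le_eqVlt => /predU1P[h|h].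
    by move: h1; rewrite -h phaseK ltxx.
  by have := lt_trans (elapsed_lt z h) h1; rewrite phaseK ltxx.
have a2 : phase (z, x) < t0 + e.
  rewrite ltNge; apply/negP; rewrite le_eqVlt => /predU1P[h|h].
    by move: h2; rewrite h phaseK ltxx.
  by have := lt_trans h2 (elapsed_lt z h); rewrite phaseK ltxx.
rewrite ltr_norml; apply/andP; split; lra.
Qed.

Lemma phase_derive z (x : R) :
  is_derive x 1 (fun x => phase (z, x)) (Num.sqrt (2 * Num.max (orbit_gap (z, phase (z, x))) d)).
Proof.
have sp := slowness_gt0 w p p2 bm (z, phase (z, x)) d0.
have := @is_derive_inverse R (fun t => elapsed (z, t)) (fun x => phase (z, x))
  (slowness (z, phase (z, x))) (phase (z, x)).
rewrite /= phaseK /slowness invrK; apply.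
- by exists 1 => //= t _; exact: elapsedK.
- by exists 1 => //= t _; exact: elapsed_slice.
- exact: elapsed_derive.
- by rewrite gt_eqF.
Qed.

Lemma phase0 z : phase (z, 0) = 0.
Proof. by apply: (@elapsed_inj z); rewrite phaseK elapsed0. Qed.

Lemma height_even z t : height (z, - t) = height (z, t).
Proof. by rewrite /height /= cosN. Qed.

Lemma height_periodic z t : height (z, t + pi *+ 2) = height (z, t).
Proof. by rewrite /height /= cosD2pi. Qed.

Lemma elapsed_half_periods z n : elapsed (z, n%:R * pi) = n%:R * half_time z.
Proof.
apply: prim_half_periods; first exact: sc.
- by move=> t; rewrite /slowness /orbit_gap /= height_even.
- by move=> t; rewrite /slowness /orbit_gap /= height_periodic.
Qed.

Lemma mass_half_periods z n :
  prim (fun t => mass_density (z, t)) (n%:R * pi) = n%:R * half_mass z.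
Proof.
apply: prim_half_periods; first exact: (mass_density_slice hw bm0 bm1 (z := z) d0).
- by move=> t; rewrite /mass_density /slowness /orbit_gap /= height_even.
- by move=> t; rewrite /mass_density /slowness /orbit_gap /= height_periodic.
Qed.

Lemma half_time_gt0 z : 0 < half_time z.
Proof. by rewrite -[ltLHS](elapsed0 z); apply: elapsed_lt; exact: pi_gt0. Qed.

Lemma half_mass_gt0 z : 0 < half_mass z.
Proof.
have [e e0 He] := slowness_bounded_below z.
have h0 := crest_gt0 bm0 bm1 z; have pi0 := pi_gt0 R.
have cf := mass_density_slice hw bm0 bm1 (z := z) d0.
have f0 t : 0 <= mass_density (z, t) by exact: mass_density_ge0.
have pi20 : 0 <= pi / 2 :> R by rewrite divr_ge0// ltW.
have pi2pi : pi / 2 <= pi :> R by lra.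
apply: lt_le_trans (@prim_ge_sub _ _ (pi / 2) pi cf pi20 pi2pi (lexx _) (fun t _ => f0 t)).
have [c /andP[c1 c2] ->] := @mean_value R (prim (fun t => mass_density (z, t)))
  _ (pi / 2) pi pi2pi (fun t _ => is_derive_prim t cf).
apply: mulr_gt0; last by lra.
apply: mulr_gt0; last exact: slowness_gt0.
apply: lt_le_trans (height_ge bm0 bm1 z c); rewrite mulr_gt0// divr_gt0// subr_gt0.
apply: (@le_lt_trans _ _ 0); last exact: ltr01.
by rewrite cos_le0_pihalf_pi// c1.
Qed.

End phase.

(** * The displacement of an orbit *)

Section displacements.
Context {R : realType}.
Local Notation mu := (@lebesgue_measure R).
Local Notation I01 := (`[0%R, 1%R]%classic : set (measurableTypeR R)).
Variables (w p p2 : R -> R) (k bm d : R) (n : nat).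
Hypotheses (hw : concave_convex w p p2 k) (bm0 : 0 < bm) (bm1 : bm <= 1) (d0 : 0 < d).
Hypothesis n0 : (0 < n)%N.

Notation crest := (crest bm).
Notation trough := (trough bm).
Notation height := (height bm).
Notation orbit_gap := (orbit_gap w p p2 bm).
Notation slowness := (slowness w p p2 bm d).
Notation half_mass := (half_mass w p p2 bm d).
Notation half_time := (half_time w p p2 bm d).
Notation mass_density := (mass_density w p p2 bm d).
Notation phase := (phase hw bm0 bm1 d0).

(** the load at which the mean of the height over a period is 1 / load *)
Definition load z : R := half_time z / half_mass z.

(** the time of the n half periods that are fitted into [0, 1] *)
Definition duration z : R := n%:R * half_time z.
Definition angle (zs : (R * R) * R) : R := phase (zs.1, duration zs.1 * zs.2).
Definition profile (zs : (R * R) * R) : R := height (zs.1, angle zs).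
Definition momentum (zs : (R * R) * R) : R :=
  (crest zs.1 - trough zs.1) / 2 * sin (angle zs) *
  Num.sqrt (2 * Num.max (orbit_gap (zs.1, angle zs)) d).
Definition slope (zs : (R * R) * R) : R := load zs.1 * duration zs.1 * momentum zs.
Definition displacement z (s : R) : R :=
  if 0 <= s <= 1 then load z * profile (z, s) - 1 else 0.

Let nR : 0 < n%:R :> R. Proof. by rewrite ltr0n. Qed.

Let T0 z : 0 < half_time z. Proof. exact: (half_time_gt0 hw bm0 bm1 d0). Qed.
Let M0 z : 0 < half_mass z. Proof. exact: (half_mass_gt0 hw bm0 bm1 d0). Qed.

Lemma load_gt0 z : 0 < load z. Proof. by rewrite divr_gt0. Qed.

Lemma load_cont : continuous load.
Proof.
move=> z; apply: (@continuousM _ _ half_time (fun z => (half_mass z)^-1)).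
  exact: (half_time_cont hw bm0 bm1 d0).
apply: (@continuousV _ _ half_mass); first by rewrite gt_eqF.
exact: (half_mass_cont hw bm0 bm1 d0).
Qed.

Lemma duration_cont : continuous duration.
Proof.
move=> z; apply: (@continuousM _ _ (cst n%:R) half_time); first exact: cst_continuous.
exact: (half_time_cont hw bm0 bm1 d0).
Qed.

Lemma angle_cont : continuous angle.
Proof.
move=> zs; apply: (@continuous_comp _ _ _ (fun zs : (R * R) * R => (zs.1, duration zs.1 * zs.2)) phase);
  last exact: phase_cont.
apply: continuous_pair; first exact: cvg_fst.
apply: (@continuousM _ _ (fun zs : (R * R) * R => duration zs.1) snd); last exact: cvg_snd.
exact: (continuous_comp_fst duration_cont).
Qed.

Let zangle_cont : continuous (fun zs : (R * R) * R => (zs.1, angle zs)).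
Proof. by move=> zs; apply: continuous_pair; [exact: cvg_fst|exact: angle_cont]. Qed.

Lemma profile_cont : continuous profile.
Proof.
move=> zs; apply: (@continuous_comp _ _ _ _ height); first exact: zangle_cont.
exact: height_cont.
Qed.

Let root_cont : continuous (fun zs => Num.sqrt (2 * Num.max (orbit_gap (zs.1, angle zs)) d)).
Proof.
have e zs : Num.sqrt (2 * Num.max (orbit_gap (zs.1, angle zs)) d) = (slowness (zs.1, angle zs))^-1.
  by rewrite invrK.
rewrite (funext e) => zs; apply: (@continuousV _ _ (fun zs => slowness (zs.1, angle zs))).
  by rewrite gt_eqF// slowness_gt0.
apply: (@continuous_comp _ _ _ _ slowness); first exact: zangle_cont.
exact: (slowness_cont hw bm0 bm1 d0).
Qed.

Lemma momentum_cont : continuous momentum.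
Proof.
move=> zs; apply: (@continuousM _ _ (fun zs => (crest zs.1 - trough zs.1) / 2 * sin (angle zs))
  (fun zs => Num.sqrt (2 * Num.max (orbit_gap (zs.1, angle zs)) d))); last exact: root_cont.
apply: (@continuousM _ _ (fun zs => (crest zs.1 - trough zs.1) / 2) (fun zs => sin (angle zs))).
  apply: continuousM; last exact: cst_continuous.
  apply: continuousB; first exact: (continuous_comp_fst (@crest_cont _ _)).
  exact: (continuous_comp_fst (@trough_cont _ _)).
apply: (@continuous_comp _ _ _ angle (@sin R)); first exact: angle_cont.
exact: continuous_sin.
Qed.

Lemma slope_cont : continuous slope.
Proof.
move=> zs; apply: (@continuousM _ _ (fun zs => load zs.1 * duration zs.1) momentum).
  apply: continuousM; first exact: (continuous_comp_fst load_cont).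
  exact: (continuous_comp_fst duration_cont).
exact: momentum_cont.
Qed.

Lemma angle_derive z (s : R) : is_derive s 1 (fun s => angle (z, s))
  (duration z * Num.sqrt (2 * Num.max (orbit_gap (z, angle (z, s))) d)).
Proof.
have d1 : is_derive s 1 (fun s : R => duration z * s) (duration z).
  have h := is_deriveZ (duration z) (is_derive_id s 1).
  by apply: (is_derive_eq h); rewrite /GRing.scale /= mulr1.
have d2 := @is_derive1_comp _ (fun x => phase (z, x)) (fun s => duration z * s) s _ _
  (phase_derive hw bm0 bm1 d0 z _) d1.
by apply: (is_derive_eq d2); rewrite mulrC.
Qed.

Lemma height_derive z (t : R) :
  is_derive t 1 (fun t => height (z, t)) ((crest z - trough z) / 2 * sin t).
Proof.
have h := is_deriveD (is_derive_cst ((crest z + trough z) / 2) t 1)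
  (is_deriveZ (- ((crest z - trough z) / 2)) (is_derive_cos t)).
have e : (fun t => height (z, t)) = cst ((crest z + trough z) / 2) + - ((crest z - trough z) / 2) *: (@cos R).
  apply/funext => u; rewrite /height /=.
  rewrite -[RHS]/((crest z + trough z) / 2 + (- ((crest z - trough z) / 2)) * cos u).
  by field.
by rewrite e; apply: (is_derive_eq h); rewrite add0r /GRing.scale /= mulrNN.
Qed.

Lemma profile_derive z (s : R) :
  is_derive s 1 (fun s => profile (z, s)) (duration z * momentum (z, s)).
Proof.
have d2 := @is_derive1_comp _ (fun t => height (z, t)) (fun s => angle (z, s)) s _ _
  (height_derive z _) (angle_derive z s).
by apply: (is_derive_eq d2); rewrite /momentum /=; ring.
Qed.

Lemma angle0 z : angle (z, 0) = 0.
Proof. by rewrite /angle /= mulr0 phase0. Qed.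

Lemma angle1 z : angle (z, 1) = n%:R * pi.
Proof.
rewrite /angle /= mulr1 /duration -(elapsed_half_periods hw bm0 bm1 d0).
exact: (elapsedK hw bm0 bm1 d0 z (n%:R * pi)).
Qed.

Lemma angle_half z : angle (z, n%:R^-1) = pi.
Proof.
rewrite /angle /= /duration mulrAC divff ?gt_eqF// mul1r.
exact: (elapsedK hw bm0 bm1 d0 z pi).
Qed.

Let extended_derive z (s : R) :
  is_derive s 1 (fun s => load z * profile (z, s) - 1) (slope (z, s)).
Proof.
have h := is_deriveB (is_deriveZ (load z) (profile_derive z s)) (is_derive_cst (1 : R) s 1).
by apply: (is_derive_eq h); rewrite subr0 /GRing.scale /= /slope /= mulrA.
Qed.

Let displacementI z s : I01 s -> displacement z s = load z * profile (z, s) - 1.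
Proof. by rewrite /= in_itv/= /displacement => ->. Qed.

Lemma displacement_H1 z : H1_derivative (displacement z) (fun s => slope (z, s)).
Proof.
apply: continuous_H1_derivative; first exact: (continuous_slice2 slope_cont).
move=> s sI; have I0 : I01 0 by rewrite /= in_itv/= lexx ler01.
rewrite !displacementI//; have s0 : 0 <= s by move: sI; rewrite /= in_itv/= => /andP[].
rewrite (Rintegral_FTC s0 (continuous_slice2 (x := z) slope_cont) (extended_derive z)).
by ring.
Qed.

Lemma displacement_zero_mean z : \int[mu]_(s in I01) displacement z s = 0.
Proof.
rewrite (@eq_Rintegral _ _ _ mu _ (fun s => load z * profile (z, s) - 1)); last first.
  by move=> s; rewrite inE => /displacementI ->.
pose F s := load z / duration z * prim (fun t => mass_density (z, t)) (angle (z, s)) - s.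
have P0 : 0 < duration z by rewrite mulr_gt0.
have dF (s : R) : is_derive s 1 F (load z * profile (z, s) - 1).
  have d1 := @is_derive1_comp _ (prim (fun t => mass_density (z, t)))
    (fun s => angle (z, s)) s _ _
    (is_derive_prim _ (mass_density_slice hw bm0 bm1 (z := z) d0)) (angle_derive z s).
  have d2 := is_deriveB (is_deriveZ (load z / duration z) d1) (is_derive_id s 1).
  apply: (is_derive_eq d2); congr (_ - _); rewrite /GRing.scale /=.
  rewrite /mass_density /slowness /profile /=.
  have m0 : 0 < Num.sqrt (2 * Num.max (orbit_gap (z, angle (z, s))) d).
    by rewrite sqrtr_gt0 max_gap_gt0.
  by field; rewrite !gt_eqF.
have cc : continuous (fun s => load z * profile (z, s) - 1).
  by move=> s; exact: is_derive_continuous (extended_derive z s).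
rewrite (Rintegral_FTC ler01 cc dF) /F angle0 angle1 prim0 mulr0 subr0.
rewrite (mass_half_periods hw bm0 bm1 d0) /load /duration.
have := T0 z; have := M0 z; have := nR => ? ? ?.
by field; rewrite !gt_eqF.
Qed.

Lemma displacement_mem z : displacement z \in zero_mean_H1_pred.
Proof.
rewrite inE; split.
- by exists (fun s => slope (z, s)); exact: displacement_H1.
- exact: displacement_zero_mean.
- by move=> s; rewrite /= in_itv/= /displacement => /negP/negbTE ->.
Qed.

Definition displacementH z : H1m R := MkH1m (displacement_mem z).

(** The derivatives converge uniformly on [0, 1]. *)
Lemma displacementH_cont : continuous displacementH.
Proof.
move=> z0; apply/cvgrPdist_le => e e0.
have := near_uniform_itv z0 0 1 slope_cont e0; apply: filterS => z Hz.
have dd : H1_derivative (displacementH z0 - displacementH z)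
    ((fun s => slope (z0, s)) + (-1) *: (fun s => slope (z, s))).
  rewrite -scaleN1r; apply: H1_derivativeD; first exact: displacement_H1.
  by apply: H1_derivativeZ; exact: displacement_H1.
rewrite -[`|_|]/(H1m_norm _) /H1m_norm (H1m_dotE dd dd).
have e2 : e = Num.sqrt (e ^+ 2) by rewrite sqrtr_sqr gtr0_norm.
rewrite [leRHS]e2 ler_wsqrtr//.
pose g s := (slope (z0, s) - slope (z, s)) ^+ 2.
have cg : continuous g.
  move=> s; apply: (@continuous_comp _ _ _ (fun s => slope (z0, s) - slope (z, s)) (fun y => y ^+ 2)).
    by apply: continuousB; exact: (continuous_slice2 slope_cont).
  exact: exprn_continuous.
rewrite (@eq_Rintegral _ _ _ mu _ g); last first.
  move=> s _; rewrite /g expr2 -[_ s]/(slope (z0, s) + -1 * slope (z, s)).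
  by rewrite mulN1r.
rewrite (Rintegral_prim ler01 cg).
have [c cin ->] := @mean_value R (prim g) g 0 1 ler01 (fun s _ => is_derive_prim s cg).
rewrite subr0 mulr1 /g -real_normK ?num_real// ler_pXn2r ?nnegrE ?(ltW e0)//.
by apply/ltW/Hz; rewrite /= in_itv.
Qed.

(** The equation of motion. Away from the turning points it is obtained by
    differentiating the energy integral. At a turning point the square root of the
    gap may fail to be differentiable, namely at height 0, but it is multiplied by
    a factor that vanishes there, so its continuity is enough. *)
Lemma momentum_derive z (s : R) : (forall t, d <= orbit_gap (z, t)) ->
  is_derive s 1 (fun s => momentum (z, s))
    (duration z * (p (profile (z, s)) - divdiff w p (trough z) (crest z))).
Proof.
move=> Gd; set m := divdiff w p _ _; set A := (crest z - trough z) / 2.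
pose f s := A * sin (angle (z, s)).
pose g s := Num.sqrt (2 * Num.max (orbit_gap (z, angle (z, s))) d).
have GE t : Num.max (orbit_gap (z, t)) d = orbit_gap (z, t) by rewrite max_l.
have G0 t : 0 < orbit_gap (z, t) by exact: lt_le_trans (Gd t).
have g2 s' : g s' ^+ 2 = 2 * orbit_gap (z, angle (z, s')).
  by rewrite /g GE sqr_sqrtr// mulr_ge0// ltW.
have cg : {for s, continuous g} by exact: (continuous_slice2 (x := z) root_cont).
have df (s' : R) : is_derive s' 1 f (A * (cos (angle (z, s')) * (duration z * g s'))).
  have h := is_deriveZ A (@is_derive1_comp _ (@sin R) (fun s => angle (z, s)) s' _ _
    (is_derive_sin _) (angle_derive z s')).
  exact: (is_derive_eq h).
have [ab|ab] := eqVneq (trough z) (crest z).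
  have A0 : A = 0 by rewrite /A ab subrr mul0r.
  have -> : (fun s => momentum (z, s)) = cst 0.
    by apply/funext => s'; rewrite /momentum /= -/A A0 !mul0r.
  have -> : p (profile (z, s)) - m = 0.
    by rewrite /m ab divdiffxx /profile /height /= ab subrr mul0r subr0 subrr.
  by rewrite mulr0; exact: is_derive_cst.
have [s0|s0] := eqVneq (sin (angle (z, s))) 0.
  have f0 : f s = 0 by rewrite /f s0 mulr0.
  have h := is_derive_mul_vanish (df s) f0 cg.
  apply: (is_derive_eq h).
  have -> : A * (cos (angle (z, s)) * (duration z * g s)) * g s =
    duration z * (A * cos (angle (z, s)) * g s ^+ 2) by ring.
  congr (_ * _); rewrite g2.
  have := sin0cos1 s0.
  have [c0|c0] := leP 0 (cos (angle (z, s))).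
    rewrite ger0_norm// => c1; rewrite c1 mulr1.
    have hE : profile (z, s) = trough z by rewrite /profile /height /= c1; field.
    by rewrite hE -(gap_left w p p2 ab) /orbit_gap /= -/(profile (z, s)) hE /A; field.
  rewrite ltr0_norm// => /(congr1 -%R); rewrite opprK => c1; rewrite c1.
  have hE : profile (z, s) = crest z by rewrite /profile /height /= c1; field.
  by rewrite hE -[RHS]opprB -(gap_right w p p2 ab) /orbit_gap /= -/(profile (z, s)) hE /A; field.
pose q s := momentum (z, s).
have q0 : q s != 0.
  apply: mulf_neq0; last by rewrite gt_eqF// sqrtr_gt0 max_gap_gt0.
  apply: mulf_neq0 => //; apply: mulf_neq0; first by rewrite subr_eq0 eq_sym.
  by rewrite invr_eq0 pnatr_eq0.
pose phi h := w h - w (trough z) - m * (h - trough z).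
have q2 s' : q s' ^+ 2 = 2 * phi (profile (z, s')).
  have := gap_chord w p p2 (height_itv bm0 bm1 (z, angle (z, s'))) => /= chord.
  rewrite /phi -chord -/(orbit_gap (z, angle (z, s'))) /q /momentum /= -/(g s') exprMn g2.
  by rewrite exprMn sin2cos2 /height /=; field.
pose Q s' := 2 * phi (profile (z, s')) - 2 * phi (profile (z, s)).
have dQ : is_derive s 1 Q (2 * ((p (profile (z, s)) - m) * (duration z * q s))).
  have dphi (x : R) : is_derive x 1 phi (p x - m).
    have h := is_deriveB (is_deriveB (cc_derive hw x) (is_derive_cst (w (trough z)) x 1))
      (is_deriveZ m (is_deriveB (is_derive_id x 1) (is_derive_cst (trough z) x 1))).
    by apply: (is_derive_eq h); rewrite /GRing.scale /= !subr0 mulr1.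
  have h := is_deriveB (is_deriveZ 2 (@is_derive1_comp _ phi (fun s => profile (z, s)) s _ _
    (dphi _) (profile_derive z s))) (is_derive_cst (2 * phi (profile (z, s)) : R) s 1).
  by apply: (is_derive_eq h); rewrite subr0.
have Q0 : Q s = 0 by rewrite /Q subrr.
have cq : {for s, continuous q} by exact: (continuous_slice2 (x := z) momentum_cont).
have cV : {for s, continuous (fun s' => (q s' + q s)^-1)}.
  apply: (@continuousV _ _ (fun s' => q s' + q s)).
    by rewrite -mulr2n mulrn_eq0.
  by apply: continuousD => //; exact: cst_continuous.
have h := is_derive_mul_vanish dQ Q0 cV.
have h2 := is_deriveD h (is_derive_cst (q s) s 1).
have e : 2 * ((p (profile (z, s)) - m) * (duration z * q s)) * (q s + q s)^-1 + 0 =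
    duration z * (p (profile (z, s)) - m).
  move: (q s) q0 => y y0; have yy : y + y != 0 by rewrite -mulr2n mulrn_eq0.
  by field; rewrite ?yy ?y0.
rewrite -e; apply: near_eq_is_derive h2.
have : \forall s' \near s, q s' + q s != 0.
  have c2 : {for s, continuous (fun s' => q s' + q s)}.
    by apply: continuousD => //; exact: cst_continuous.
  by apply: (cvgr_neq0 _ c2); rewrite -mulr2n mulrn_eq0.
apply: filterS => s' ne.
rewrite -[LHS]/(Q s' * (q s' + q s)^-1 + q s) -[RHS]/(q s').
apply: (mulIf ne); rewrite mulrDl divfK// /Q -!q2; ring.
Qed.

End displacements.

(** * Equilibria *)

Section solutions.
Context {R : realType}.
Local Notation mu := (@lebesgue_measure R).
Local Notation I01 := (`[0%R, 1%R]%classic : set (measurableTypeR R)).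
Variables (w p p2 : R -> R) (k bm d : R) (n : nat).
Hypotheses (hw : concave_convex w p p2 k) (bm0 : 0 < bm) (bm1 : bm <= 1) (d0 : 0 < d).
Hypothesis n0 : (0 < n)%N.
Variables (W : R -> R) (gamma eps : R).
Hypotheses (eps0 : 0 < eps) (WE : forall x, 0 <= x -> dWstar W gamma x = p x).

Notation crest := (crest bm).
Notation trough := (trough bm).
Notation height := (height bm).
Notation orbit_gap := (orbit_gap w p p2 bm).
Notation slowness := (slowness w p p2 bm d).
Notation half_mass := (half_mass w p p2 bm d).
Notation half_time := (half_time w p p2 bm d).
Notation mass_density := (mass_density w p p2 bm d).
Notation load := (load w p p2 bm d).
Notation duration := (duration w p p2 bm d n).
Notation profile := (profile n hw bm0 bm1 d0).
Notation momentum := (momentum n hw bm0 bm1 d0).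
Notation slope := (slope n hw bm0 bm1 d0).
Notation displacementH := (displacementH hw bm0 bm1 d0 n0).

Lemma profile_itv z s : trough z <= profile (z, s) <= crest z.
Proof. exact: (height_itv bm0 bm1 (z, angle n hw bm0 bm1 d0 (z, s))). Qed.

Lemma displacementHE z s : 0 <= s <= 1 -> displacementH z s = load z * profile (z, s) - 1.
Proof. by move=> s01; rewrite -[LHS]/(displacement n hw bm0 bm1 d0 z s) /displacement s01. Qed.

Lemma equilibrium_load_gt0 z : 0 < load z. Proof. exact: (load_gt0 hw bm0 bm1 d0). Qed.

(** Where the gap is not cut off and the mass over n half periods fits, the orbit
    satisfies eps u'' = load ^ 3 (p - m) with u' = 0 at both ends. Tested with the
    mean-zero function v - u, the variational inequality is an equality. This
    includes the orbits with trough 0, which touch the obstacle tangentially. *)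
Lemma displacementH_solution z : (forall t, d <= orbit_gap (z, t)) ->
  half_mass z * (n%:R * Num.sqrt eps) = 1 -> solution W gamma eps (load z, displacementH z).
Proof.
move=> Gd mass1; have l0 := equilibrium_load_gt0 z.
split => //.
  move=> s; rewrite in_itv/= => s01; rewrite -[leRHS]/(displacementH z s) (displacementHE z s01) lerBrDr addNr.
  rewrite mulr_ge0 ?(ltW l0)//.
  by have /andP[h _] := profile_itv z s; apply: le_trans h; exact: trough_ge0.
move=> v _; set u := displacementH z; pose f s := slope (z, s).
pose m := divdiff w p (trough z) (crest z).
pose f' s := load z * duration z * (duration z * (p (profile (z, s)) - m)).
have df (s : R) : is_derive s 1 f (f' s).
  exact: (is_deriveZ (load z * duration z) (momentum_derive n hw bm0 bm1 d0 s Gd)).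
have cf : continuous f by move=> s; exact: is_derive_continuous (df s).
have cpr : continuous (fun s => profile (z, s)).
  exact: (continuous_slice2 (x := z) (@profile_cont _ _ _ _ _ _ _ n hw bm0 bm1 d0)).
have cpp : continuous (fun s => p (profile (z, s))).
  move=> s; apply: (@continuous_comp _ _ _ (fun s => profile (z, s)) p); first exact: cpr.
  exact: (cc_cont hw).
have cf' : continuous f'.
  move=> s; apply: (@continuousM _ _ (cst (load z * duration z)) (fun s => duration z * (p (profile (z, s)) - m))).
    exact: cst_continuous.
  apply: (@continuousM _ _ (cst (duration z)) (fun s => p (profile (z, s)) - m)).
    exact: cst_continuous.
  by apply: continuousB; [exact: cpp|exact: cst_continuous].
have f0 : f 0 = 0 by rewrite /f /slope /momentum /= angle0 sin0 !(mulr0, mul0r).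
have f1 : f 1 = 0.
  have sinn : sin (n%:R * pi) = 0 :> R.
    elim: (n) => [|j IH]; first by rewrite mul0r sin0.
    by rewrite -addn1 natrD mulrDl mul1r sinDpi IH oppr0.
  by rewrite /f /slope /momentum /= angle1 sinn !(mulr0, mul0r).
have ODE s : load z ^+ 3 * p (profile (z, s)) = eps * f' s + load z ^+ 3 * m.
  have lE : load z ^+ 2 = eps * duration z ^+ 2.
    have -> : load z = Num.sqrt eps * duration z.
      have M0 := half_mass_gt0 hw bm0 bm1 d0 z.
      rewrite /load /duration; apply: (mulIf (lt0r_neq0 M0)).
      rewrite divfK ?gt_eqF//.
      transitivity (half_time z * (half_mass z * (n%:R * Num.sqrt eps))); last by ring.
      by rewrite mass1 mulr1.
    by rewrite exprMn sqr_sqrtr// ltW.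
  have -> : load z ^+ 3 = load z * (eps * duration z ^+ 2) by rewrite -lE; ring.
  by rewrite /f'; ring.
have vu : H1_derivative (v - u) (H1m_deriv (v - u)) by exact: H1m_derivP.
set g := H1m_deriv (v - u) in vu *.
have [mg ig2 _] := vu; have ig := L2_L1 mg ig2.
have iw := H1_derivative_integrable vu.
have [mu1 _ _] := H1m_derivP u.
have aeu := H1_derivative_ae (H1m_derivP u) (displacement_H1 n hw bm0 bm1 d0 z).
rewrite (@eq_Rintegral _ _ _ mu _ (fun s => eps * H1m_deriv u s * g s +
    load z ^+ 3 * p (profile (z, s)) * (v - u) s)); last first.
  move=> s; rewrite inE/= in_itv/= => s01.
  have h0 : 0 <= profile (z, s).
    by have /andP[h _] := profile_itv z s; apply: le_trans h; exact: trough_ge0.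
  rewrite -[(1 + u s)]/(1 + displacementH z s) (displacementHE z s01).
  have -> : (1 + (load z * profile (z, s) - 1)) / load z = profile (z, s).
    by field; rewrite gt_eqF.
  by rewrite WE.
have -> : \int[mu]_(s in I01) (eps * H1m_deriv u s * g s +
    load z ^+ 3 * p (profile (z, s)) * (v - u) s) =
  \int[mu]_(s in I01) (eps * f s * g s + load z ^+ 3 * p (profile (z, s)) * (v - u) s).
  have mp : measurable_fun I01 (fun s => load z ^+ 3 * p (profile (z, s)) * (v - u) s).
    apply: measurable_funM.
      apply: measurable_funM => //.
      by apply: measurable_funS (@continuous_measurable_fun _ _ cpp).
    by have /measurable_int/measurable_EFinP := iw.
  rewrite /Rintegral; congr fine; apply: ae_eq_integral; first exact: mI01.
  - apply/measurable_EFinP; apply: measurable_funD => //.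
    by apply: measurable_funM => //; apply: measurable_funM.
  - apply/measurable_EFinP; apply: measurable_funD => //.
    apply: measurable_funM => //; apply: measurable_funM => //.
    by apply: measurable_funS (@continuous_measurable_fun _ _ cf).
  apply: (@filterS _ _ (ae_filter_ringOfSetsType mu)) aeu => s /= H s01.
  by rewrite H.
rewrite (@eq_Rintegral _ _ _ mu _ (fun s => eps * (f s * g s + f' s * (v - u) s) +
    load z ^+ 3 * m * (v - u) s)); last by move=> s _; rewrite ODE; ring.
have i1 := integrableD mI01 (integrable_continuousM cf ig) (integrable_continuousM cf' iw).
rewrite RintegralD; last 3 first.
- exact: mI01.
- exact: (integrableZl mI01 eps i1).
- exact: (integrableZl mI01 (load z ^+ 3 * m) iw).
rewrite RintegralZl; [|exact: mI01|exact: i1].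
rewrite RintegralZl; [|exact: mI01|exact: iw].
have [_ -> _] := H1m_zero_mean (v - u).
rewrite (H1_by_parts df cf' f0 f1 vu) !mulr0 addr0//.
Qed.

Lemma displacementH_fractured z : z.1 = 0 -> displacementH z 0 = -1.
Proof.
move=> z1; rewrite displacementHE ?lexx ?ler01// /profile angle0 height0.
by rewrite /trough z1 /clamp min_r ?ler01// maxxx mul0r mulr0 sub0r.
Qed.

Lemma displacementH_interior z : 0 < trough z -> coneKo (displacementH z).
Proof.
move=> z0; have h s : s \in `[0, 1] -> -1 < displacementH z s.
  rewrite in_itv/= => s01; rewrite -[ltRHS]/(displacementH z s) (displacementHE z s01) ltrBrDr addNr.
  rewrite mulr_gt0 ?equilibrium_load_gt0//.
  by have /andP[h _] := profile_itv z s; apply: lt_le_trans h.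
by split => // s /h /ltW.
Qed.

Lemma displacementH_neq0 z : trough z < crest z -> displacementH z != 0.
Proof.
move=> ab; apply/eqP => u0.
have nR : 0 < n%:R :> R by rewrite ltr0n.
have e1 : displacementH z 0 = 0 by rewrite u0.
have e2 : displacementH z n%:R^-1 = 0 by rewrite u0.
have ninv : 0 <= (n%:R^-1 : R) <= 1 by rewrite invr_ge0 (ltW nR)/= invf_le1// ler1n.
rewrite displacementHE ?lexx ?ler01// /profile angle0 height0 in e1.
rewrite displacementHE// /profile angle_half// heightpi in e2.
have : load z * trough z < load z * crest z by rewrite ltr_pM2l// equilibrium_load_gt0.
lra.
Qed.

Lemma displacementH_diag z : trough z = crest z -> displacementH z = 0 /\ load z = (crest z)^-1.
Proof.
move=> ab; have h0 := crest_gt0 bm0 bm1 z.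
have hE t : height (z, t) = crest z by rewrite /height /= ab subrr mul0r subr0.
have ME : half_mass z = crest z * half_time z.
  rewrite /half_mass /half_time -primZ; last first.
    exact: (slowness_slice hw bm0 bm1 (z := z) d0).
  by congr prim; apply/funext => t; rewrite /mass_density hE.
have lE : load z = (crest z)^-1.
  rewrite /load ME; have := half_time_gt0 hw bm0 bm1 d0 z => T0.
  by field; rewrite !gt_eqF.
split => //; apply/val_inj/funext => s.
rewrite -[RHS]/(0 : R) -[LHS]/(displacement n hw bm0 bm1 d0 z s) /displacement.
case: ifP => // _.
by rewrite lE /profile hE mulVf ?gt_eqF// subrr.
Qed.

(** The mean 1 / load of the height is at most the crest. *)
Lemma load_gt1 z : crest z < 1 -> 1 < load z.
Proof.
move=> h1; rewrite /load ltr_pdivlMr ?mul1r ?(half_mass_gt0 hw bm0 bm1 d0)//.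
apply: (@le_lt_trans _ _ (crest z * half_time z)); last first.
  by rewrite gtr_pMl// (half_time_gt0 hw bm0 bm1 d0).
have sc := slowness_slice hw bm0 bm1 (z := z) d0.
rewrite /half_time -primZ//; apply: le_prim; first exact: pi_ge0.
- exact: (mass_density_slice hw bm0 bm1 (z := z) d0).
- by move=> t; apply: (@continuousM _ _ (cst (crest z)) (fun t => slowness (z, t))); [exact: cst_continuous|exact: sc].
move=> t _; rewrite ler_wpM2r//; first by rewrite ltW// slowness_gt0.
by have /andP[] := height_itv bm0 bm1 (z, t).
Qed.

End solutions.

(** * Roots of the characteristic equation *)

Section characteristic_roots.
Context {R : realType}.
Variables (W : R -> R) (gamma kappa eps : R) (lambda : nat -> R).
Hypotheses (hW : stored_energy W gamma kappa) (eps0 : 0 < eps)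
  (hl : char_roots W kappa eps lambda).
Notation p2 := (dual_p2 W).

Lemma char_root_dual m l : 0 < l ->
  char_root W eps m l <-> eps * m%:R ^+ 2 * pi ^+ 2 * (l^-1) ^+ 2 = - p2 l^-1.
Proof.
move=> l0; rewrite /char_root (Wstar_fin2E hW) ?invr_gt0// exprVn.
by split => [[]|].
Qed.

Lemma lambda_gt1 m : (0 < m)%N -> 1 < lambda m.
Proof.
move=> m0; have /andP[k0 k1] := energy_kappa hW.
have k1' : 1 < kappa^-1 by rewrite invf_gt1.
apply: (lt_trans k1'); apply: lt_le_trans (char_gt_kappa hl) _.
case: m m0 => [//|[|m]] _; first exact: lexx.
by apply/ltW; exact: (char_increasing hl).
Qed.

Let lambda_gt0 m : (0 < m)%N -> 0 < lambda m.
Proof. by move=> m0; exact: lt_trans (lambda_gt1 m0). Qed.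

Lemma p2_lambda m : (0 < m)%N ->
  p2 (lambda m)^-1 = - (eps * m%:R ^+ 2 * pi ^+ 2 * (lambda m)^-1 ^+ 2).
Proof.
move=> m0; have := (char_unique hl _ m0).2 (erefl (lambda m)).
by move/(char_root_dual _ (lambda_gt0 m0)) => ->; rewrite opprK.
Qed.

(** At the points 1 / lambda m, which accumulate at 0 only, the quotient
    - p2(h) / h ^ 2 takes the arbitrarily large values eps (m pi) ^ 2. If it were
    below eps (N pi) ^ 2 somewhere left of 1 / lambda N, it would take the latter
    value once more in between, against the uniqueness of the roots. *)
Lemma p2_below_root N x : (0 < N)%N -> 0 < x <= (lambda N)^-1 ->
  p2 x <= - (eps * N%:R ^+ 2 * pi ^+ 2 * x ^+ 2).
Proof.
move=> N0 /andP[x0 xN]; rewrite leNgt; apply/negP => lt.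
have hcc := dual_concave_convex hW.
have cp2 (y : R) : 0 < y -> {for y, continuous p2} by move=> y0; exact: (cc_cont2 hcc y0).
have pi0 := pi_gt0 R.
have xN' : x < (lambda N)^-1.
  rewrite lt_neqAle xN andbT; apply/eqP => e.
  by move: lt; rewrite e p2_lambda// ltxx.
have [m Nm mx] : exists2 m, (N < m)%N & (lambda m)^-1 < x.
  apply: contrapT => nm.
  have [c _ Lc] : exists2 c, c \in `[x, (lambda N)^-1] &
      forall t, t \in `[x, (lambda N)^-1] -> `|p2 t| <= `|p2 c|.
    apply: (@EVT_max R (fun y => `|p2 y|)); first exact: ltW.
    apply: continuous_in_subspaceT => y; rewrite inE /= in_itv/= => /andP[xy _].
    by apply: cvg_norm; apply: cp2; exact: lt_le_trans xy.
  pose B := eps * pi ^+ 2 * x ^+ 2.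
  have B0 : 0 < B by rewrite !mulr_gt0// exprn_gt0.
  pose m := maxn N.+1 (Num.truncn (`|p2 c| / B)).+1.
  have Nm : (N < m)%N by rewrite leq_max ltnSn.
  have m0 : (0 < m)%N by apply: leq_trans Nm.
  have xm : x <= (lambda m)^-1.
    by rewrite leNgt; apply/negP => h; apply: nm; exists m.
  have mN : (lambda m)^-1 <= (lambda N)^-1.
    by rewrite lef_pV2 ?posrE ?lambda_gt0// ltW// (char_increasing hl).
  have := Lc (lambda m)^-1; rewrite in_itv/= xm mN => /(_ isT).
  rewrite p2_lambda// normrN ger0_norm; last first.
    by rewrite ltW// !mulr_gt0 ?exprn_gt0 ?ltr0n ?invr_gt0 ?lambda_gt0.
  apply/negP; rewrite -ltNge.
  have h1 : `|p2 c| < B * m%:R.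
    rewrite mulrC -ltr_pdivrMr//; apply: lt_le_trans (truncnS_gt _) _.
    by rewrite ler_nat leq_max leqnn orbT.
  apply: lt_le_trans h1 _.
  have -> : eps * m%:R ^+ 2 * pi ^+ 2 * (lambda m)^-1 ^+ 2 =
    (eps * pi ^+ 2 * (lambda m)^-1 ^+ 2) * m%:R ^+ 2 by ring.
  have m1 : 1 <= m%:R :> R by rewrite ler1n.
  apply: ler_pM; [exact: ltW|by rewrite ler0n| |].
    rewrite /B ler_pM2l ?mulr_gt0 ?exprn_gt0//.
    by rewrite ler_pXn2r ?nnegrE ?(ltW x0)// (le_trans (ltW x0)).
  by rewrite expr2 ler_pMl// (lt_le_trans ltr01).
have m0 : (0 < m)%N by exact: leq_trans Nm.
pose g y := eps * N%:R ^+ 2 * pi ^+ 2 * y ^+ 2 + p2 y.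
have hm0 : 0 < (lambda m)^-1 by rewrite invr_gt0 lambda_gt0.
have gm : g (lambda m)^-1 < 0.
  rewrite /g p2_lambda// subr_lt0 ltr_pM2r ?exprn_gt0//.
  by rewrite ltr_pM2r ?exprn_gt0// ltr_pM2l// ltr_pXn2r ?nnegrE ?ler0n// ltr_nat.
have gx : 0 < g x by move: lt; rewrite /g; lra.
have [|||y] := @IVT R g (lambda m)^-1 x 0.
- exact: ltW.
- apply: continuous_in_subspaceT => y; rewrite inE /= in_itv/= => /andP[my _].
  have c1 : {for y, continuous (fun y : R => eps * N%:R ^+ 2 * pi ^+ 2 * y ^+ 2)}.
    by apply: continuousM; [exact: cst_continuous|exact: exprn_continuous].
  exact: (continuousD c1 (cp2 y (lt_le_trans hm0 my))).
- by rewrite ge_min le_max (ltW gm) (ltW gx) orbT.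
rewrite in_itv/= => /andP[my yx] gy.
have y0 : 0 < y by exact: lt_le_trans my.
have : char_root W eps N y^-1.
  apply/(char_root_dual _ _); first by rewrite invr_gt0.
  by rewrite invrK; move: gy; rewrite /g => /eqP; rewrite addr_eq0 => /eqP.
move/(char_unique hl _ N0) => e.
by move: xN'; rewrite -e invrK ltNge yx.
Qed.

End characteristic_roots.

(** * The continuum from bifurcation to fracture *)

Theorem corollary4p4 (R : realType) (W : R -> R) (gamma kappa eps : R)
    (lambda : nat -> R)
    (hW : stored_energy W gamma kappa)
    (heps : 0 < eps)
    (hlambda : char_roots W kappa eps lambda) :
  forall n : nat, (0 < n)%N ->
    exists p : R * H1m R,
      [/\ (closure (subbranch W gamma eps (lambda n)) `&`
            [set q | 0 < q.1]) p,
          fractured W gamma eps p,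
          bdryK p.2 &
          1 < p.1].
Proof.
move=> n n0.
have hcc := dual_concave_convex hW.
have WE x (x0 : 0 <= x) := dWstarE hW x0.
have lgt1 m m0 : 1 < lambda m := lambda_gt1 hW hlambda (m := m) m0.
have lgt0 m (m0 : (0 < m)%N) : 0 < lambda m := lt_trans ltr01 (lgt1 m m0).
have nR : 0 < n%:R :> R by rewrite ltr0n.
have pi0 := pi_gt0 R.
have N0 : (0 < 3 * n)%N by rewrite muln_gt0.
(* any N > sqrt 6 * n instead of 3 * n makes the mass small on the side crest = bm *)
pose bm := (lambda (3 * n)%N)^-1.
have bm0 : 0 < bm by rewrite invr_gt0 lgt0.
have bm1' : bm < 1 by rewrite invf_lt1 ?lgt1// lgt0.
have bm1 := ltW bm1'.
(* the half mass of the orbits whose n half periods fit into [0, 1] *)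
pose c := (n%:R * Num.sqrt eps)^-1.
have se0 : 0 < Num.sqrt eps by rewrite sqrtr_gt0.
have c0 : 0 < c by rewrite invr_gt0 mulr_gt0.
have [d d0 Hd] := uniform_gap hcc bm0 bm1 c.
pose M := half_mass (dual_w W gamma) (dual_p W gamma) (dual_p2 W) bm d.
pose f z := M z - c.
have cf : continuous f.
  move=> z; apply: (@continuousB _ _ _ M (cst c)); last exact: cst_continuous.
  exact: (half_mass_cont hcc bm0 bm1 d0).
have crestE s b : bm <= b <= 1 -> crest bm (s, b) = b by move=> bin; rewrite /crest clamp_id.
have troughE s b : 0 <= s <= 1 -> bm <= b <= 1 -> trough bm (s, b) = s * b.
  by move=> sin bin; rewrite /trough crestE// clamp_id.
have fbm s : 0 <= s <= 1 -> f (s, bm) < 0.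
  move=> sin; rewrite subr_lt0.
  pose Q := eps * (3 * n)%:R ^+ 2 * pi ^+ 2.
  have Q0 : 0 < Q by rewrite !mulr_gt0 ?exprn_gt0 ?ltr0n.
  have HQ x : 0 < x <= bm -> dual_p2 W x <= - (Q * x ^+ 2).
    by move=> xin; exact: (p2_below_root hW heps hlambda N0 xin).
  have hb : crest bm (s, bm) = bm by rewrite crestE// lexx.
  apply: le_lt_trans (half_mass_small hcc bm0 bm1 d0 Q0 HQ hb) _.
  have qn : 0 <= pi * Num.sqrt (6 / Q) by rewrite mulr_ge0 ?sqrtr_ge0// ltW.
  rewrite -(@ltr_pXn2r _ 2)// ?nnegrE ?(ltW c0)//.
  rewrite exprMn sqr_sqrtr ?divr_ge0 ?(ltW Q0)// /c exprVn exprMn sqr_sqrtr ?(ltW heps)//.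
  have -> : pi ^+ 2 * (6 / Q) = 2 / 3 * (n%:R ^+ 2 * eps)^-1.
    rewrite /Q natrM; move: (pi : R) pi0 => P P0.
    by field; rewrite !gt_eqF.
  rewrite gtr_pMl ?invr_gt0 ?mulr_gt0 ?exprn_gt0//; lra.
have f1 s : 0 <= s <= 1 -> 0 < f (s, 1).
  move=> sin; rewrite ltNge; apply/negP; rewrite subr_le0 => le.
  have rs : rect 0 1 bm 1 (s, 1) by split => //=; rewrite bm1 lexx.
  have := lt_le_trans d0 (Hd _ rs le pi).
  have h1 : crest bm (s, 1) = 1 by rewrite crestE// bm1 lexx.
  by rewrite ltNge (orbit_gap_at1 hcc bm0 bm1 h1).
pose h := (lambda n)^-1.
have f_t1 b : bm <= b <= 1 -> f (1, b) = 0 -> b = h.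
  move=> bin /eqP; rewrite subr_eq0 => /eqP Mc.
  have rs : rect 0 1 bm 1 (1, b) by split => //=; rewrite ler01 lexx.
  have le : M (1, b) <= c by rewrite Mc.
  have ab : trough bm (1, b) = crest bm (1, b) by rewrite troughE ?crestE ?ler01 ?lexx// mul1r.
  have [] := half_mass_diag hcc bm0 bm1 d0 ab (Hd _ rs le).
  rewrite -/(M _) Mc crestE// => p20 cE.
  have b0 : 0 < b by apply: lt_le_trans bm0 _; case/andP: bin.
  have : char_root W eps n b^-1.
    have V0 : 0 < b^-1 by rewrite invr_gt0.
    apply/(char_root_dual eps hW n V0).
    rewrite invrK; have s0 : 0 < Num.sqrt (- dual_p2 W b) by rewrite sqrtr_gt0.
    have e : n%:R * Num.sqrt eps * (b * pi) = Num.sqrt (- dual_p2 W b).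
      have -> : b * pi = c * Num.sqrt (- dual_p2 W b).
        by rewrite cE; field; rewrite gt_eqF.
      by rewrite mulrA divff ?mul1r// mulf_neq0// gt_eqF.
    rewrite -[RHS]sqr_sqrtr ?(ltW p20)// -e !exprMn sqr_sqrtr ?(ltW heps)//.
    by ring.
  by move=> /(char_unique hlambda _ n0) e; rewrite /h -e invrK.
pose Psi (z : R * R) : R * H1m R :=
  (load (dual_w W gamma) (dual_p W gamma) (dual_p2 W) bm d z, displacementH hcc bm0 bm1 d0 n0 z).
have cPsi : continuous Psi.
  by move=> z; apply: continuous_pair; [exact: (load_cont hcc bm0 bm1 d0)|exact: displacementH_cont].
have sol z : rect 0 1 bm 1 z -> f z = 0 -> solution W gamma eps (Psi z).
  move=> rz /eqP; rewrite subr_eq0 => /eqP Mc.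
  have le : M z <= c by rewrite Mc.
  apply: displacementH_solution => //; first exact: Hd.
  by rewrite -/(M z) Mc /c mulVf// mulf_neq0// gt_eqF.
have hbm : bm <= h <= 1.
  have h1 : h < 1 by rewrite invf_lt1 ?lgt1// lgt0.
  rewrite (ltW h1) andbT lef_pV2 ?posrE ?lgt0// ltW// (char_increasing hlambda)//.
  by rewrite ltn_Pmull.
have Psih : Psi (1, h) = (lambda n, 0).
  have ab : trough bm (1, h) = crest bm (1, h) by rewrite troughE ?crestE ?ler01 ?lexx// mul1r.
  have [e1 e2] := displacementH_diag hcc bm0 bm1 d0 n0 ab.
  by rewrite /Psi e1 e2 crestE// invrK.
(* Stopping at r > 0 keeps the continuum in the interior of the cone; the orbits
   that reach 0 are then approached by letting r tend to 0. *)
have reach (r : R) : 0 < r -> r < 1 -> exists b, [/\ bm <= b <= 1, f (r, b) = 0 &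
    subbranch W gamma eps (lambda n) (Psi (r, b))].
  move=> r0 r1.
  have in01 s : r <= s <= 1 -> 0 <= s <= 1.
    by move=> /andP[rs ->]; rewrite (le_trans (ltW r0)).
  have [C [cC Csub Ch [b Cb]]] := level_continuum cf r1 bm1'
    (fun s sin => fbm s (in01 s sin)) (fun s sin => f1 s (in01 s sin)) f_t1.
  have Crect z : C z -> rect 0 1 bm 1 z.
    by move=> /Csub [[h1 h2] _]; split => //; exact: in01.
  have Cf z : C z -> f z = 0 by move=> /Csub [].
  have Clo z : C z -> 0 < trough bm z.
    move=> Cz; have [h1 h2] := Crect _ Cz.
    case: z Cz h1 h2 => z1 z2 Cz h1 h2; rewrite troughE//.
    have [[/andP[h3 _] /andP[h4 _]] _] := Csub _ Cz.
    by apply: mulr_gt0; [exact: lt_le_trans r0 h3|exact: lt_le_trans bm0 h4].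
  have nontriv z : C z -> z.1 < 1 -> nontrivial_solutions W gamma eps (Psi z).
    move=> Cz z1; split; first exact: sol (Crect _ Cz) (Cf _ Cz).
    apply: displacementH_neq0; have [h1 h2] := Crect _ Cz.
    case: z Cz h1 h2 z1 => z1 z2 Cz h1 h2 /= z11; rewrite troughE// crestE//.
    by rewrite gtr_pMl//; case/andP: h2 => h2 _; exact: lt_le_trans bm0 h2.
  have clos z : C z -> closure (nontrivial_solutions W gamma eps) (Psi z).
    move=> Cz; have [z1|z1] := ltP z.1 1.
      by apply: subset_closure; exact: nontriv.
    have zE : z = (1, h).
      have [h1 h2] := Crect _ Cz; case: z Cz z1 h1 h2 => z1 z2 Cz /= z11 h1 h2.
      have e1 : z1 = 1 by apply/le_anti; rewrite z11 andbT; case/andP: h1.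
      by subst z1; rewrite (f_t1 z2 h2 (Cf _ Cz)).
    move=> B nB; have nV : nbhs z (Psi @^-1` B) by exact: cPsi.
    apply: contrapT => noB.
    have [U [oU Uz] UB] : exists2 U, open_nbhs z U & U `<=` Psi @^-1` B.
      by move: nV; rewrite nbhsE => -[U]; exists U.
    have single y : C y -> U y -> y = z.
      move=> Cy Uy; have [y1|y1] := ltP y.1 1.
        by exfalso; apply: noB; exists (Psi y); split; [exact: nontriv|exact: UB].
      rewrite zE; have [h1 h2] := Crect _ Cy; case: y Cy Uy y1 h1 h2 => y1 y2 Cy _ /= y11 h1 h2.
      have e1 : y1 = 1 by apply/le_anti; rewrite y11 andbT; case/andP: h1.
      by subst y1; rewrite (f_t1 y2 h2 (Cf _ Cy)).
    (* otherwise the bifurcation point would be isolated in the connected set C *)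
    have : [set z] = C.
      apply: cC; first by exists z.
        exists U => //; apply/seteqP; split => [_ ->//|y [Cy Uy]]; exact: single.
      exists [set z]; first exact: accessible_closed_set1 (hausdorff_accessible (@norm_hausdorff _ _)) z.
      by apply/seteqP; split => [_ -> //|y []].
    move=> E; have : [set z] (r, b) by rewrite E.
    by rewrite zE => -[e _]; move: r1; rewrite e ltxx.
  have cimg : connected (Psi @` C).
    by apply: connected_continuous_connected => //; exact: continuous_subspaceT.
  have himg : (Psi @` C) (lambda n, 0) by rewrite -Psih; exists (1, h).
  have sub1 : Psi @` C `<=` branch W gamma eps (lambda n).
    apply: connected_component_max => // _ [z Cz <-]; split; first exact: clos.
    exact: (load_gt0 hcc bm0 bm1 d0).
  have sub2 : Psi @` C `<=` subbranch W gamma eps (lambda n).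
    apply: connected_component_max => // _ [z Cz <-]; split.
      by apply: sub1; exists z.
    split; first exact: (load_gt0 hcc bm0 bm1 d0).
    by apply: displacementH_interior; exact: Clo.
  have [_ bin] := Crect _ Cb.
  by exists b; split => //; [exact: Cf|apply: sub2; exists (r, b)].
have hr j : 0 < (j.+2%:R^-1 : R) /\ (j.+2%:R^-1 : R) < 1.
  by rewrite invr_gt0 ltr0n invf_lt1 ?ltr0n// ltr1n.
have /choice[b_ Hb] : forall j, exists b, [/\ bm <= b <= 1, f (j.+2%:R^-1, b) = 0 &
    subbranch W gamma eps (lambda n) (Psi (j.+2%:R^-1, b))].
  by move=> j; apply: reach; have [] := hr j.
pose z_ j : R * R := (j.+2%:R^-1, b_ j).
have zrect j : rect 0 1 bm 1 (z_ j).
  have [bin _ _] := Hb j; have [r0 r1] := hr j.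
  by split => //=; rewrite !ltW.
have [z [[z1in z2in] clz]] : rect 0 1 bm 1 `&` cluster (z_ @ \oo) !=set0.
  by apply: rect_compact; exists 0%N => // j _; exact: zrect.
have limP (A : set (R * R)) : closed A -> (\forall j \near \oo, A (z_ j)) -> A z.
  move=> cA nA; apply: cA => V nV; exact: (clz _ _ nA nV).
have fz : f z = 0.
  apply: (limP [set z | f z = 0]); first exact: (closed_preimage cf (@closed_eq _ 0)).
  by exists 0%N => // j _; have [] := Hb j.
have z1 : z.1 = 0.
  apply/le_anti; rewrite (andP z1in).1 andbT; apply/ler_addgt0Pr => e e0; rewrite add0r.
  apply: (limP [set z | z.1 <= e]).
    by apply: (@closed_preimage _ _ fst [set x | x <= e]) => [x|]; [exact: cvg_fst|exact: closed_le].
  near=> j; rewrite /z_ /=.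
  have je : e^-1 <= j%:R by near: j; exact: nbhs_infty_ger.
  rewrite -[leRHS]invrK lef_pV2 ?posrE ?invr_gt0 ?ltr0n//.
  by rewrite (le_trans je)// ler_nat !leqW.
have hiz : crest bm z = z.2 by case: z z2in {z1in clz limP fz z1} => a b bin; exact: crestE.
have z21 : z.2 < 1.
  rewrite lt_neqAle (andP z2in).2 andbT; apply/eqP => e.
  have := f1 z.1 z1in; rewrite -e; move: fz; case: (z) => a b /= ->.
  by rewrite ltxx.
have sz := sol z (conj z1in z2in) fz.
have u0 : (Psi z).2 0 = -1 by exact: (displacementH_fractured hcc bm0 bm1 d0 n0 z1).
have I0 : (0 : R) \in `[0, 1] by rewrite in_itv/= lexx ler01.
exists (Psi z); split.
- split; last exact: (load_gt0 hcc bm0 bm1 d0).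
  move=> B nB; have nV : nbhs z (Psi @^-1` B) by exact: cPsi.
  have : (z_ @ \oo) (Psi @^-1` (subbranch W gamma eps (lambda n))).
    by exists 0%N => // j _; have [] := Hb j.
  by move=> /clz /(_ nV) [y [sy By]]; exists (Psi y).
- by split => //; exists 0.
- split; first by case: sz.
  by move=> [_ /(_ 0 I0)]; rewrite u0 ltxx.
- by apply: (load_gt1 hcc bm0 bm1 d0); rewrite hiz.
Unshelve. all: by end_near. Qed.
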